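(* Let $a$ and $b$ be continuous and $a>0$ on $(-M,N)$, and let $\mu,\nu,\lambda^{\mathrm{DD}},\lambda^{\mathrm{NN}}$ be associated with $L=a(x)\frac{d^2}{dx^2}+b(x)\frac{d}{dx}$ as in the context. Let $\mathcal C_+=\{f\in C(-M,N): f>0\text{ on }(-M,N)\}$. (1) Assume that $\nu(-M,N)<\infty$. For $f\in\mathcal C_+$ and $\theta\in(-M,N)$ put $$h^-(z)=\int_{-M}^z\nu(dx)\int_x^{\theta}f\,d\mu\quad(z\le\theta),\qquad h^+(z)=\int_z^N\nu(dx)\int_{\theta}^xf\,d\mu\quad(z\geq\theta),$$ where $\theta=\theta(f)$ is the unique root of $h^-(\theta)=h^+(\theta)$ (provided $h^\pm<\infty$), and set $I\!I^{\pm}(f)(z)=h^{\pm}(z)/f(z)$. Then $$\lambda^{\mathrm{DD}}=\sup_{f\in\mathcal C_+}\min\Big\{\inf_{z\in(-M,\theta)}I\!I^-(f)(z)^{-1},\ \inf_{z\in(\theta,N)}I\!I^+(f)(z)^{-1}\Big\}.$$ (2) Assume that $\mu(-M,N)<\infty$. For $f\in\mathcal C_+$ and $\theta\in(-M,N)$ put instead $$h^-(z)=\int_{-M}^z\mu(dx)\int_x^{\theta}f\,d\nu\quad(z\le\theta),\qquad h^+(z)=\int_z^N\mu(dx)\int_{\theta}^xf\,d\nu\quad(z\geq\theta),$$ where $\theta=\theta(f)$ is the unique root of $h^-(\theta)=h^+(\theta)$ (provided $h^\pm<\infty$), and set $I\!I^{\pm}(f)(z)=h^{\pm}(z)/f(z)$.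 Then $$\lambda^{\mathrm{NN}}=\sup_{f\in\mathcal C_+}\min\Big\{\inf_{z\in(-M,\theta)}I\!I^-(f)(z)^{-1},\ \inf_{z\in(\theta,N)}I\!I^+(f)(z)^{-1}\Big\}.$$
   Context: Let $M,N\in(0,\infty]$. Fix a reference point $x_0\in(-M,N)$ and put $C(x)=\int_{x_0}^x\frac ba\,du$, $\mu(dx)=\frac{e^{C(x)}}{a(x)}dx$, $\nu(dx)=e^{-C(x)}dx$. $\|\cdot\|$ is the norm of $L^2(\mu)$, $\mu(f)=\int f\,d\mu$, $D(f)=\int_{-M}^N(f')^2e^{C}dx$, $\mathcal A(-M,N)$ is the set of absolutely continuous functions on $(-M,N)$, and $\mathcal A_0(-M,N)$ is the subset of functions with compact support. Then $$\lambda^{\mathrm{DD}}=\inf\{D(f): f\in\mathcal A_0(-M,N),\ \|f\|=1\},$$ $$\lambda^{\mathrm{NN}}=\inf\{D(f): f\in\mathcal A(-M,N),\ \mu(f)=0,\ \|f\|=1\}.$$ Convention: a function $f\in\mathcal C_+$ for which $h^-$ or $h^+$ is infinite contributes $0$ to the supremum ($I\!I^\pm(f)^{-1}$ read as $1/\infty=0$). *)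

(* Defs.v *)
From HB Require Import structures.
From mathcomp Require Import all_boot all_order all_algebra.
From mathcomp Require Import all_classical all_reals all_analysis.

Set Implicit Arguments.
Unset Strict Implicit.
Unset Printing Implicit Defensive.

Import Order.TTheory GRing.Theory Num.Theory.
Import numFieldNormedType.Exports.

Local Open Scope classical_set_scope.
Local Open Scope ring_scope.

Section general.
Context {R : realType}.
Implicit Types (f w : R -> R) (A : set R).

(* The real interval (l, r), with possibly infinite endpoints. *)
Definition ereal_itv (l r : \bar R) : set R :=
  [set x | (l < x%:E)%E /\ (x%:E < r)%E].

(* \int_A g(x) w(x) dx, the integral of g over A against the measure w(x)dx.
   The densities used below are only meaningful on (-M, N), so A is always a
   subset of that interval. *)
Definition integral_density w A (g : R -> \bar R) : \bar R :=
  (\int[lebesgue_measure]_(x in A) (g x * (w x)%:E))%E.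

(* The signed integral from x0 to x. *)
Definition oriented_integral f (x0 x : R) : R :=
  if x0 <= x then \int[lebesgue_measure]_(u in `[x0, x]) f u
  else - \int[lebesgue_measure]_(u in `[x, x0]) f u.

(* Absolute continuity on an interval A, in the epsilon-delta form. The closed
   intervals [l i, r i] may share endpoints. *)
Definition absolutely_continuous A f : Prop :=
  forall e : R, 0 < e -> exists2 d : R, 0 < d &
    forall (n : nat) (l r : 'I_n -> R),
      (forall i, A (l i) /\ A (r i) /\ l i <= r i) ->
      (forall i j, i != j -> `]l i, r i[ `&` `]l j, r j[ = set0) ->
      \sum_(i < n) (r i - l i) < d ->
      \sum_(i < n) `|f (r i) - f (l i)| < e.

Definition compact_support_in A f : Prop :=
  exists K : set R, [/\ compact K, K `<=` A &
    forall x, A x -> ~ K x -> f x = 0].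

End general.

Section diffusion.
Context {R : realType}.
Variables (M N : \bar R) (x0 : R) (a b : R -> R).
Implicit Types f : R -> R.

Local Notation I := (ereal_itv (- M)%E N).

Definition C_fun (x : R) : R := oriented_integral (fun u => b u / a u) x0 x.

Definition mu_density (x : R) : R := expR (C_fun x) / a x.

Definition nu_density (x : R) : R := expR (- C_fun x).

Definition mu_integral f : \bar R :=
  integral_density mu_density I (fun x => (f x)%:E).

Definition L2mu_norm f : \bar R :=
  (integral_density mu_density I (fun x => (f x ^+ 2)%:E) `^ 2^-1)%E.

(* derive1 f is a total function; an absolutely continuous f is differentiable
   almost everywhere, so its values elsewhere do not matter here. *)
Definition D_form f : \bar R :=
  integral_density (fun x => expR (C_fun x)) I (fun x => (derive1 f x ^+ 2)%:E).

Definition lambdaDD : \bar R :=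
  ereal_inf [set D_form f | f in
    [set f | [/\ absolutely_continuous I f, compact_support_in I f &
                 L2mu_norm f = 1%E]]].

Definition lambdaNN : \bar R :=
  ereal_inf [set D_form f | f in
    [set f | [/\ absolutely_continuous I f, mu_integral f = 0%E &
                 L2mu_norm f = 1%E]]].

End diffusion.

(* p is the density of the outer measure and q that of the inner one, so that
   (p, q) is (nu, mu) for the DD problem and (mu, nu) for the NN problem. *)
Section double_integral.
Context {R : realType}.
Variables (M N : \bar R) (p q : R -> R).
Implicit Types (f : R -> R) (theta z : R).

Local Notation I := (ereal_itv (- M)%E N).

Definition Cplus f : Prop :=
  {within I, continuous f} /\ (forall x, I x -> 0 < f x).

Definition h_minus f theta z : \bar R :=
  integral_density p (ereal_itv (- M)%E z%:E)
    (fun x => integral_density q `[x, theta] (fun u => (f u)%:E)).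

Definition h_plus f theta z : \bar R :=
  integral_density p (ereal_itv z%:E N)
    (fun x => integral_density q `[theta, x] (fun u => (f u)%:E)).

(* h^- and h^+ are finite. When p is integrable on (-M, N) and q is locally
   integrable, this does not depend on the choice of theta and z. *)
Definition h_finite f : Prop :=
  forall theta z, I theta -> I z ->
    ((z <= theta)%R -> (h_minus f theta z < +oo)%E) /\
    ((theta <= z)%R -> (h_plus f theta z < +oo)%E).

Definition h_root f theta : Prop :=
  I theta /\ h_minus f theta theta = h_plus f theta theta.

Definition II_minus f theta z : \bar R := (h_minus f theta z / (f z)%:E)%E.

Definition II_plus f theta z : \bar R := (h_plus f theta z / (f z)%:E)%E.

Definition lower_estimate f theta : \bar R :=
  Order.min
    (ereal_inf [set ((II_minus f theta z)^-1)%E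
               | z in ereal_itv (- M)%E theta%:E])
    (ereal_inf [set ((II_plus f theta z)^-1)%E
               | z in ereal_itv theta%:E N]).

(* The value v contributed by f: theta is the unique root when h^- and h^+ are
   finite, and otherwise the contribution is 0 by convention (1/oo = 0). *)
Definition contribution f (v : \bar R) : Prop :=
  (h_finite f /\
     exists2 theta, unique (h_root f) theta & v = lower_estimate f theta) \/
  (~ h_finite f /\ v = 0%E).

Definition sup_lower_estimate : \bar R :=
  ereal_sup [set v | exists2 f, Cplus f & contribution f v].

End double_integral.

(* Main.v *)
Require Import Defs.
From HB Require Import structures.
From mathcomp Require Import all_boot all_order all_algebra.
From mathcomp Require Import all_classical all_reals all_analysis.
From mathcomp Require Import measurable_realfun.
From mathcomp Require Import ring lra.
Import Order.TTheory GRing.Theory Num.Theory.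
Import numFieldNormedType.Exports.
Local Open Scope classical_set_scope.
Local Open Scope ring_scope.

(** Write p for the density of the outer measure of the double integrals and q
    for the inner one. Since e^C = 1/nu, both variational problems have the same
    shape: minimise the integral of phi'^2/p under the constraint that phi^2 q
    has integral 1 and phi has compact support (Dirichlet, p = nu, q = mu), or
    minimise the integral of phi'^2/q under the constraint that phi p has
    integral 0 and phi^2 p has integral 1 (Neumann, p = mu, q = nu). In both
    cases p is integrable, and the infimum is shown to equal
    sup_lower_estimate M N p q (dirichlet_duality, neumann_duality).

    Each f bounds the infimum from below. If h^- or h^+ is infinite this only
    says that energies are nonnegative. Otherwise suppose that
    c h^-(z) <= f(z) to the left of theta and c h^+(z) <= f(z) to the right of
    it. On either side of theta, phi (or phi - phi(theta) in the Neumann case) is the integral of its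
    derivative psi from an endpoint at which it vanishes. A Cauchy-Schwarz
    inequality with a weight w, followed by Tonelli's theorem, then gives c as a
    lower bound (weighted_hardy); one takes for w the integral of f q between
    the current point and theta in the Dirichlet case, and w = f in the Neumann
    case. In the Neumann case subtracting phi(theta) from a function of mean
    zero only increases its L^2 norm. That phi is the integral of its derivative
    is the fundamental theorem for absolutely continuous functions
    (chain_ac_derive): phi is the difference of two nondecreasing absolutely
    continuous functions, their Lebesgue-Stieltjes measures have densities by
    the Radon-Nikodym theorem, and Lebesgue differentiation identifies these
    densities with the derivative almost everywhere.

    Conversely, the supremum reaches the infimum. For lam > 0 consider the
    linear system g' = p k, k' = - lam q g. Sturm's dichotomy
    (positive_solution_or_conjugate) says that either some solution has g > 0 on
    the whole interval, or some nontrivial solution has two zeros a < b of g. In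
    the first case the double integrals of f = g can be computed, because -k/lam
    is a primitive of g q, and at the root theta they satisfy lam h^- <= g and
    lam h^+ <= g, so that lam is at most the supremum (le_sup_lower_estimate).
    In the second case a test function of energy at most lam exists: in the
    Dirichlet case g itself, extended by 0 outside [a, b]; in the Neumann case
    k, extended by constants outside [a, b] and then centred. Hence no lam can
    lie strictly between the supremum and the infimum. *)

Set Implicit Arguments.
Unset Strict Implicit.
Unset Printing Implicit Defensive.

(** * Chains of intervals and absolute continuity *)

Section chains.
Context {R : realType}.
Implicit Types (a b : R) (f : R -> R) (s : seq (R * R)).

(** A family of disjoint intervals in [a, b] is kept as a list of its pairs of
    endpoints in increasing order, so that induction and concatenation apply;
    consecutive intervals may share an endpoint. *)
Fixpoint chain a s b : bool :=
  if s is c :: s' then [&& a <= c.1, c.1 <= c.2 & chain c.2 s' b] else a <= b.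

Definition chain_length s : R := \sum_(c <- s) (c.2 - c.1).

Definition chain_variation f s : R := \sum_(c <- s) `|f c.2 - f c.1|.

Lemma chain_le a s b : chain a s b -> a <= b.
Proof.
by elim: s a => //= c s ih a /and3P[ac cc /ih]; apply: le_trans; exact: le_trans cc.
Qed.

Lemma chain_weakl a a' s b : a' <= a -> chain a s b -> chain a' s b.
Proof.
by case: s => [|c s] /= aa'; [exact: le_trans|move=> /and3P[ac -> ->]; rewrite (le_trans aa')].
Qed.

Lemma chain_cat a s t b c : chain a s b -> chain b t c -> chain a (s ++ t) c.
Proof.
elim: s a => [|d s ih] a /=; first exact: chain_weakl.
by move=> /and3P[-> -> sb] tc /=; exact: ih.
Qed.

Lemma chain_catE a s t c : chain a (s ++ t) c ->
  exists2 b, chain a s b & chain b t c.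
Proof.
elim: s a => [|d s ih] a /=; first by exists a.
by move=> /and3P[-> -> /ih[b sb tc]]; exists b.
Qed.

Lemma chain_in a s b c : chain a s b -> c \in s ->
  [/\ a <= c.1, c.1 <= c.2 & c.2 <= b].
Proof.
elim: s a => //= d s ih a /and3P[ad dd sb]; rewrite inE => /predU1P[->|/(ih _ sb)[h1 h2 h3]].
  by split=> //; exact: chain_le sb.
by split=> //; rewrite (le_trans _ h1)// (le_trans ad).
Qed.

Lemma chain_nth a s b i j : chain a s b -> (i < j < size s)%N ->
  (nth (0, 0) s i).2 <= (nth (0, 0) s j).1.
Proof.
elim: s a i j => [a i j|d s ih a i j]; first by rewrite /= ltn0 andbF.
rewrite [chain _ _ _]/= => /and3P[ad dd sb] /andP[].
case: j => // j; case: i => [_ js|i ij js] /=.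
  have js' : (j < size s)%N by [].
  by have [] := chain_in sb (mem_nth (0, 0) js').
by apply: ih sb _; rewrite -ltnS ij.
Qed.

Lemma chain_length_cat s t :
  chain_length (s ++ t) = chain_length s + chain_length t.
Proof. exact: big_cat. Qed.

Lemma chain_variation_cat f s t :
  chain_variation f (s ++ t) = chain_variation f s + chain_variation f t.
Proof. exact: big_cat. Qed.

(** An ordered chain is a disjoint family, whose intervals are indexed by
    their position in the list. *)
Lemma absolutely_continuous_chain (A : set R) f a b :
  absolutely_continuous A f -> `[a, b] `<=` A ->
  forall e, 0 < e -> exists2 d, 0 < d & forall s, chain a s b ->
    chain_length s < d -> chain_variation f s < e.
Proof.
move=> acf abA e /acf[d d0 H]; exists d => // s sab.
have sA (i : 'I_(size s)) : [/\ a <= (tnth (in_tuple s) i).1,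
   (tnth (in_tuple s) i).1 <= (tnth (in_tuple s) i).2 &
   (tnth (in_tuple s) i).2 <= b].
  by apply: (chain_in sab); exact: mem_tnth.
rewrite /chain_length /chain_variation !(big_tnth _ _ s); apply: H => [i|i j ij].
  have [h1 h2 h3] := sA i; split; [|split=> //]; apply: abA => /=; rewrite in_itv/=.
    by rewrite h1 (le_trans h2).
  by rewrite h3 (le_trans h1).
rewrite -subset0 => x [/=]; rewrite !in_itv/= => /andP[ix xi] /andP[jx xj].
have [ij'|ji|/ord_inj/eqP] := ltngtP i j; last by rewrite (negbTE ij).
  have : (tnth (in_tuple s) i).2 <= (tnth (in_tuple s) j).1.
    by rewrite !(tnth_nth (0, 0)); apply: chain_nth sab _; rewrite ij' /=.
  by move=> /(lt_le_trans xi)/lt_trans/(_ jx); rewrite ltxx.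
have : (tnth (in_tuple s) j).2 <= (tnth (in_tuple s) i).1.
  by rewrite !(tnth_nth (0, 0)); apply: chain_nth sab _; rewrite ji /=.
by move=> /(lt_le_trans xj)/lt_trans/(_ ix); rewrite ltxx.
Qed.

Definition partition_chain a (s : seq R) := pairmap pair a s.

Lemma partition_chainP a b (s : seq R) : itv_partition a b s -> chain a (partition_chain a s) b.
Proof.
move=> [+ /eqP]; elim: s a => [|x s ih] a /=; first by move=> _ ->.
by move=> /andP[ax xs] sb; rewrite lexx (ltW ax); exact: ih.
Qed.

Lemma partition_chain_length a b (s : seq R) : itv_partition a b s ->
  chain_length (partition_chain a s) = b - a.
Proof.
rewrite /chain_length => -[+ /eqP]; elim: s a => [|x s ih] a /=.
  by move=> _ ->; rewrite big_nil subrr.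
by move=> /andP[_ /ih h] /h; rewrite big_cons => ->; rewrite /=; lra.
Qed.

Lemma partition_chain_variation a b (s : seq R) f :
  variation a b f s = chain_variation f (partition_chain a s).
Proof.
rewrite /variation/= /chain_variation.
elim: s a => [|x s ih] a; first by rewrite !big_nil.
by rewrite big_nat_recl//= ih [RHS]big_cons.
Qed.

Local Notation TV := (@total_variation R).

(** The total variation of f on an interval is a supremum over its partitions,
    and a partition of one interval of a chain refines the chain without changing
    its length. Hence the intervals of s can be treated one at a time, those
    already refined being collected in the prefix t of the induction. *)
Lemma chain_total_variation f a b e d :
  (forall s, chain a s b -> chain_length s < d -> chain_variation f s < e) ->
  forall s, chain a s b -> chain_length s < d ->
  (\sum_(c <- s) TV c.1 c.2 f <= e%:E)%E.
Proof.
move=> H s sab sd.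
suff: forall t, chain a (t ++ s) b -> chain_length (t ++ s) < d ->
  ((chain_variation f t)%:E + \sum_(c <- s) TV c.1 c.2 f <= e%:E)%E.
  by move=> /(_ [::] sab sd); rewrite /chain_variation big_nil add0e.
elim: s {sab sd} => [|c s ih] t; first by rewrite cats0 big_nil adde0 lee_fin => h /(H _ h)/ltW.
move=> tcs tcsd.
have [h tch] := chain_catE tcs; rewrite /= => /and3P[hc cc scb].
have tsd : chain_length (t ++ s) < d.
  move: tcsd; rewrite !chain_length_cat /chain_length big_cons; lra.
have ts : chain a (t ++ s) b.
  by apply: chain_cat tch _; apply: chain_weakl scb; exact: le_trans cc.
have := ih _ ts tsd.
set S := (\sum_(j <- s) _)%E => tSe.
have S0 : (0 <= S)%E.
  rewrite /S big_seq; apply: sume_ge0 => j js; apply: total_variation_ge0.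
  by have [] := chain_in scb js.
have Sfin : S \is a fin_num.
  rewrite ge0_fin_numE//; apply: le_lt_trans (ltry (e - chain_variation f t)).
  by rewrite EFinB leeBrDl.
rewrite big_cons -/S addeC -addeA -leeBrDr; last by rewrite fin_numD Sfin.
rewrite {1}/TV; apply: ge_ereal_sup => _ [_ [p pp <-] <-].
rewrite leeBrDr; last by rewrite fin_numD Sfin.
rewrite partition_chain_variation addeCA -EFinD addeC.
rewrite [X in X%:E]addrC -chain_variation_cat /S; apply: ih.
  rewrite -catA; apply: chain_cat tch _; apply: chain_cat scb.
  exact/(chain_weakl hc)/partition_chainP.
move: tcsd; rewrite !chain_length_cat (partition_chain_length pp).
by rewrite /chain_length big_cons; lra.
Qed.

End chains.

(** * Lebesgue-Stieltjes measure of open sets *)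

Section stieltjes.
Context {R : realType}.
Notation mu := (@lebesgue_measure R).
Implicit Types (a b : R) (s : seq (R * R)) (G : cumulative R R).

Lemma lebesgue_stieltjes_measure_itvoc G a b : a <= b ->
  lebesgue_stieltjes_measure G `]a, b]%classic = (G b - G a)%:E.
Proof.
move=> ab; rewrite /lebesgue_stieltjes_measure/= /measure_extension/=.
by rewrite measurable_mu_extE/= ?wlength_itv_bnd//; exact: is_ocitv.
Qed.

Lemma chain_length_le_measure (U : set R) a s b : measurable U -> chain a s b ->
  (forall c, c \in s -> `]c.1, c.2] `<=` U) ->
  ((chain_length s)%:E <= mu (U `&` `]a, b]))%E.
Proof.
move=> mU; elim: s a => [|c s ih] a /=; first by rewrite /chain_length big_nil.
move=> /and3P[ac cc sb] sU.
have mUI (x y : R) : measurable (U `&` `]x, y]) by exact: measurableI.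
rewrite /chain_length big_cons EFinD.
have -> : ((c.2 - c.1)%:E = mu `]c.1, c.2])%E.
  rewrite lebesgue_measure_itv/= lte_fin EFinB; case: ltgtP cc => // -> _.
  by rewrite subee.
apply: (@le_trans _ _ (mu `]c.1, c.2] + mu (U `&` `]c.2, b]))%E).
  by rewrite leeD2l//; apply: ih => // d ds; apply: sU; rewrite inE ds orbT.
rewrite -measureU//=; last 2 first.
  exact: measurableI.
  rewrite -subset0 => x [/=]; rewrite in_itv/= => /andP[_ h] [_].
  by rewrite in_itv/= => /andP[/(le_lt_trans h)]; rewrite ltxx.
apply: (@le_measure _ _ _ mu); rewrite ?inE; [apply: measurableU => //; exact: mUI|exact: mUI|].
move=> x [xc|[Ux]].
  split; first by apply: (sU c) => //; rewrite mem_head.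
  move: xc; rewrite /= !in_itv/= => /andP[h xc].
  by rewrite (le_lt_trans ac)//= (le_trans xc (chain_le sb)).
rewrite /= in_itv/= => /andP[h xb]; split=> //; rewrite in_itv/= xb.
by rewrite (le_lt_trans ac)// (le_lt_trans cc).
Qed.

Definition chain_cover s : set R := \big[setU/set0]_(c <- s) `]c.1, c.2]%classic.

Lemma chain_coverP s x : chain_cover s x <-> exists2 c, c \in s & x \in `]c.1, c.2].
Proof.
rewrite /chain_cover; split.
  rewrite -bigcup_seq => -[c /= cs xc]; exists c => //.
by move=> [c cs xc]; rewrite -bigcup_seq; exists c.
Qed.

Lemma measurable_chain_cover s : measurable (chain_cover s).
Proof. by apply: bigsetU_measurable => c _; exact: measurable_itv. Qed.

(** Subadditivity of the measure. *)
Lemma chain_cover_measure_le G a s b : chain a s b ->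
  (lebesgue_stieltjes_measure G (chain_cover s) <=
   (\sum_(c <- s) (G c.2 - G c.1))%:E)%E.
Proof.
elim: s a => [|c s ih] a; first by rewrite /chain_cover !big_nil measure0.
move=> /and3P[ac cc sb]; rewrite /chain_cover !big_cons EFinD.
apply: le_trans (measureU2 _ _ _) _ => //; first exact: measurable_chain_cover.
by apply: leeD; [rewrite -lebesgue_stieltjes_measure_itvoc|exact: ih sb].
Qed.

Section dyadic.
Variables (U : set R) (a b : R).
Hypothesis ab : a < b.

Definition dyadic_pt n (k : nat) : R := a + (b - a) * (k%:R / 2 ^+ n).

Definition dyadic_cell n k : R * R := (dyadic_pt n k, dyadic_pt n k.+1).

(** The dyadic cells of level n contained in U: chains that increase to
    U in ]a, b] when U is open. *)
Definition dyadic_cells n : seq (R * R) :=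
  [seq dyadic_cell n k | k <- iota 0 (2 ^ n) &
     `[< `](dyadic_cell n k).1, (dyadic_cell n k).2] `<=` U >]].

Lemma dyadic_pt_le n (i j : nat) : (i <= j)%N -> dyadic_pt n i <= dyadic_pt n j.
Proof.
move=> ij; rewrite lerD2l ler_pM2l ?subr_gt0// ler_pM2r ?invr_gt0 ?exprn_gt0//.
by rewrite ler_nat.
Qed.

Lemma dyadic_pt0 n : dyadic_pt n 0 = a.
Proof. by rewrite /dyadic_pt mul0r mulr0 addr0. Qed.

Lemma dyadic_ptN n : dyadic_pt n (2 ^ n) = b.
Proof. by rewrite /dyadic_pt natrX divff ?expf_neq0// mulr1; lra. Qed.

Lemma dyadic_ptD n k : dyadic_pt n.+1 k.*2 = dyadic_pt n k.
Proof.
rewrite /dyadic_pt -muln2 natrM exprS; congr (_ + _ * _).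
by rewrite invfM mulrA mulfK// pnatr_eq0.
Qed.

Lemma dyadic_cells_chain n : chain a (dyadic_cells n) b.
Proof.
have aux m i : (i + m <= 2 ^ n)%N ->
  chain (dyadic_pt n i) [seq dyadic_cell n k | k <- iota i m &
     `[< `](dyadic_cell n k).1, (dyadic_cell n k).2] `<=` U >]]
     (dyadic_pt n (2 ^ n)).
  elim: m i => [i|m ih i iN] /=; first by rewrite addn0; exact: dyadic_pt_le.
  have := ih i.+1; rewrite addSnnS => /(_ iN) h.
  case: ifP => _ /=; first by rewrite lexx dyadic_pt_le.
  exact/(chain_weakl _ h)/dyadic_pt_le.
by rewrite -[X in chain X](dyadic_pt0 n) -(dyadic_ptN n); exact: aux.
Qed.

Lemma dyadic_cells_sub n c : c \in dyadic_cells n -> `]c.1, c.2] `<=` U.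
Proof. by move=> /mapP[k]; rewrite mem_filter => /andP[/asboolP + _] ->. Qed.

Lemma chain_cover_dyadicP n x : chain_cover (dyadic_cells n) x <->
  exists k, [/\ (k < 2 ^ n)%N, dyadic_pt n k < x <= dyadic_pt n k.+1 &
    `]dyadic_pt n k, dyadic_pt n k.+1] `<=` U].
Proof.
split=> [/chain_coverP[c /mapP[k]]|[k [kn xk kU]]].
  rewrite mem_filter => /andP[/asboolP kU]; rewrite mem_iota => /andP[_ kn] ->.
  by rewrite in_itv/= => xk; exists k.
apply/chain_coverP; exists (dyadic_cell n k); last by rewrite in_itv.
by apply: map_f; rewrite mem_filter mem_iota/= kn andbT; exact/asboolP.
Qed.

Lemma chain_cover_dyadicS n :
  chain_cover (dyadic_cells n) `<=` chain_cover (dyadic_cells n.+1).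
Proof.
move=> x /chain_cover_dyadicP[k [kn /andP[kx xk] kU]].
apply/chain_cover_dyadicP.
have kSn : (k.*2.+1 < 2 ^ n.+1)%N by rewrite expnS mul2n -doubleS leq_double.
have e1 := dyadic_ptD n k; have e2 := dyadic_ptD n k.+1.
have l1 : dyadic_pt n.+1 k.*2 <= dyadic_pt n.+1 k.*2.+1 by exact: dyadic_pt_le.
have l2 : dyadic_pt n.+1 k.*2.+1 <= dyadic_pt n.+1 k.*2.+2 by exact: dyadic_pt_le.
have [h|h] := leP x (dyadic_pt n.+1 k.*2.+1).
  exists k.*2; split; [exact: ltnW|by rewrite e1 kx h|].
  move=> y /=; rewrite in_itv/= e1 => /andP[ky yk]; apply: kU => /=.
  by rewrite in_itv/= ky (le_trans yk)// -e2.
exists k.*2.+1; split; [by []|by rewrite h -doubleS e2|].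
move=> y /=; rewrite in_itv/= -doubleS e2 => /andP[ky yk]; apply: kU => /=.
by rewrite in_itv/= yk (le_lt_trans _ ky)// -e1.
Qed.

(** A point x of U has a neighbourhood in U, which contains the cell of x as
    soon as the mesh is smaller than its radius. *)
Lemma bigcup_chain_cover_dyadic : open U ->
  \bigcup_n chain_cover (dyadic_cells n) = U `&` `]a, b].
Proof.
move=> oU; apply/seteqP; split=> [x [n _ /chain_coverP[c cs xc]]|x [Ux]].
  split; first exact: (dyadic_cells_sub cs).
  have [h1 h2 h3] := chain_in (dyadic_cells_chain n) cs.
  move: xc; rewrite /= !in_itv/= => /andP[cx xc].
  by rewrite (le_lt_trans h1)//= (le_trans xc).
rewrite /= in_itv/= => /andP[ax xb].
have /nbhs_ballP[e /= e0 eU] : nbhs x U by exact: open_nbhs_nbhs.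
have [n _ hn] : exists2 n, True & (b - a) / 2 ^+ n < e.
  have e0' : 0 < e / (b - a) by rewrite divr_gt0// subr_gt0.
  have /cvgrPdist_lt/(_ _ e0')[N _ HN] :=
    @cvg_expr R 2^-1 ltac:(by rewrite ger0_norm// invf_lt1// ltr1n).
  exists N => //; have := HN N (leqnn _); rewrite sub0r normrN ger0_norm.
    by rewrite exprVn ltr_pdivlMr ?subr_gt0// mulrC.
  by rewrite exprn_ge0.
exists n => //; apply/chain_cover_dyadicP.
have ex : exists k, x <= dyadic_pt n k by exists (2 ^ n)%N; rewrite dyadic_ptN.
(* The least grid point above x is the right end of the half-open cell of x. *)
case: (ex_minnP ex) => -[|k] xk kmin.
  by move: xk; rewrite dyadic_pt0 => /(lt_le_trans ax); rewrite ltxx.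
have kx : dyadic_pt n k < x.
  by rewrite ltNge; apply/negP => /kmin; rewrite ltnn.
exists k; split.
- by apply: kmin; rewrite dyadic_ptN.
- by rewrite kx xk.
move=> y /=; rewrite in_itv/= => /andP[ky yk]; apply: eU => /=.
rewrite /ball/= ltr_distl.
have : dyadic_pt n k.+1 = dyadic_pt n k + (b - a) / 2 ^+ n.
  by rewrite /dyadic_pt -natr1; set z := _^-1; ring.
by move=> E; apply/andP; split; lra.
Qed.

End dyadic.

(** Exhausting U by chains of dyadic cells turns the chain estimate into
    an estimate for the measure of U; the chains have length less than d because
    they lie in U. *)
Lemma lebesgue_stieltjes_open_le G a b d e (U : set R) : a < b -> open U ->
  (mu U < d%:E)%E ->
  (forall s, chain a s b -> chain_length s < d ->
     \sum_(c <- s) (G c.2 - G c.1) <= e) ->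
  (lebesgue_stieltjes_measure G (U `&` `]a, b]) <= e%:E)%E.
Proof.
move=> ab oU Ud H; have mU : measurable U by exact: open_measurable.
rewrite -bigcup_chain_cover_dyadic//.
have mC n : measurable (chain_cover (dyadic_cells U a b n)).
  exact: measurable_chain_cover.
have homC : {homo (fun n => chain_cover (dyadic_cells U a b n)) :
    n m / (n <= m)%N >-> (n <= m)%O}.
  move=> n m; rewrite subsetEset; elim: m => [|m ih]; first by rewrite leqn0 => /eqP ->.
  rewrite leq_eqVlt => /predU1P[->//|/ih h].
  by apply: subset_trans h _; exact: chain_cover_dyadicS.
have := nondecreasing_cvg_mu (mu := lebesgue_stieltjes_measure G) mC
  (bigcup_measurable (fun k _ => mC k)) homC.
move=> /cvg_lim <-//; apply: lime_le.
  apply: ereal_nondecreasing_is_cvgn => n m nm.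
  apply: le_measure; rewrite ?inE; [exact: mC|exact: mC|].
  by have := homC _ _ nm; rewrite subsetEset.
apply: nearW => n /=; have cn := dyadic_cells_chain U ab n.
apply: le_trans (chain_cover_measure_le G cn) _; rewrite lee_fin; apply: H => //.
rewrite -lte_fin; apply: le_lt_trans Ud.
apply: le_trans (chain_length_le_measure mU cn (@dyadic_cells_sub _ _ _ n)) _.
by apply: le_measure; rewrite ?inE//; exact: measurableI.
Qed.

End stieltjes.

(** * Densities of absolutely continuous functions *)

Section density.
Context {R : realType}.
Notation mu := (@lebesgue_measure R).
Implicit Types (a b : R) (s : seq (R * R)) (G : cumulative R R).

(** Absolute continuity of the function G makes its Lebesgue-Stieltjes
    measure absolutely continuous with respect to Lebesgue measure: a null set
    lies in open sets of arbitrarily small Lebesgue measure, whose Stieltjes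
    measure is small by lebesgue_stieltjes_open_le. The Radon-Nikodym derivative
    is the density. The measure is restricted to ]a, b] to make it finite. *)
Lemma cumulative_density G a b : a < b ->
  (forall e, 0 < e -> exists2 d, 0 < d & forall s, chain a s b ->
     chain_length s < d -> \sum_(c <- s) (G c.2 - G c.1) <= e) ->
  exists psi : R -> R, mu.-integrable setT (EFin \o psi) /\
    forall x y, a <= x -> x <= y -> y <= b ->
      (G y - G x)%:E = (\int[mu]_(t in `]x, y]) (psi t)%:E)%E.
Proof.
move=> ab H.
pose m : {measure set (measurableTypeR R) -> \bar R} := lebesgue_stieltjes_measure G.
have mE x y : x <= y -> m `]x, y]%classic = (G y - G x)%:E.
  exact: lebesgue_stieltjes_measure_itvoc.
have mab : measurable (`]a, b]%classic : set (measurableTypeR R)) by exact: measurable_itv.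
have mfin : (m `]a, b]%classic < +oo)%E.
  by rewrite mE ?ltry// ltW.
pose nu : {finite_measure set (measurableTypeR R) -> \bar R} := mfrestr mab mfin.
have nu_mu : nu `<< mu.
  apply/null_content_dominatesP => A mA A0.
  apply/eqP; rewrite eq_le measure_ge0 andbT; apply/lee_addgt0Pr => e e0.
  rewrite add0e; have [d d0 Hd] := H _ e0.
  have Aoo : (mu A < +oo)%E by rewrite [X in (X < _)%E](_ : _ = 0%E).
  have [U [oU AU Ud]] := lebesgue_regularity_outer mA Aoo d0.
  have mU : measurable U by exact: open_measurable.
  have Ud' : (mu U < d%:E)%E.
    rewrite -(setDUK AU); apply: le_lt_trans Ud.
    apply: le_trans (measureU2 _ _ _) _ => //; first exact: measurableD.
    by rewrite [X in (X + _)%E](_ : _ = 0%E) ?add0e.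
  apply: le_trans (lebesgue_stieltjes_open_le ab oU Ud' Hd).
  apply: (@le_measure _ _ _ nu); rewrite ?inE.
  - exact: mA.
  - exact: mU.
  - exact: AU.
pose f := Radon_Nikodym_SigmaFinite.f nu mu.
have fi := Radon_Nikodym_SigmaFinite.f_integrable nu_mu.
have ffin := Radon_Nikodym_SigmaFinite.f_fin_num nu_mu.
have fE : EFin \o (fine \o f) = f by apply/funext => x /=; rewrite fineK// ffin.
exists (fine \o f); split; first by rewrite fE.
move=> x y ax xy yb.
rewrite (_ : (fun t : R => ((fine \o f) t)%:E) = f)//.
have xyab : `]x, y]%classic = `]x, y]%classic `&` `]a, b]%classic :> set R.
  apply/esym/setIidPl => z /=; rewrite !in_itv/= => /andP[xz zy].
  by rewrite (le_lt_trans ax)//= (le_trans zy).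
rewrite -mE// [X in m X]xyab.
exact: (Radon_Nikodym_SigmaFinite.f_integral nu_mu (measurable_itv _)).
Qed.

End density.

Section clamp.
Context {R : realType}.
Implicit Types (a b x y : R).

Definition clamp a b x : R := if x <= a then a else if x <= b then x else b.

Lemma clamp_itv a b x : a <= b -> a <= clamp a b x <= b.
Proof.
rewrite /clamp => ab; case: (leP x a) => ?; last case: (leP x b) => ?;
by apply/andP; split; lra.
Qed.

Lemma clamp_id a b x : a <= x <= b -> clamp a b x = x.
Proof.
rewrite /clamp => /andP[ax xb].
by case: (leP x a) => ?; last case: (leP x b) => ?; lra.
Qed.

Lemma clamp_le a b x y : a <= b -> x <= y -> clamp a b x <= clamp a b y.
Proof.
rewrite /clamp => ab xy; case: (leP x a) => ?; last case: (leP x b) => ?;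
by case: (leP y a) => ?; last case: (leP y b) => ?; lra.
Qed.

Lemma clamp_dist a b x y : a <= b -> x <= y -> clamp a b y - clamp a b x <= y - x.
Proof.
rewrite /clamp => ab xy; case: (leP x a) => ?; last case: (leP x b) => ?;
by case: (leP y a) => ?; last case: (leP y b) => ?; lra.
Qed.

End clamp.

Section ac_density.
Context {R : realType}.
Notation mu := (@lebesgue_measure R).
Notation TV := (@total_variation R).
Implicit Types (a b : R) (s : seq (R * R)) (f g : R -> R).

(** Absolute continuity on [a, b], stated with chains. *)
Definition chain_ac f a b := forall e, 0 < e -> exists2 d, 0 < d &
  forall s, chain a s b -> chain_length s < d -> chain_variation f s < e.

(** Composing g with the clamp to [a, b] makes it nondecreasing and
    right-continuous on the whole line, as a cumulative function must be. *)
Lemma nondecreasing_ac_density g a b : a < b ->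
  (forall x y, a <= x -> x <= y -> y <= b -> g x <= g y) ->
  (forall e, 0 < e -> exists2 d, 0 < d & forall s, chain a s b ->
     chain_length s < d -> \sum_(c <- s) (g c.2 - g c.1) <= e) ->
  exists psi : R -> R, mu.-integrable setT (EFin \o psi) /\
    forall x y, a <= x -> x <= y -> y <= b ->
      (g y - g x)%:E = (\int[mu]_(t in `]x, y]) (psi t)%:E)%E.
Proof.
move=> ab gnd gac; pose G := g \o clamp a b.
have Gnd : nondecreasing G.
  move=> x y xy; have /andP[h1 _] := clamp_itv x (ltW ab).
  have /andP[_ h2] := clamp_itv y (ltW ab).
  by apply: gnd => //; apply: clamp_le => //; exact: ltW.
have Gstep e : 0 < e -> exists2 d, 0 < d & forall x y, x <= y -> y - x < d ->
    G y - G x <= e.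
  move=> /gac[d d0 H]; exists d => // x y xy xyd.
  have /andP[ax _] := clamp_itv x (ltW ab).
  have /andP[_ yb] := clamp_itv y (ltW ab).
  have := H [:: (clamp a b x, clamp a b y)].
  rewrite /chain_length !big_cons !big_nil !addr0 /=; apply.
    by rewrite ax yb clamp_le// ltW.
  by apply: le_lt_trans xyd; apply: clamp_dist => //; exact: ltW.
have Grc : right_continuous G.
  move=> x; apply/cvgrPdist_le => e /Gstep[d d0 H].
  near=> y; have xy : x <= y by near: y; exact: nbhs_right_ge.
  rewrite distrC ger0_norm ?subr_ge0; last exact: Gnd.
  apply: H => //; rewrite ltrBlDl; near: y; apply: nbhs_right_lt; lra.
pose mG := isCumulative.Build R _ R G Gnd Grc.
pose cG : cumulative R R := HB.pack G mG.
have [|psi [ipsi Hpsi]] := @cumulative_density R cG a b ab.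
  move=> e /gac[d d0 H]; exists d => // s sab sd; have := H s sab sd.
  rewrite big_seq [X in _ -> X <= _]big_seq; apply: le_trans.
  apply: ler_sum => c cs; have [h1 h2 h3] := chain_in sab cs.
  by rewrite /cG /= /G /= !clamp_id// ?h1 ?h3 ?(le_trans h2) ?(le_trans _ h2).
exists psi; split=> // x y ax xy yb; rewrite -Hpsi// /cG/= /G/=.
by rewrite !clamp_id// ?ax ?yb ?(le_trans ax) ?(le_trans xy).
Unshelve. all: by end_near. Qed.

Lemma dyadic_pt_step a b n k :
  dyadic_pt a b n k.+1 - dyadic_pt a b n k = (b - a) / 2 ^+ n.
Proof. by rewrite /dyadic_pt -natr1; set z := _^-1; ring. Qed.

(** On each of the 2^n cells of a fine enough dyadic partition the variation
    is at most 1. *)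
Lemma chain_ac_total_variation f a b : a < b -> chain_ac f a b ->
  TV a b f \is a fin_num.
Proof.
move=> ab /(_ 1 ltr01)[d d0 H].
have [n hn] : exists n, (b - a) / 2 ^+ n < d.
  have e0' : 0 < d / (b - a) by rewrite divr_gt0// subr_gt0.
  have /cvgrPdist_lt/(_ _ e0')[N _ HN] :=
    @cvg_expr R 2^-1 ltac:(by rewrite ger0_norm// invf_lt1// ltr1n).
  exists N => //; have := HN N (leqnn _); rewrite sub0r normrN ger0_norm.
    by rewrite exprVn ltr_pdivlMr ?subr_gt0// mulrC.
  by rewrite exprn_ge0.
have le_pt i j : (i <= j)%N -> dyadic_pt a b n i <= dyadic_pt a b n j.
  exact: dyadic_pt_le.
have TVk k : (k <= 2 ^ n)%N -> (TV a (dyadic_pt a b n k) f <= k%:R%:E)%E.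
  elim: k => [_|k ih kn]; first by rewrite dyadic_pt0 total_variationxx.
  have a_pt : a <= dyadic_pt a b n k by have := le_pt 0%N k (leq0n k); rewrite dyadic_pt0.
  have pt_b : dyadic_pt a b n k.+1 <= b by have := le_pt _ _ kn; rewrite dyadic_ptN.
  rewrite (total_variationD f a_pt (le_pt _ _ (leqnSn k))).
  rewrite -natr1 EFinD leeD ?ih 1?ltnW//.
  have := chain_total_variation H (s := [:: (dyadic_pt a b n k, dyadic_pt a b n k.+1)]).
  rewrite /chain_length !big_cons !big_nil addr0 adde0 /=; apply.
    by rewrite a_pt le_pt//=.
  by rewrite dyadic_pt_step.
rewrite ge0_fin_numE; last by rewrite total_variation_ge0// ltW.
apply: le_lt_trans (ltry (2 ^ n)%:R).
by have := TVk _ (leqnn _); rewrite dyadic_ptN.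
Qed.

(** Jordan decomposition: with T(x) the variation of f on [a, x], both T and
    T - f are nondecreasing and absolutely continuous. *)
Lemma chain_ac_density f a b : a < b -> chain_ac f a b ->
  exists psi : R -> R, mu.-integrable setT (EFin \o psi) /\
    forall x y, a <= x -> x <= y -> y <= b ->
      (f y - f x)%:E = (\int[mu]_(t in `]x, y]) (psi t)%:E)%E.
Proof.
move=> ab fac; have TVab := chain_ac_total_variation ab fac.
have TVfin x y : a <= x -> x <= y -> y <= b -> TV x y f \is a fin_num.
  move=> ax xy yb; move: TVab.
  rewrite (total_variationD f ax (le_trans xy yb)).
  by rewrite (total_variationD f xy yb) !fin_numD => /and3P[].
pose T x := fine (TV a x f).
have TE x y : a <= x -> x <= y -> y <= b -> T y - T x = fine (TV x y f).
  move=> ax xy yb; rewrite /T (total_variationD f ax xy) fineD.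
  - by rewrite addrC addKr.
  - by apply: TVfin => //; exact: le_trans yb.
  - exact: TVfin.
have Tge x y : a <= x -> x <= y -> y <= b -> `|f y - f x| <= T y - T x.
  move=> ax xy yb; rewrite TE// -lee_fin fineK ?TVfin//.
  exact: total_variation_ge.
have Tac e : 0 < e -> exists2 d, 0 < d & forall s, chain a s b ->
     chain_length s < d -> \sum_(c <- s) (T c.2 - T c.1) <= e.
  move=> /fac[d d0 H]; exists d => // s sab sd.
  rewrite -lee_fin; apply: le_trans (chain_total_variation H sab sd).
  rewrite -sumEFin big_seq [leRHS]big_seq; apply: lee_sum => c cs.
  have [h1 h2 h3] := chain_in sab cs.
  by rewrite TE// fineK// TVfin.
have [psi1 [i1 H1]] : exists psi : R -> R, mu.-integrable setT (EFin \o psi) /\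
    forall x y, a <= x -> x <= y -> y <= b ->
      (T y - T x)%:E = (\int[mu]_(t in `]x, y]) (psi t)%:E)%E.
  apply: nondecreasing_ac_density => // x y ax xy yb.
  by rewrite -subr_ge0; apply: le_trans (Tge _ _ ax xy yb).
have [psi2 [i2 H2]] : exists psi : R -> R, mu.-integrable setT (EFin \o psi) /\
    forall x y, a <= x -> x <= y -> y <= b ->
      ((T \- f) y - (T \- f) x)%:E = (\int[mu]_(t in `]x, y]) (psi t)%:E)%E.
  apply: nondecreasing_ac_density => // [x y ax xy yb|e e0].
    by have := Tge _ _ ax xy yb; rewrite ler_norml/= => /andP[_]; lra.
  have e20 : 0 < e / 2 by rewrite divr_gt0.
  have [d1 d10 K1] := Tac _ e20; have [d2 d20 K2] := fac _ e20.
  exists (Num.min d1 d2); first by rewrite lt_min d10.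
  move=> s sab; rewrite lt_min => /andP[sd1 sd2].
  rewrite (splitr e); apply: le_trans (lerD (K1 _ sab sd1) (ltW (K2 _ sab sd2))).
  rewrite /chain_variation -big_split/= ler_sum// => c _.
  have : - (f c.2 - f c.1) <= `|f c.2 - f c.1| by rewrite -normrN ler_norm.
  by lra.
exists (psi1 \- psi2); split.
  by rewrite (_ : EFin \o _ = (EFin \o psi1) \- (EFin \o psi2))%E//; exact: integrableB.
move=> x y ax xy yb.
under eq_integral do rewrite EFinB.
rewrite integralB//; [|exact: integrableS i1|exact: integrableS i2].
by rewrite -H1// -H2// -EFinB; congr EFin; rewrite /=; lra.
Qed.

(** Lebesgue differentiation identifies the density with the derivative. *)
Lemma chain_ac_derive f a b : a < b -> chain_ac f a b ->
  exists psi : R -> R, [/\ mu.-integrable setT (EFin \o psi),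
    forall x y, a <= x -> x <= y -> y <= b ->
      (f y - f x)%:E = (\int[mu]_(t in `]x, y]) (psi t)%:E)%E &
    {ae mu, forall x, a < x < b -> derive1 f x = psi x}].
Proof.
move=> ab /(chain_ac_density ab)[psi [ipsi Hpsi]]; exists psi; split=> //.
have := @FTC1 R psi (BRight a).
have h1 (y : R) : mu.-integrable [set` Interval (BRight a) (BRight y)] (EFin \o psi).
  exact: integrableS ipsi.
have h2 : locally_integrable [set: R] psi.
  by apply: open_integrable_locally => //; exact: openT.
move=> /(_ h1 h2)/=; apply: filterS; first exact: (ae_filter_ringOfSetsType mu).
move=> x + /andP[ax xb].
rewrite lte_fin ax => /(_ isT)[dF <-]; rewrite !derive1E.
have -> : 'D_1 f x = 'D_1 (fun y => f y - f a) x.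
  by rewrite /derive; do 2 f_equal; apply/funext => h /=; rewrite opprB addrA subrK.
apply: near_eq_derive; near=> y.
have ay : a <= y by near: y; exact: lt_le_nbhsr.
have yb : y <= b by near: y; exact: lt_le_nbhsl.
by rewrite /Rintegral -Hpsi.
Unshelve. all: by end_near. Qed.

End ac_density.

(** * Comparison of integrals without measurability *)

Section nonmeasurable_integral.
Context d (T : measurableType d) (R : realType).
Variable mu : {measure set T -> \bar R}.
Implicit Types (D E N : set T) (f g : T -> \bar R).
Local Open Scope ereal_scope.

(** The integral of a nonnegative function is the supremum of the integrals
    of the simple functions below it, so it is monotone for arbitrary functions.
    This matters because the energy of phi is the integral of derive1 phi ^+ 2,
    whose measurability is not given. *)
Lemma ge0_le_integral_any D E f g :
  (forall x, D x -> 0 <= f x) -> (forall x, E x -> 0 <= g x) ->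
  (forall x, D x -> f x != 0 -> E x /\ f x <= g x) ->
  \int[mu]_(x in D) f x <= \int[mu]_(x in E) g x.
Proof.
move=> f0 g0 fg; rewrite !ge0_integralE//.
apply: ge_ereal_sup => _ [h /= hf <-]; apply: ereal_sup_ubound; exists h => //=.
move=> x; apply: le_trans (hf x) _; rewrite !patchE.
case: ifPn => [/set_mem Dx|_]; last by case: ifPn => // /set_mem /g0.
have [->|fx0] := eqVneq (f x) 0; first by case: ifPn => // /set_mem /g0.
by have [Ex fgx] := fg _ Dx fx0; rewrite mem_set.
Qed.

(** Raising g to +oo on the null set N leaves its integral unchanged, and
    makes the comparison hold everywhere. *)
Lemma ge0_le_integral_ae_l D E N f g : measurable E -> measurable N ->
  measurable_fun E g -> mu N = 0 ->
  (forall x, D x -> 0 <= f x) -> (forall x, E x -> 0 <= g x) ->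
  (forall x, D x -> f x != 0 -> ~ N x -> E x /\ f x <= g x) ->
  \int[mu]_(x in D) f x <= \int[mu]_(x in E) g x.
Proof.
move=> mE mN mg N0 f0 g0 fg; rewrite [leRHS]integral_mkcond.
have mgE : measurable_fun setT (g \_ E) by exact/(measurable_restrictT _ mE).1.
have gE0 x : 0 <= (g \_ E) x by exact: erestrict_ge0.
rewrite (ge0_negligible_integral mN measurableT mgE)//.
pose h x := if x \in N then +oo else (g \_ E) x.
have -> : \int[mu]_(x in setT `\` N) (g \_ E) x = \int[mu]_(x in setT `\` N) h x.
  by apply: eq_integral => x; rewrite inE => -[_ Nx]; rewrite /h memNset.
have mh : measurable_fun setT h.
  apply: measurable_fun_ifT => //; apply: (measurable_fun_bool true).
  rewrite setTI (_ : _ @^-1` _ = N)//.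
  by apply/seteqP; split => x /=; [exact: set_mem|exact: mem_set].
rewrite -(ge0_negligible_integral mN measurableT mh)//; last first.
  by move=> x _; rewrite /h; case: ifP.
apply: ge0_le_integral_any => // [x _|x Dx fx0]; first by rewrite /h; case: ifP.
split=> //; rewrite /h; case: ifPn => [_|/negP Nx]; first exact: leey.
have [|Ex] := fg x Dx fx0; first by move=> /mem_set.
by rewrite patchE mem_set.
Qed.

Lemma ge0_le_integral_ae_r D E N f g : measurable D -> measurable N ->
  measurable_fun D f -> mu N = 0 ->
  (forall x, D x -> 0 <= f x) -> (forall x, E x -> 0 <= g x) ->
  (forall x, D x -> ~ N x -> E x /\ f x <= g x) ->
  \int[mu]_(x in D) f x <= \int[mu]_(x in E) g x.
Proof.
move=> mD mN mf N0 f0 g0 fg; rewrite (ge0_negligible_integral mN mD mf)//.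
apply: ge0_le_integral_any => // x [Dx Nx]; first exact: f0.
by move=> _; exact: fg.
Qed.

End nonmeasurable_integral.

(** * A weighted Hardy inequality *)

Section weighted_inequality.
Context {R : realType}.
Notation mu := (@lebesgue_measure R).

Lemma measurable_fun_inv_pos (D : set R) (v : R -> R) :
  measurable_fun D v -> (forall x, D x -> 0 < v x) ->
  measurable_fun D (fun x => (v x)^-1).
Proof.
move=> mv v0; apply: (@measurable_comp _ _ _ _ _ _ [set x : R | 0 < x]) => //.
- by apply: open_measurable; exact: open_gt.
- by move=> _ [x Dx <-] /=; exact: v0.
- apply: open_continuous_measurable_fun; first exact: open_gt.
  by move=> x /set_mem/= x0; apply: inv_continuous; rewrite gt_eqF.
Qed.

(** This is the inequality (int |psi|)^2 <= (int v) (int psi^2/v), with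
    bounds t and rho in place of the integrals of |psi| and v so that no
    finiteness has to be discussed. It comes from integrating
    2 |psi| <= k psi^2/v + v/k. *)
Lemma weighted_cauchy_schwarz (D : set R) (psi v : R -> R) (t rho : R) :
  measurable D -> measurable_fun D psi -> measurable_fun D v ->
  (forall x, D x -> 0 < v x) -> 0 <= t -> 0 < rho ->
  (t%:E <= \int[mu]_(x in D) `|psi x|%:E)%E ->
  (\int[mu]_(x in D) (v x)%:E <= rho%:E)%E ->
  ((t ^+ 2)%:E <= rho%:E * \int[mu]_(x in D) (psi x ^+ 2 / v x)%:E)%E.
Proof.
move=> mD mpsi mv v0; rewrite le_eqVlt => /predU1P[<- rho0 _ _|t0 rho0 tpsi vrho].
  rewrite expr0n; apply: mule_ge0; first by rewrite lee_fin ltW.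
  apply: integral_ge0 => x Dx; rewrite lee_fin divr_ge0 ?sqr_ge0//.
  exact/ltW/v0.
have mq : measurable_fun D (fun x => psi x ^+ 2 / v x).
  apply: measurable_funM; first exact: measurable_funX.
  exact: measurable_fun_inv_pos.
have q0 x : D x -> 0 <= psi x ^+ 2 / v x.
  by move=> Dx; rewrite divr_ge0 ?sqr_ge0// ltW// v0.
set Y := (\int[mu]_(x in D) (psi x ^+ 2 / v x)%:E)%E.
have Y0 : (0 <= Y)%E by apply: integral_ge0 => x Dx; rewrite lee_fin q0.
move: Y0; case Yy : Y => [y| |//] y0; last by rewrite gt0_muley ?lte_fin// leey.
rewrite lee_fin in y0; rewrite -EFinM lee_fin.
(* With this k the second term of the bound equals t. *)
pose k := rho / t; have k0 : 0 < k by rewrite divr_gt0.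
have : ((2 * t)%:E <= k%:E * Y + k^-1%:E * rho%:E)%E.
  apply: (@le_trans _ _ (2%:E * \int[mu]_(x in D) `|psi x|%:E)%E).
    by rewrite EFinM lee_pmul2l.
  apply: (@le_trans _ _ (k%:E * Y + k^-1%:E * \int[mu]_(x in D) (v x)%:E)%E); last first.
    by rewrite leeD2l// lee_pmul2l// lte_fin invr_gt0.
  have m1 : measurable_fun D (fun x => `|psi x|%:E).
    by apply/measurable_EFinP; exact: measurableT_comp.
  have m2 : measurable_fun D (fun x => (psi x ^+ 2 / v x)%:E) by exact/measurable_EFinP.
  have m3 : measurable_fun D (fun x => (v x)%:E) by exact/measurable_EFinP.
  have v0' x : D x -> (0 <= (v x)%:E)%E by move=> Dx; rewrite lee_fin ltW// v0.
  have q0' x : D x -> (0 <= (psi x ^+ 2 / v x)%:E)%E by move=> Dx; rewrite lee_fin q0.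
  have k0' : (0 <= k^-1%:E)%E by rewrite lee_fin invr_ge0 ltW.
  have k0'' : (0 <= k%:E)%E by rewrite lee_fin ltW.
  rewrite -!ge0_integralZl// -ge0_integralD//; first last.
  - exact: measurable_funeM.
  - by move=> x Dx; rewrite mule_ge0// v0'.
  - exact: measurable_funeM.
  - by move=> x Dx; rewrite mule_ge0// q0'.
  apply: ge0_le_integral => //.
  - exact: measurable_funeM.
  - by apply: emeasurable_funD; exact: measurable_funeM.
  move=> x Dx; rewrite -!EFinM -EFinD lee_fin; have vx := v0 _ Dx.
  have : 0 <= (k * `|psi x| - v x) ^+ 2 / (k * v x).
    by rewrite divr_ge0 ?sqr_ge0// mulr_ge0 ?ltW.
  have -> : (k * `|psi x| - v x) ^+ 2 / (k * v x) =
      k * (`|psi x| ^+ 2 / v x) - 2 * `|psi x| + k^-1 * v x.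
    by field; rewrite !gt_eqF.
  by rewrite real_normK ?num_real//; lra.
rewrite Yy -!EFinM -EFinD lee_fin /k invf_div => h.
have : 0 <= (rho / t * y - t) * t.
  apply: mulr_ge0; last exact: ltW.
  have : t / rho * rho = t by rewrite divfK// gt_eqF.
  by move=> e; rewrite e in h; lra.
by rewrite mulrBl mulrAC divfK ?gt_eqF// -expr2; lra.
Qed.

End weighted_inequality.

Section hardy.
Context {R : realType}.
Notation mu := (@lebesgue_measure R).

(** By Cauchy-Schwarz with weight r w on E x, phi(x)^2 is at most rho(x) times
    the integral of psi^2/(r w) over E x. Integrating against s and exchanging
    the order of integration, the inner integral of s rho over the x with u in
    E x is at most w(u)/c, which cancels the w in the denominator. *)
Lemma weighted_hardy (A : set R) (E : R -> set R) (phi psi r w s rho : R -> R)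
    (c : R) :
  measurable A -> measurable [set z : R * R | E z.1 z.2] ->
  measurable_fun A psi -> measurable_fun A r -> measurable_fun A w ->
  measurable_fun A s -> measurable_fun A rho ->
  (forall x, A x -> 0 < r x) -> (forall x, A x -> 0 < w x) ->
  (forall x, A x -> 0 <= s x) -> (forall x, A x -> 0 < rho x) -> 0 < c ->
  (forall x, A x -> (`|phi x|%:E <= \int[mu]_(u in A `&` E x) `|psi u|%:E)%E) ->
  (forall x, A x ->
     (\int[mu]_(u in A `&` E x) (r u * w u)%:E <= (rho x)%:E)%E) ->
  (forall u, A u ->
     (c%:E * \int[mu]_(x in A `&` [set x | E x u]) (s x * rho x)%:E
       <= (w u)%:E)%E) ->
  (c%:E * \int[mu]_(x in A) (phi x ^+ 2 * s x)%:E
     <= \int[mu]_(x in A) (psi x ^+ 2 / r x)%:E)%E.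
Proof.
move=> mA mE mpsi mr mw ms mrho r0 w0 s0 rho0 c0 Hphi Hrho Hw.
have mEx x : measurable (E x).
  have -> : E x = xsection [set z : R * R | E z.1 z.2] x.
    by rewrite /xsection; apply/seteqP; split => u /=; rewrite ?inE.
  exact: measurable_xsection.
have mEu u : measurable [set x | E x u].
  have -> : [set x | E x u] = ysection [set z : R * R | E z.1 z.2] u.
    by rewrite /ysection; apply/seteqP; split => x /=; rewrite ?inE.
  exact: measurable_ysection.
pose q u := psi u ^+ 2 / (r u * w u).
have mq : measurable_fun A q.
  apply: measurable_funM; first exact: measurable_funX.
  apply: measurable_fun_inv_pos; first exact: measurable_funM.
  by move=> u Au; rewrite mulr_gt0 ?r0 ?w0.
have q0 u : A u -> 0 <= q u.
  by move=> Au; rewrite divr_ge0 ?sqr_ge0// mulr_ge0 ?ltW ?r0 ?w0.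
pose sr x := s x * rho x.
have msr : measurable_fun A sr by exact: measurable_funM.
have sr0 x : A x -> 0 <= sr x by move=> Ax; rewrite mulr_ge0 ?s0// ltW// rho0.
pose aT : R -> \bar R := (EFin \o sr) \_ A.
pose bT : R -> \bar R := (EFin \o q) \_ A.
have maT : measurable_fun setT aT.
  have h : measurable_fun A (EFin \o sr) by exact/measurable_EFinP.
  exact: ((measurable_restrictT _ mA).1 h).
have mbT : measurable_fun setT bT.
  have h : measurable_fun A (EFin \o q) by exact/measurable_EFinP.
  exact: ((measurable_restrictT _ mA).1 h).
have aT0 x : (0 <= aT x)%E by apply: erestrict_ge0 => t At /=; rewrite lee_fin sr0.
have bT0 x : (0 <= bT x)%E by apply: erestrict_ge0 => t At /=; rewrite lee_fin q0.
pose K (z : R * R) : \bar R :=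
  ((aT z.1 * bT z.2) * (\1_[set z : R * R | E z.1 z.2] z)%:E)%E.
have K0 z : (0 <= K z)%E by rewrite !mule_ge0// lee_fin.
have mK : measurable_fun setT K.
  apply: emeasurable_funM; first apply: emeasurable_funM.
  - exact: (measurableT_comp maT measurable_fst).
  - exact: (measurableT_comp mbT measurable_snd).
  - by apply/measurable_EFinP; exact: measurable_indic.
pose Phi x := (\int[mu]_(u in A `&` E x) (q u)%:E)%E.
have Phi0 x : (0 <= Phi x)%E.
  by apply: integral_ge0 => u [Au _]; rewrite lee_fin q0.
have KE x : (\int[mu]_u K (x, u) = aT x * Phi x)%E.
  have m1 : measurable (A `&` E x) by exact: measurableI.
  have m2 : measurable_fun (A `&` E x) (fun u => (q u)%:E).
    by apply/measurable_EFinP; apply: measurable_funS mq => //; exact: subIsetl.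
  rewrite /Phi -ge0_integralZl//; last by move=> u [Au _]; rewrite lee_fin q0.
  rewrite [RHS]integral_mkcond; apply: eq_integral => u _.
  rewrite /K /= patchE /bT patchE /= indicE in_setI.
  have -> : ((x, u) \in [set z | E z.1 z.2]) = (u \in E x).
    by apply/idP/idP => /set_mem h; apply/mem_set.
  by case: (u \in A); case: (u \in E x) => //=; rewrite ?mule1 ?mule0 ?mul0e.
have KE' u : (\int[mu]_x K (x, u) =
    bT u * \int[mu]_(x in A `&` [set x | E x u]) (sr x)%:E)%E.
  have m1 : measurable (A `&` [set x | E x u]) by exact: measurableI.
  have m2 : measurable_fun (A `&` [set x | E x u]) (fun x => (sr x)%:E).
    by apply/measurable_EFinP; apply: measurable_funS msr => //; exact: subIsetl.
  rewrite -ge0_integralZl//; last by move=> x [Ax _]; rewrite lee_fin sr0.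
  rewrite [RHS]integral_mkcond; apply: eq_integral => x _.
  rewrite /K /= patchE /aT patchE /= indicE in_setI.
  have -> : ((x, u) \in [set z | E z.1 z.2]) = (x \in [set x | E x u]).
    by apply/idP/idP => /set_mem h; apply/mem_set.
  by case: (x \in A); case: (x \in [set x | E x u]) => //=;
    rewrite ?mule1 ?mule0 ?mul0e// muleC.
have mF : measurable_fun setT (fun x => aT x * Phi x)%E.
  have := measurable_fun_fubini_tonelli_F (m2 := mu) K mK K0.
  by rewrite (_ : fubini_F _ _ = (fun x => aT x * Phi x)%E)//; apply/funext => x; rewrite /fubini_F KE.
apply: (@le_trans _ _ (c%:E * \int[mu]_x (aT x * Phi x))%E).
  apply: lee_wpmul2l; first by rewrite lee_fin ltW.
  apply: ge0_le_integral_any => [x Ax|x _|x Ax _].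
  - by rewrite lee_fin mulr_ge0 ?sqr_ge0 ?s0.
  - by rewrite mule_ge0.
  split=> //; rewrite /aT patchE mem_set//= /sr (mulrC (phi x ^+ 2)) EFinM (EFinM (s x) (rho x)) -muleA.
  rewrite lee_wpmul2l// ?lee_fin ?s0// -real_normK ?num_real//.
  have m1 : measurable (A `&` E x) by exact: measurableI.
  apply: weighted_cauchy_schwarz => //; first last.
  - exact: Hrho.
  - exact: Hphi.
  - exact: rho0.
  - by move=> u [Au _]; rewrite mulr_gt0 ?r0 ?w0.
  - by apply: measurable_funM; [apply: measurable_funS mr|apply: measurable_funS mw] => //;
      exact: subIsetl.
  - by apply: measurable_funS mpsi => //; exact: subIsetl.
have -> : (\int[mu]_x (aT x * Phi x) = \int[mu]_u \int[mu]_x K (x, u))%E.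
  transitivity (\int[mu]_x \int[mu]_u K (x, u))%E.
    by apply: eq_integral => x _; rewrite KE.
  exact: (fubini_tonelli (m1 := mu) (m2 := mu) K mK K0).
have mG : measurable_fun setT (fun u => \int[mu]_x K (x, u))%E.
  exact: (measurable_fun_fubini_tonelli_G (m1 := mu) K mK K0).
rewrite -ge0_integralZl//; last 2 first.
- by move=> u _; apply: integral_ge0.
- by rewrite lee_fin ltW.
apply: ge0_le_integral_any => [u _|u Au|u _].
- by rewrite mule_ge0 ?integral_ge0// lee_fin ltW.
- by rewrite lee_fin divr_ge0 ?sqr_ge0// ltW// r0.
rewrite KE' {1 2}/bT !patchE; case: ifPn => [/set_mem Au _|]; last by rewrite mul0e mule0 eqxx.
split=> //=; rewrite muleCA.
apply: (@le_trans _ _ ((q u)%:E * (w u)%:E)%E).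
  by apply: lee_wpmul2l; [rewrite lee_fin q0|exact: Hw].
by rewrite -EFinM lee_fin /q invfM mulrA divfK ?gt_eqF ?w0.
Qed.

End hardy.

(** * Intervals with extended real endpoints *)

Section open_interval.
Context {R : realType}.
Notation mu := (@lebesgue_measure R).
Implicit Types (l r : \bar R) (x y z c : R).

Lemma open_ereal_itv l r : open (ereal_itv l r).
Proof.
have -> : ereal_itv l r = [set x | (l < x%:E)%E] `&` [set x | (x%:E < r)%E].
  by apply/seteqP; split.
by apply: openI; [exact: open_ereal_gt|exact: open_ereal_lt].
Qed.

Lemma measurable_ereal_itv l r : measurable (ereal_itv l r).
Proof. by apply: open_measurable; exact: open_ereal_itv. Qed.

Lemma ereal_itv_segment l r x y :
  ereal_itv l r x -> ereal_itv l r y -> `[x, y] `<=` ereal_itv l r.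
Proof.
move=> [lx _] [_ yr] z /=; rewrite in_itv/= => /andP[xz zy]; split.
  by apply: lt_le_trans lx _; rewrite lee_fin.
by apply: le_lt_trans yr; rewrite lee_fin.
Qed.

Lemma ereal_itv_between l r x y z :
  ereal_itv l r x -> ereal_itv l r y -> x <= z <= y -> ereal_itv l r z.
Proof. by move=> lx ly xzy; apply: (ereal_itv_segment lx ly); rewrite /= in_itv. Qed.

Lemma ereal_itv_enlarge l r x y : ereal_itv l r x -> ereal_itv l r y -> x <= y ->
  exists a b, [/\ ereal_itv l r a, ereal_itv l r b, a < x & y < b].
Proof.
move=> Ix Iy xy; have side z : ereal_itv l r z ->
    exists e, [/\ 0 < e, ereal_itv l r (z - e) & ereal_itv l r (z + e)].
  move=> Iz; have : nbhs z (ereal_itv l r).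
    by apply: open_nbhs_nbhs; split=> //; exact: open_ereal_itv.
  move=> /nbhs_ballP[e /= e0 eI]; exists (e / 2); split; first by rewrite divr_gt0.
    by apply: eI; rewrite /ball/= opprB addrC subrK gtr0_norm ?divr_gt0//; lra.
  by apply: eI; rewrite /ball/= opprD addNKr normrN gtr0_norm ?divr_gt0//; lra.
have [e [e0 h1 _]] := side _ Ix; have [d [d0 _ h2]] := side _ Iy.
by exists (x - e), (y + d); split=> //; lra.
Qed.

(** The sequence c - n serves an infinite endpoint and
    l + (c - l)/(n + 1) a finite one. *)
Lemma ereal_lt_seq l c : (l < c%:E)%E ->
  exists a : nat -> R, [/\ forall n, (l < (a n)%:E)%E /\ a n <= c,
    forall n m, (n <= m)%N -> a m <= a n &
    forall x, (l < x%:E)%E -> exists n, a n <= x].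
Proof.
case: l => [l|//|_]; last first.
  exists (fun n => c - n%:R); split=> [n|n m nm|x _].
  - by rewrite ltNyr gerBl.
  - by rewrite lerB// ler_nat.
  - exists (Num.trunc (`|c - x|)).+1.
    have : c - x <= `|c - x| by exact: ler_norm.
    have := truncnS_gt `|c - x|; lra.
rewrite lte_fin => lc; have cl : 0 < c - l by rewrite subr_gt0.
exists (fun n => l + (c - l) / n.+1%:R); split=> [n|n m nm|x].
- rewrite lte_fin ltrDl divr_gt0//; split=> //.
  by rewrite -lerBrDl ler_pdivrMr// ler_peMr ?ler1n// ltW.
- by rewrite lerD2l ler_pM2l// lef_pV2 ?posrE// ler_nat.
rewrite lte_fin => lx; have xl : 0 < x - l by rewrite subr_gt0.
exists (Num.trunc ((c - l) / (x - l))); set n := Num.trunc _.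
have : (c - l) / (x - l) < n.+1%:R by exact: truncnS_gt.
rewrite ltr_pdivrMr// => h.
by rewrite -lerBrDl ler_pdivrMr// mulrC ltW.
Qed.

Lemma ereal_gt_seq r c : (c%:E < r)%E ->
  exists b : nat -> R, [/\ forall n, ((b n)%:E < r)%E /\ c <= b n,
    forall n m, (n <= m)%N -> b n <= b m &
    forall x, (x%:E < r)%E -> exists n, x <= b n].
Proof.
rewrite -lteN2 -EFinN => /ereal_lt_seq[a [h1 h2 h3]].
exists (fun n => - a n); split=> [n|n m nm|x].
- by have [? ?] := h1 n; rewrite -lteN2 EFinN oppeK lerNr.
- by rewrite lerN2 h2.
by rewrite -lteN2 -EFinN => /h3[n an]; exists n; rewrite lerNr.
Qed.

(** Monotone convergence along compact intervals increasing to (l, r). *)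
Lemma ge0_integral_exhaust l r c (w : R -> \bar R) (B : \bar R) :
  ereal_itv l r c -> measurable_fun (ereal_itv l r) w ->
  (forall x, ereal_itv l r x -> 0 <= w x)%E ->
  (forall a b, ereal_itv l r a -> ereal_itv l r b -> (a <= c <= b)%R ->
     \int[mu]_(x in `[a, b]) w x <= B)%E ->
  (\int[mu]_(x in ereal_itv l r) w x <= B)%E.
Proof.
move=> Ic mw w0 H; have [lc cr] := Ic.
have [a [a1 a2 a3]] := ereal_lt_seq lc; have [b [b1 b2 b3]] := ereal_gt_seq cr.
have Ia n : ereal_itv l r (a n).
  have [la ac] := a1 n; split=> //; apply: le_lt_trans cr; by rewrite lee_fin.
have Ib n : ereal_itv l r (b n).
  have [lb cb] := b1 n; split=> //; apply: lt_le_trans lc _; by rewrite lee_fin.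
have FE : \bigcup_n `[a n, b n]%classic = ereal_itv l r.
  apply/seteqP; split=> [x [n _]|x [lx xr]].
    exact: ereal_itv_segment.
  have [n an] := a3 _ lx; have [m bm] := b3 _ xr.
  exists (maxn n m) => //=; rewrite in_itv/= (le_trans _ an) ?a2 ?leq_maxl//=.
  by rewrite (le_trans bm)// b2// leq_maxr.
rewrite -FE; have ndF : {homo (fun n => `[a n, b n]%classic) :
    n m / (n <= m)%N >-> (n <= m)%O}.
  move=> n m nm; rewrite subsetEset => x /=; rewrite !in_itv/= => /andP[h1 h2].
  by rewrite (le_trans (a2 _ _ nm) h1) (le_trans h2 (b2 _ _ nm)).
have mF n : measurable_fun `[a n, b n] w.
  by apply: measurable_funS mw; [exact: measurable_ereal_itv|exact: ereal_itv_segment].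
have F0 n x : `[a n, b n]%classic x -> (0 <= w x)%E.
  by move=> h; apply: w0; move: h; exact: ereal_itv_segment.
have := ge0_nondecreasing_set_cvg_integral (mu := mu) ndF (fun n => measurable_itv _) mF F0.
move=> /cvg_lim <-//; apply: lime_le.
  apply: ereal_nondecreasing_is_cvgn.
  exact: ge0_nondecreasing_set_nondecreasing_integral.
apply: nearW => n; apply: H => //; have [_ ->] := a1 n; by have [_ ->] := b1 n.
Qed.

Section continuous_on.
Variables (l r : \bar R).
Local Notation I := (ereal_itv l r).
Implicit Types (f F h : R -> R).

Definition continuous_on_itv (f : R -> R) := forall x, I x -> {for x, continuous f}.

Lemma continuous_on_itvP f : {within I, continuous f} <-> continuous_on_itv f.
Proof.
rewrite continuous_open_subspace; last exact: open_ereal_itv.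
by split=> [h x Ix|h x /set_mem]; [apply: h; rewrite inE|exact: h].
Qed.

Lemma continuous_on_segment f a b : continuous_on_itv f -> I a -> I b ->
  {within `[a, b], continuous f}.
Proof.
move=> /continuous_on_itvP cf Ia Ib.
by apply: continuous_subspaceW cf; exact: ereal_itv_segment.
Qed.

Lemma continuous_on_measurable f : continuous_on_itv f -> measurable_fun I f.
Proof.
move=> cf; apply: open_continuous_measurable_fun; first exact: open_ereal_itv.
by move=> x /set_mem; exact: cf.
Qed.

Lemma continuous_on_measurableS f (A : set R) : continuous_on_itv f ->
  measurable A -> A `<=` I -> measurable_fun A f.
Proof.
move=> cf mA AI; apply: measurable_funS (continuous_on_measurable cf) => //.
exact: measurable_ereal_itv.
Qed.

Lemma continuous_on_emeasurableS f (A : set R) : continuous_on_itv f ->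
  measurable A -> A `<=` I -> measurable_fun A (fun x => (f x)%:E).
Proof.
by move=> cf mA AI; apply/measurable_EFinP; exact: continuous_on_measurableS.
Qed.

Lemma continuous_on_integrable f a b : continuous_on_itv f -> I a -> I b ->
  mu.-integrable `[a, b] (EFin \o f).
Proof.
move=> cf Ia Ib; apply: continuous_compact_integrable.
  exact: segment_compact.
exact: continuous_on_segment.
Qed.

Lemma derive_on_continuous F h : (forall x, I x -> is_derive x 1 F (h x)) ->
  continuous_on_itv F.
Proof.
move=> dF x /dF[dFx _]; apply: differentiable_continuous.
exact/derivable1_diffP.
Qed.

Lemma derive_on_MVT F h a b : (forall x, I x -> is_derive x 1 F (h x)) ->
  I a -> I b -> a < b ->
  exists c, [/\ a < c, c < b & F b - F a = h c * (b - a)].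
Proof.
move=> dF Ia Ib ab; have [||c] := @MVT R F h a b ab.
- move=> x; rewrite in_itv/= => /andP[ax xb]; apply: dF.
  by apply: (ereal_itv_between Ia Ib); rewrite !ltW.
- exact: continuous_on_segment (derive_on_continuous dF) Ia Ib.
by rewrite in_itv/= => /andP[ac cb] e; exists c.
Qed.

Lemma derive_on_integral F h a b : (forall x, I x -> is_derive x 1 F (h x)) ->
  continuous_on_itv h -> I a -> I b -> a <= b ->
  (\int[mu]_(x in `[a, b]) (h x)%:E = (F b - F a)%:E)%E.
Proof.
move=> dF ch Ia Ib; rewrite le_eqVlt => /predU1P[<-|ab].
  by rewrite set_itv1 integral_set1 subrr.
have cF := derive_on_continuous dF.
rewrite EFinB; apply: continuous_FTC2 => //.
- exact: continuous_on_segment.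
- split.
  + move=> x; rewrite in_itv/= => /andP[ax xb].
    have /dF[] // : I x by apply: (ereal_itv_between Ia Ib); rewrite !ltW.
  + by apply: cvg_at_right_filter; exact: cF.
  + by apply: cvg_at_left_filter; exact: cF.
- move=> x; rewrite in_itv/= => /andP[ax xb]; rewrite derive1E.
  have /dF[_ ->] // : I x by apply: (ereal_itv_between Ia Ib); rewrite !ltW.
Qed.

Lemma oriented_integral_derive h x0 x : continuous_on_itv h -> I x0 -> I x ->
  is_derive x 1 (oriented_integral h x0) (h x).
Proof.
move=> ch Ix0 Ix.
have Imin : I (Num.min x0 x) by case: leP.
have Imax : I (Num.max x0 x) by case: leP.
have [|a [b [Ia Ib aM Mb]]] := ereal_itv_enlarge Imin Imax.
  by rewrite ge_min le_max lexx.
move: aM Mb; rewrite lt_min gt_max => /andP[ax0 ax] /andP[x0b xb].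
have ih : mu.-integrable `[a, b] (EFin \o h) by exact: continuous_on_integrable.
have [dF F'] := continuous_FTC1_closed xb ih ax (ch _ Ix).
pose F y := \int[mu]_(t in `[a, y]) h t.
have Fsub u v : a <= u -> u <= v -> v <= b -> \int[mu]_(t in `[u, v]) h t = F v - F u.
  move=> au uv vb.
  have iav : mu.-integrable `[a, v] (EFin \o h).
    by apply: integrableS ih => //; apply: subset_itvl; rewrite bnd_simp.
  rewrite /F (Rintegral_itvB iav) ?bnd_simp// Rintegral_itv_obnd_cbnd//.
  by apply: integrableS iav => //; apply: subset_itvr; rewrite bnd_simp.
have oE : \near x, F x - F x0 = oriented_integral h x0 x.
  near=> y; have ay : a <= y by near: y; exact: lt_le_nbhsr.
  have yb : y <= b by near: y; exact: lt_le_nbhsl.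
  rewrite /oriented_integral; case: leP => [x0y|/ltW yx0].
    by rewrite Fsub// ltW.
  by rewrite Fsub ?opprB// ltW.
apply: (near_eq_is_derive oE).
rewrite -[h x]subr0; apply: is_deriveB.
by rewrite -F' derive1E; split.
Unshelve. all: by end_near. Qed.

Lemma oriented_integralxx h x0 : oriented_integral h x0 x0 = 0.
Proof. by rewrite /oriented_integral lexx set_itv1 Rintegral_set1. Qed.

End continuous_on.
End open_interval.

(** * One-sided Hardy inequalities *)

Section one_sided.
Context {R : realType}.
Notation mu := (@lebesgue_measure R).
Variables (M N : \bar R).
Local Notation I := (ereal_itv (- M)%E N).
Implicit Types (f p q H phi psi : R -> R) (theta x y z c : R).

Lemma measurable_gt_pair : measurable [set z : R * R | z.2 < z.1].
Proof.
have mf : measurable_fun setT (fun z : R * R => z.1 - z.2).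
  by apply: measurable_funB; [exact: measurable_fst|exact: measurable_snd].
rewrite (_ : mkset _ = setT `&` (fun z : R * R => z.1 - z.2) @^-1` `]0, +oo[).
  by apply: mf => //; exact: measurable_itv.
by rewrite setTI; apply/seteqP; split=> z /=; rewrite in_itv/= andbT subr_gt0.
Qed.

Lemma measurable_lt_pair : measurable [set z : R * R | z.1 < z.2].
Proof.
have mf : measurable_fun setT (fun z : R * R => z.2 - z.1).
  by apply: measurable_funB; [exact: measurable_snd|exact: measurable_fst].
rewrite (_ : mkset _ = setT `&` (fun z : R * R => z.2 - z.1) @^-1` `]0, +oo[).
  by apply: mf => //; exact: measurable_itv.
by rewrite setTI; apply/seteqP; split=> z /=; rewrite in_itv/= andbT subr_gt0.
Qed.

Lemma measurable_lt_set x : measurable [set u : R | u < x].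
Proof. by apply: open_measurable; exact: open_lt. Qed.

Lemma measurable_gt_set x : measurable [set u : R | x < u].
Proof. by apply: open_measurable; exact: open_gt. Qed.

Section primitive_weight.
Variables (f p q H : R -> R).
Hypotheses (cf : continuous_on_itv (- M)%E N f) (cp : continuous_on_itv (- M)%E N p)
  (cq : continuous_on_itv (- M)%E N q).
Hypotheses (f0 : forall x, I x -> 0 < f x) (p0 : forall x, I x -> 0 < p x)
  (q0 : forall x, I x -> 0 < q x).
Hypothesis dH : forall x, I x -> is_derive x 1 H (f x * q x).

Let cH : continuous_on_itv (- M)%E N H.
Proof. exact: derive_on_continuous dH. Qed.

Let cfq : continuous_on_itv (- M)%E N (fun x => f x * q x).
Proof. by move=> x Ix; apply: continuousM; [exact: cf|exact: cq]. Qed.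

Lemma primitive_increasing x y : I x -> I y -> x < y -> H x < H y.
Proof.
move=> Ix Iy xy; have [c [xc cy e]] := derive_on_MVT dH Ix Iy xy.
have Ic : I c by apply: (ereal_itv_between Ix Iy); rewrite !ltW.
by rewrite -subr_gt0 e mulr_gt0 ?subr_gt0// mulr_gt0 ?f0 ?q0.
Qed.

Lemma primitive_nondecreasing x y : I x -> I y -> x <= y -> H x <= H y.
Proof.
move=> Ix Iy; rewrite le_eqVlt => /predU1P[->//|xy].
exact/ltW/primitive_increasing.
Qed.

Lemma integral_density_segment x y : I x -> I y -> x <= y ->
  integral_density q `[x, y] (fun u => (f u)%:E) = (H y - H x)%:E.
Proof.
move=> Ix Iy xy; rewrite -(derive_on_integral dH cfq Ix Iy xy).
by rewrite /integral_density; under eq_integral do rewrite -EFinM.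
Qed.

(** With H a primitive of f q, the double integrals become single ones, and
    the positivity of the weights becomes the monotonicity of H. *)
Lemma h_minusE theta z : I theta -> I z -> z <= theta ->
  h_minus M p q f theta z =
  (\int[mu]_(x in ereal_itv (- M)%E z%:E) ((H theta - H x) * p x)%:E)%E.
Proof.
move=> It Iz zt; rewrite /h_minus /integral_density; apply: eq_integral => x.
rewrite inE => -[Mx xz]; rewrite EFinM; congr (_ * _)%E.
have xz' : x <= z by move: xz; rewrite lte_fin => /ltW.
have Ix : I x by split=> //; apply: lt_trans xz Iz.2.
exact: integral_density_segment (le_trans xz' zt).
Qed.

Lemma h_plusE theta z : I theta -> I z -> theta <= z ->
  h_plus N p q f theta z =
  (\int[mu]_(x in ereal_itv z%:E N) ((H x - H theta) * p x)%:E)%E.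
Proof.
move=> It Iz tz; rewrite /h_plus /integral_density; apply: eq_integral => x.
rewrite inE => -[zx xN]; rewrite EFinM; congr (_ * _)%E.
have zx' : z <= x by move: zx; rewrite lte_fin => /ltW.
have Ix : I x by split=> //; apply: lt_trans Iz.1 zx.
exact: integral_density_segment (le_trans tz zx').
Qed.

Lemma ereal_itv_minus z : I z -> ereal_itv (- M)%E z%:E `<=` I.
Proof. by move=> [_ zN] x [Mx xz]; split=> //; exact: lt_trans xz zN. Qed.

Lemma ereal_itv_plus z : I z -> ereal_itv z%:E N `<=` I.
Proof. by move=> [Mz _] x [zx xN]; split=> //; exact: lt_trans Mz zx. Qed.

Lemma continuous_minus_weight theta :
  continuous_on_itv (- M)%E N (fun x => (H theta - H x) * p x).
Proof.
move=> x Ix; apply: continuousM; last exact: cp.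
by apply: continuousB; [exact: cst_continuous|exact: cH].
Qed.

Lemma continuous_plus_weight theta :
  continuous_on_itv (- M)%E N (fun x => (H x - H theta) * p x).
Proof.
move=> x Ix; apply: continuousM; last exact: cp.
by apply: continuousB; [exact: cH|exact: cst_continuous].
Qed.

Lemma integral_le_h_minus theta z (A : set R) : I theta -> I z -> z <= theta ->
  measurable A -> A `<=` ereal_itv (- M)%E z%:E ->
  (\int[mu]_(x in A) ((H theta - H x) * p x)%:E <= h_minus M p q f theta z)%E.
Proof.
move=> It Iz zt mA Asub; rewrite (h_minusE It Iz zt).
apply: ge0_subset_integral => //; first exact: measurable_ereal_itv.
  exact: (continuous_on_emeasurableS (@continuous_minus_weight theta)
    (measurable_ereal_itv _ _) (ereal_itv_minus Iz)).
move=> x Jx; have Ix := ereal_itv_minus Iz Jx; have [_ xz] := Jx.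
rewrite lee_fin mulr_ge0//; last by rewrite ltW// p0.
rewrite lte_fin in xz; rewrite subr_ge0; apply: primitive_nondecreasing => //.
by apply: le_trans zt; exact: ltW.
Qed.

Lemma integral_le_h_plus theta z (A : set R) : I theta -> I z -> theta <= z ->
  measurable A -> A `<=` ereal_itv z%:E N ->
  (\int[mu]_(x in A) ((H x - H theta) * p x)%:E <= h_plus N p q f theta z)%E.
Proof.
move=> It Iz tz mA Asub; rewrite (h_plusE It Iz tz).
apply: ge0_subset_integral => //; first exact: measurable_ereal_itv.
  exact: (continuous_on_emeasurableS (@continuous_plus_weight theta)
    (measurable_ereal_itv _ _) (ereal_itv_plus Iz)).
move=> x Jx; have Ix := ereal_itv_plus Iz Jx; have [zx _] := Jx.
rewrite lee_fin mulr_ge0//; last by rewrite ltW// p0.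
rewrite lte_fin in zx; rewrite subr_ge0; apply: primitive_nondecreasing => //.
by apply: le_trans tz _; exact: ltW.
Qed.

Lemma integral_fq_le x y (A : set R) : I x -> I y -> x <= y -> measurable A ->
  A `<=` `[x, y] -> (\int[mu]_(u in A) (f u * q u)%:E <= (H y - H x)%:E)%E.
Proof.
move=> Ix Iy xy mA Axy; rewrite -(derive_on_integral dH cfq Ix Iy xy).
apply: ge0_subset_integral => //.
  exact: (continuous_on_emeasurableS cfq (measurable_itv _) (ereal_itv_segment Ix Iy)).
move=> u /(ereal_itv_segment Ix Iy) Iu.
by rewrite lee_fin mulr_ge0 ?ltW ?f0 ?q0.
Qed.

Let mI (g : R -> R) (A : set R) : measurable A -> A `<=` I ->
  continuous_on_itv (- M)%E N g -> measurable_fun A g.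
Proof. by move=> mA AI cg; exact: continuous_on_measurableS cg mA AI. Qed.

Let cHt theta : continuous_on_itv (- M)%E N (fun x => H theta - H x).
Proof. by move=> x Ix; apply: continuousB; [exact: cst_continuous|exact: cH]. Qed.

Let cHt' theta : continuous_on_itv (- M)%E N (fun x => H x - H theta).
Proof. by move=> x Ix; apply: continuousB; [exact: cH|exact: cst_continuous]. Qed.

Section minus.
Variables (theta c alpha : R).
Hypotheses (It : I theta) (c0 : 0 < c) (Ia : I alpha) (at_ : alpha < theta).
Hypothesis Hc : forall z, I z -> z < theta ->
  (c%:E * h_minus M p q f theta z <= (f z)%:E)%E.
Variables (phi psi : R -> R).
Hypothesis mpsi : measurable_fun `[alpha, theta[ psi.

Let A : set R := `[alpha, theta[%classic.

Let AP x : A x -> [/\ I x, alpha <= x & x < theta].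
Proof.
rewrite /A/= in_itv/= => /andP[ax xt]; split=> //.
by apply: (ereal_itv_between Ia It); rewrite ax ltW.
Qed.

Let AI : A `<=` I. Proof. by move=> x /AP[]. Qed.

(** Here phi vanishes at alpha and the sets E x = {u < x} face alpha. The
    weight w(u) = H(theta) - H(u) is the integral of f q over [u, theta]; the
    integral of p w over E x is at most h^-(x) <= f(x)/c, while c times the
    integral of q f/c over {x > u} is at most w(u). The interval A excludes
    theta, where w vanishes. *)
Lemma hardy_dirichlet_minus :
  (forall x, alpha <= x -> x < theta ->
     (`|phi x|%:E <= \int[mu]_(u in `[alpha, x[) `|psi u|%:E)%E) ->
  (c%:E * \int[mu]_(x in A) (phi x ^+ 2 * q x)%:E
    <= \int[mu]_(x in A) (psi x ^+ 2 / p x)%:E)%E.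
Proof.
move=> Hphi.
have mA : measurable A by exact: measurable_itv.
apply: (@weighted_hardy R A (fun x => [set u | u < x]) phi psi p
  (fun u => H theta - H u) q (fun x => f x / c)) => //.
- exact: measurable_gt_pair.
- exact: mI.
- exact: mI.
- exact: mI.
- by apply: measurable_funM => //; exact: mI.
- by move=> x /AI; exact: p0.
- by move=> x /AP[Ix _ xt]; rewrite subr_gt0; exact: primitive_increasing.
- by move=> x /AI /q0 /ltW.
- by move=> x /AI /f0 fx; rewrite divr_gt0.
- move=> x /AP[Ix ax xt].
  rewrite (_ : A `&` _ = `[alpha, x[%classic); first exact: Hphi.
  apply/seteqP; split=> u /=; rewrite /A/= !in_itv/=.
    by move=> [/andP[-> _] ->].
  by move=> /andP[-> ux]; rewrite ux (lt_trans ux).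
- move=> x /AP[Ix ax xt].
  have h : (\int[mu]_(u in A `&` [set u | (u < x)%R]) (p u * (H theta - H u))%:E
      <= h_minus M p q f theta x)%E.
    under eq_integral do rewrite mulrC.
    apply: integral_le_h_minus => //; first exact: ltW.
      by apply: measurableI => //; exact: measurable_lt_set.
    move=> u [/AP[Iu _ _]] /= ux; split; first exact: Iu.1.
    by rewrite lte_fin.
  apply: le_trans h _; have := Hc Ix xt.
  by rewrite muleC -lee_pdivlMr.
- move=> u /AP[Iu au ut].
  have mB : measurable (A `&` [set x | u < x]).
    by apply: measurableI => //; exact: measurable_gt_set.
  have BI : A `&` [set x | u < x] `<=` I by move=> x [/AI].
  rewrite -ge0_integralZl//; first last.
  + by rewrite lee_fin ltW.
  + by move=> x /BI Ix; rewrite lee_fin mulr_ge0 ?divr_ge0 ?ltW ?f0 ?q0.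
  + apply/measurable_EFinP; apply: measurable_funM; first exact: mI.
    by apply: measurable_funM => //; exact: mI.
  have -> : (\int[mu]_(x in A `&` [set x | (u < x)%R]) (c%:E * (q x * (f x / c))%:E)
      = \int[mu]_(x in A `&` [set x | (u < x)%R]) (f x * q x)%:E)%E.
    by apply: eq_integral => x _; rewrite -EFinM; congr EFin; field; rewrite gt_eqF.
  apply: integral_fq_le => //; first exact: ltW.
  by move=> x [/AP[_ ax xt]] /= ux; rewrite /= in_itv/= !ltW.
Qed.

(** Here phi vanishes at theta and the sets E x = {u > x} face theta. With
    the weight w = f, the integral of q f over E x is at most H(theta) - H(x),
    whose integral against p over {x < u} is at most h^-(u) <= f(u)/c. *)
Lemma hardy_neumann_minus :
  (forall x, alpha <= x -> x < theta ->
     (`|phi x|%:E <= \int[mu]_(u in `]x, theta[) `|psi u|%:E)%E) ->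
  (c%:E * \int[mu]_(x in A) (phi x ^+ 2 * p x)%:E
    <= \int[mu]_(x in A) (psi x ^+ 2 / q x)%:E)%E.
Proof.
move=> Hphi.
have mA : measurable A by exact: measurable_itv.
apply: (@weighted_hardy R A (fun x => [set u | x < u]) phi psi q
  f p (fun x => H theta - H x)) => //.
- exact: measurable_lt_pair.
- exact: mI.
- exact: mI.
- exact: mI.
- exact: mI.
- by move=> x /AI; exact: q0.
- by move=> x /AI; exact: f0.
- by move=> x /AI /p0 /ltW.
- by move=> x /AP[Ix _ xt]; rewrite subr_gt0; exact: primitive_increasing.
- move=> x /AP[Ix ax xt].
  rewrite (_ : A `&` _ = `]x, theta[%classic); first exact: Hphi.
  apply/seteqP; split=> u /=; rewrite /A/= !in_itv/=.
    by move=> [/andP[_ ->] ->].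
  by move=> /andP[xu ->]; rewrite xu (le_trans ax)// ltW.
- move=> x /AP[Ix ax xt].
  under eq_integral do rewrite mulrC.
  apply: integral_fq_le => //; first exact: ltW.
    by apply: measurableI => //; exact: measurable_gt_set.
  by move=> u [/AP[_ au ut]] /= xu; rewrite /= in_itv/= !ltW.
- move=> u /AP[Iu au ut].
  apply: le_trans (Hc Iu ut); apply: lee_wpmul2l; first by rewrite lee_fin ltW.
  under eq_integral do rewrite mulrC.
  apply: integral_le_h_minus => //; first exact: ltW.
    by apply: measurableI => //; exact: measurable_lt_set.
  move=> x [/AP[Ix _ _]] /= xu; split; first exact: Ix.1.
  by rewrite lte_fin.
Qed.

End minus.

Section plus.
Variables (theta c beta : R).
Hypotheses (It : I theta) (c0 : 0 < c) (Ib : I beta) (tb : theta < beta).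
Hypothesis Hc : forall z, I z -> theta < z ->
  (c%:E * h_plus N p q f theta z <= (f z)%:E)%E.
Variables (phi psi : R -> R).
Hypothesis mpsi : measurable_fun `]theta, beta] psi.

Let A : set R := `]theta, beta]%classic.

Let AP x : A x -> [/\ I x, theta < x & x <= beta].
Proof.
rewrite /A/= in_itv/= => /andP[tx xb]; split=> //.
by apply: (ereal_itv_between It Ib); rewrite xb ltW.
Qed.

Let AI : A `<=` I. Proof. by move=> x /AP[]. Qed.

(** The mirror image of hardy_dirichlet_minus. *)
Lemma hardy_dirichlet_plus :
  (forall x, theta < x -> x <= beta ->
     (`|phi x|%:E <= \int[mu]_(u in `]x, beta]) `|psi u|%:E)%E) ->
  (c%:E * \int[mu]_(x in A) (phi x ^+ 2 * q x)%:E
    <= \int[mu]_(x in A) (psi x ^+ 2 / p x)%:E)%E.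
Proof.
move=> Hphi.
have mA : measurable A by exact: measurable_itv.
apply: (@weighted_hardy R A (fun x => [set u | x < u]) phi psi p
  (fun u => H u - H theta) q (fun x => f x / c)) => //.
- exact: measurable_lt_pair.
- exact: mI.
- exact: mI.
- exact: mI.
- by apply: measurable_funM => //; exact: mI.
- by move=> x /AI; exact: p0.
- by move=> x /AP[Ix tx _]; rewrite subr_gt0; exact: primitive_increasing.
- by move=> x /AI /q0 /ltW.
- by move=> x /AI /f0 fx; rewrite divr_gt0.
- move=> x /AP[Ix tx xb].
  rewrite (_ : A `&` _ = `]x, beta]%classic); first exact: Hphi.
  apply/seteqP; split=> u /=; rewrite /A/= !in_itv/=.
    by move=> [/andP[_ ->] ->].
  by move=> /andP[xu ->]; rewrite xu (lt_trans tx).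
- move=> x /AP[Ix tx xb].
  have h : (\int[mu]_(u in A `&` [set u | (x < u)%R]) (p u * (H u - H theta))%:E
      <= h_plus N p q f theta x)%E.
    under eq_integral do rewrite mulrC.
    apply: integral_le_h_plus => //; first exact: ltW.
      by apply: measurableI => //; exact: measurable_gt_set.
    move=> u [/AP[Iu _ _]] /= xu; split; last exact: Iu.2.
    by rewrite lte_fin.
  apply: le_trans h _; have := Hc Ix tx.
  by rewrite muleC -lee_pdivlMr.
- move=> u /AP[Iu tu ub].
  have mB : measurable (A `&` [set x | x < u]).
    by apply: measurableI => //; exact: measurable_lt_set.
  have BI : A `&` [set x | x < u] `<=` I by move=> x [/AI].
  rewrite -ge0_integralZl//; first last.
  + by rewrite lee_fin ltW.
  + by move=> x /BI Ix; rewrite lee_fin mulr_ge0 ?divr_ge0 ?ltW ?f0 ?q0.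
  + apply/measurable_EFinP; apply: measurable_funM; first exact: mI.
    by apply: measurable_funM => //; exact: mI.
  have -> : (\int[mu]_(x in A `&` [set x | (x < u)%R]) (c%:E * (q x * (f x / c))%:E)
      = \int[mu]_(x in A `&` [set x | (x < u)%R]) (f x * q x)%:E)%E.
    by apply: eq_integral => x _; rewrite -EFinM; congr EFin; field; rewrite gt_eqF.
  apply: integral_fq_le => //; first exact: ltW.
  by move=> x [/AP[_ tx xb]] /= xu; rewrite /= in_itv/= !ltW.
Qed.

(** The mirror image of hardy_neumann_minus. *)
Lemma hardy_neumann_plus :
  (forall x, theta < x -> x <= beta ->
     (`|phi x|%:E <= \int[mu]_(u in `]theta, x[) `|psi u|%:E)%E) ->
  (c%:E * \int[mu]_(x in A) (phi x ^+ 2 * p x)%:E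
    <= \int[mu]_(x in A) (psi x ^+ 2 / q x)%:E)%E.
Proof.
move=> Hphi.
have mA : measurable A by exact: measurable_itv.
apply: (@weighted_hardy R A (fun x => [set u | u < x]) phi psi q
  f p (fun x => H x - H theta)) => //.
- exact: measurable_gt_pair.
- exact: mI.
- exact: mI.
- exact: mI.
- exact: mI.
- by move=> x /AI; exact: q0.
- by move=> x /AI; exact: f0.
- by move=> x /AI /p0 /ltW.
- by move=> x /AP[Ix tx _]; rewrite subr_gt0; exact: primitive_increasing.
- move=> x /AP[Ix tx xb].
  rewrite (_ : A `&` _ = `]theta, x[%classic); first exact: Hphi.
  apply/seteqP; split=> u /=; rewrite /A/= !in_itv/=.
    by move=> [/andP[-> _] ->].
  by move=> /andP[-> ux]; rewrite ux (le_trans _ xb)// ltW.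
- move=> x /AP[Ix tx xb].
  under eq_integral do rewrite mulrC.
  apply: integral_fq_le => //; first exact: ltW.
    by apply: measurableI => //; exact: measurable_lt_set.
  by move=> u [/AP[_ tu ub]] /= ux; rewrite /= in_itv/= !ltW.
- move=> u /AP[Iu tu ub].
  apply: le_trans (Hc Iu tu); apply: lee_wpmul2l; first by rewrite lee_fin ltW.
  under eq_integral do rewrite mulrC.
  apply: integral_le_h_plus => //; first exact: ltW.
    by apply: measurableI => //; exact: measurable_gt_set.
  move=> x [/AP[Ix _ _]] /= ux; split; last exact: Ix.2.
  by rewrite lte_fin.
Qed.

End plus.

End primitive_weight.
End one_sided.

(** * Lower bounds for the energy *)

Section lower_bounds.
Context {R : realType}.
Notation mu := (@lebesgue_measure R).
Variables (M N : \bar R).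
Local Notation I := (ereal_itv (- M)%E N).
Implicit Types (f p q H phi psi : R -> R) (theta x y z c : R).

Lemma absolutely_continuous_continuous phi : absolutely_continuous I phi ->
  continuous_on_itv (- M)%E N phi.
Proof.
move=> ac x Ix; apply/cvgrPdist_lt => e /ac[d d0 H].
have nI : nbhs x I by apply: open_nbhs_nbhs; split=> //; exact: open_ereal_itv.
have main u v : I u -> I v -> u <= v -> v - u < d -> `|phi v - phi u| < e.
  move=> Iu Iv uv uvd.
  have := H 1%N (fun=> u) (fun=> v); rewrite !big_ord1; apply => //.
  by move=> i j; rewrite !ord1 eqxx.
near=> y; have Iy : I y by near: y.
have yx : `|x - y| < d by near: y; exact: cvgr_dist_lt.
case: (leP y x) => [le_yx|/ltW le_xy].
  by apply: main => //; move: yx; rewrite ger0_norm ?subr_ge0.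
by rewrite distrC; apply: main => //; move: yx; rewrite distrC ger0_norm ?subr_ge0.
Unshelve. all: by end_near. Qed.

(** What the Hardy inequalities need of phi on [alpha, beta]: an integrand psi,
    equal almost everywhere to the derivative, that dominates the increments of
    phi and whose energy is at most that of phi. *)
Lemma ac_derive_majorant phi alpha beta : I alpha -> I beta -> alpha < beta ->
  absolutely_continuous I phi ->
  exists psi : R -> R, [/\ measurable_fun setT psi,
    forall x y, alpha <= x -> x <= y -> y <= beta ->
      (`|phi y - phi x|%:E <= \int[mu]_(u in `]x, y[) `|psi u|%:E)%E &
    forall v (A : set R), continuous_on_itv (- M)%E N v ->
      (forall x, I x -> 0 < v x) -> measurable A -> A `<=` `[alpha, beta] ->
      (\int[mu]_(x in A) (psi x ^+ 2 * v x)%:E <=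
       integral_density v I (fun x => (derive1 phi x ^+ 2)%:E))%E].
Proof.
move=> Ia Ib ab ac.
have := absolutely_continuous_chain ac (ereal_itv_segment Ia Ib).
move=> /(chain_ac_derive ab)[psi [ipsi Hpsi [Z [mZ Z0 HZ]]]].
have mpsi : measurable_fun setT psi by have /integrableP[/measurable_EFinP] := ipsi.
exists psi; split=> //.
  move=> x y ax xy yb.
  have mp (A : set R) : measurable A -> measurable_fun A (EFin \o psi).
    by move=> mA; apply/measurable_EFinP; exact: measurable_funS mpsi.
  rewrite -abse_EFin Hpsi//; apply: le_trans (le_abse_integral _ _ _) _ => //.
    exact: mp.
  rewrite -integral_itv_bndo_bndc//; last first.
    by apply: measurableT_comp => //; exact: mp.
move=> v A cv v0 mA Aab; rewrite /integral_density.
have AI : A `<=` I by apply: subset_trans Aab _; exact: ereal_itv_segment.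
(* The derivative is only identified with psi in the open interval and off Z. *)
apply: (@ge0_le_integral_ae_r _ _ _ mu _ _ (Z `|` [set alpha] `|` [set beta])) => //.
- by apply: measurableU => //; exact: measurableU.
- apply/measurable_EFinP; apply: measurable_funM.
    by apply: measurable_funX; exact: measurable_funS mpsi.
  exact: continuous_on_measurableS cv mA AI.
- apply/eqP; rewrite eq_le measure_ge0 andbT.
  apply: le_trans (measureU2 _ _ _) _ => //; first exact: measurableU.
  rewrite [X in (_ + X)%E]lebesgue_measure_set1 adde0.
  apply: le_trans (measureU2 _ _ _) _ => //.
  by rewrite [X in (_ + X)%E]lebesgue_measure_set1 adde0 [X in (X <= _)%E]Z0.
- by move=> x /AI Ix; rewrite lee_fin mulr_ge0 ?sqr_ge0// ltW// v0.
- by move=> x Ix; rewrite mule_ge0// lee_fin ?sqr_ge0// ltW// v0.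
move=> x Ax NZ; split; first exact: AI.
rewrite -EFinM lee_fin (_ : derive1 phi x = psi x)//.
have axb : alpha < x < beta.
  have := Aab _ Ax; rewrite /= in_itv/= => /andP[ax xb].
  rewrite !lt_neqAle ax xb !andbT; apply/andP; split; apply/eqP => e; apply: NZ.
    by left; right.
  by right.
by apply: contrapT => ne; apply: NZ; left; left; apply: HZ => /= h; apply: ne; exact: h.
Qed.

Lemma compact_enclosed (K : set R) theta : compact K -> K `<=` I -> I theta ->
  exists a b, [/\ I a, I b, a < theta < b & forall x, K x -> a < x < b].
Proof.
move=> cK KI It; have [->|/set0P K0] := eqVneq K set0.
  have [a [b [Ia Ib at_ tb]]] := ereal_itv_enlarge It It (lexx _).
  by exists a, b; split=> //; rewrite at_.
have ci : {within K, continuous (@id R)} by apply: continuous_subspaceT => x; exact: cvg_id.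
have [u /set_mem Ku Hu] := compact_EVT_min K0 cK ci.
have [v /set_mem Kv Hv] := compact_EVT_max K0 cK ci.
have Imin : I (Num.min u theta) by case: leP => // _; exact: KI.
have Imax : I (Num.max v theta) by case: leP => // _; exact: KI.
have [|a [b [Ia Ib aM Mb]]] := ereal_itv_enlarge Imin Imax.
  by rewrite ge_min !le_max lexx !orbT.
move: aM Mb; rewrite lt_min gt_max => /andP[au at_] /andP[vb tb].
exists a, b; split=> //; first by rewrite at_.
move=> x Kx; have := Hu x; have := Hv x; rewrite inE => /(_ Kx) xv /(_ Kx) ux.
by rewrite (lt_le_trans au)//= (le_lt_trans xv).
Qed.

Section bounds.
Variables (f p q : R -> R).
Hypotheses (cf : continuous_on_itv (- M)%E N f) (cp : continuous_on_itv (- M)%E N p)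
  (cq : continuous_on_itv (- M)%E N q).
Hypotheses (f0 : forall x, I x -> 0 < f x) (p0 : forall x, I x -> 0 < p x)
  (q0 : forall x, I x -> 0 < q x).
Variables (theta c : R).
Hypotheses (It : I theta) (c0 : 0 < c).
Hypothesis Hm : forall z, I z -> z < theta ->
  (c%:E * h_minus M p q f theta z <= (f z)%:E)%E.
Hypothesis Hp : forall z, I z -> theta < z ->
  (c%:E * h_plus N p q f theta z <= (f z)%:E)%E.

Let H := oriented_integral (fun u => f u * q u) theta.

Let dH x : I x -> is_derive x 1 H (f x * q x).
Proof.
move=> Ix; apply: (@oriented_integral_derive R (- M)%E N) => //.
by move=> y Iy; apply: continuousM; [exact: cf|exact: cq].
Qed.

Let continuous_inv v : continuous_on_itv (- M)%E N v -> (forall x, I x -> 0 < v x) ->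
  continuous_on_itv (- M)%E N (fun x => (v x)^-1).
Proof.
move=> cv v0 x Ix; apply: continuousV; first by rewrite gt_eqF// v0.
exact: (cv x Ix).
Qed.

(** The point theta is negligible, so the inequalities on both sides of it add
    up to one on [alpha, beta]. *)
Let glue alpha beta (g : R -> R) (h : R -> R) (B : \bar R) :
  I alpha -> I beta -> alpha < theta -> theta < beta ->
  measurable_fun I g -> (forall x, I x -> 0 <= g x) ->
  measurable_fun `[alpha, beta] h -> (forall x, `[alpha, beta]%classic x -> 0 <= h x) ->
  (c%:E * \int[mu]_(x in `[alpha, theta[) (g x)%:E <=
    \int[mu]_(x in `[alpha, theta[) (h x)%:E)%E ->
  (c%:E * \int[mu]_(x in `]theta, beta]) (g x)%:E <=
    \int[mu]_(x in `]theta, beta]) (h x)%:E)%E ->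
  (\int[mu]_(x in `[alpha, beta]) (h x)%:E <= B)%E ->
  (c%:E * \int[mu]_(x in `[alpha, beta]) (g x)%:E <= B)%E.
Proof.
move=> Ia Ib at_ tb mg g0 mh h0 gl gr hB.
pose A : set R := `[alpha, theta[%classic `|` `]theta, beta]%classic.
have mA : measurable A by apply: measurableU; exact: measurable_itv.
have disj : [disjoint `[alpha, theta[%classic & `]theta, beta]%classic].
  apply/disj_setPS => x /= [] /[!in_itv]/= /andP[_ xt] /andP[tx _].
  by have := lt_trans xt tx; rewrite ltxx.
have Aab : A `<=` `[alpha, beta].
  move=> x [] /=; rewrite !in_itv/= => /andP[h1 h2].
    by rewrite h1 ltW// (lt_trans h2).
  by rewrite h2 andbT ltW// (lt_trans _ h1).
have abI := ereal_itv_segment Ia Ib.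
have mgab : measurable_fun `[alpha, beta] (EFin \o g).
  apply/measurable_EFinP; apply: measurable_funS mg => //.
  exact: measurable_ereal_itv.
have mhab : measurable_fun `[alpha, beta] (EFin \o h) by exact/measurable_EFinP.
have gE : (\int[mu]_(x in `[alpha, beta]) (g x)%:E <= \int[mu]_(x in A) (g x)%:E)%E.
  apply: (@ge0_le_integral_ae_l _ _ _ mu _ _ [set theta]) => //.
  - by apply: measurable_funS mgab.
  - exact: lebesgue_measure_set1.
  - by move=> x /abI Ix; rewrite lee_fin g0.
  - by move=> x /Aab/abI Ix; rewrite lee_fin g0.
  move=> x /=; rewrite in_itv/= => /andP[ax xb] _ xt; split=> //.
  rewrite /A/= !in_itv/=; case: (ltgtP x theta) => [h1|h1|//].
    by left; rewrite ax.
  by right; rewrite xb.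
apply: le_trans hB; apply: (@le_trans _ _ (c%:E * \int[mu]_(x in A) (g x)%:E)%E).
  by apply: lee_wpmul2l => //; rewrite lee_fin ltW.
rewrite ge0_integral_setU//; first last.
- by move=> x /Aab/abI Ix; rewrite lee_fin g0.
- by apply: measurable_funS mgab.
rewrite ge0_muleDr; last 2 first.
- apply: integral_ge0 => x Ax; rewrite lee_fin g0//; apply/abI/Aab; by left.
- apply: integral_ge0 => x Ax; rewrite lee_fin g0//; apply/abI/Aab; by right.
apply: (@le_trans _ _ (\int[mu]_(x in A) (h x)%:E)%E).
  rewrite ge0_integral_setU//; first exact: leeD.
  - by apply: measurable_funS mhab.
  - by move=> x /Aab Ix; rewrite lee_fin h0.
by apply: ge0_subset_integral => // x hx; rewrite lee_fin h0.
Qed.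

(** Enlarging the support to an interval ]a, b[ around theta makes phi vanish
    at a and at b, from which the two one-sided inequalities start. *)
Lemma dirichlet_lower_bound phi : absolutely_continuous I phi ->
  compact_support_in I phi ->
  (c%:E * integral_density q I (fun x => (phi x ^+ 2)%:E) <=
   integral_density (fun x => ((p x)^-1)%R) I (fun x => (derive1 phi x ^+ 2)%:E))%E.
Proof.
move=> ac [K [cK KI phi0]].
have [a [b [Ia Ib /andP[at_ tb] Kab]]] := compact_enclosed cK KI It.
have ab := lt_trans at_ tb.
have [psi [mpsi Hpsi HD]] := ac_derive_majorant Ia Ib ab ac.
have cphi := absolutely_continuous_continuous ac.
have out x : I x -> ~ (a < x < b) -> phi x = 0.
  by move=> Ix nx; apply: phi0 => // /Kab.
pose g x := phi x ^+ 2 * q x.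
have cg : continuous_on_itv (- M)%E N g.
  by move=> x Ix; apply: continuousM; [apply: continuousM; exact: cphi|exact: cq].
have g0 x : I x -> 0 <= g x by move=> Ix; rewrite mulr_ge0 ?sqr_ge0// ltW// q0.
have cVp := continuous_inv cp p0.
apply: (@le_trans _ _ (c%:E * \int[mu]_(x in `[a, b]) (g x)%:E)%E).
  apply: lee_wpmul2l; first by rewrite lee_fin ltW.
  apply: ge0_le_integral_any => [x Ix|x xab|x Ix].
  - by rewrite -EFinM lee_fin g0.
  - by rewrite lee_fin g0//; apply: (ereal_itv_segment Ia Ib).
  rewrite -EFinM => nz; split=> //=; rewrite in_itv/=.
  apply: contrapT => nx; move: nz; rewrite out ?expr0n ?mul0r ?eqxx//.
  by move=> /andP[ax xb]; apply: nx; rewrite !ltW.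
apply: (glue (h := fun x => psi x ^+ 2 * (p x)^-1)) => //.
- exact: continuous_on_measurable.
- apply: measurable_funM; first by apply: measurable_funX; exact: measurable_funS mpsi.
  exact: continuous_on_measurableS cVp (measurable_itv _) (ereal_itv_segment Ia Ib).
- move=> x /(ereal_itv_segment Ia Ib) Ix.
  by rewrite mulr_ge0 ?sqr_ge0// invr_ge0 ltW// p0.
- apply: (hardy_dirichlet_minus cf cp cq f0 p0 q0 dH It c0 Ia) => //.
    exact: measurable_funS mpsi.
  move=> x ax xt; have phia : phi a = 0 by apply: out => //; rewrite ltxx.
  have := Hpsi a x (lexx _) ax (ltW (lt_trans xt tb)); rewrite phia subr0 => /le_trans; apply.
  apply: ge0_subset_integral => //.
  + apply/measurable_EFinP; apply: measurableT_comp => //.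
    exact: measurable_funS mpsi.
  + by apply: subset_itvr; rewrite bnd_simp.
- apply: (hardy_dirichlet_plus cf cp cq f0 p0 q0 dH It c0 Ib) => //.
    exact: measurable_funS mpsi.
  move=> x tx xb; have phib : phi b = 0 by apply: out => //; rewrite ltxx andbF.
  have := Hpsi x b (ltW (lt_trans at_ tx)) xb (lexx _).
  rewrite phib sub0r normrN => /le_trans; apply.
  apply: ge0_subset_integral => //.
  + apply/measurable_EFinP; apply: measurableT_comp => //.
    exact: measurable_funS mpsi.
  + by apply: subset_itvl; rewrite bnd_simp.
by apply: HD => // x Ix; rewrite invr_gt0 p0.
Qed.

(** Both one-sided inequalities start from theta, where phi - phi(theta)
    vanishes; phi may not vanish anywhere near the ends, so the left-hand side is
    first bounded on compact intervals. *)
Lemma neumann_lower_bound_centered phi : absolutely_continuous I phi ->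
  (c%:E * integral_density p I (fun x => ((phi x - phi theta) ^+ 2)%:E) <=
   integral_density (fun x => ((q x)^-1)%R) I (fun x => (derive1 phi x ^+ 2)%:E))%E.
Proof.
move=> ac; have cphi := absolutely_continuous_continuous ac.
pose g x := (phi x - phi theta) ^+ 2 * p x.
have cg : continuous_on_itv (- M)%E N g.
  move=> x Ix; apply: continuousM; last exact: cp.
  by apply: continuousM; apply: continuousB; [exact: cphi|exact: cst_continuous|
    exact: cphi|exact: cst_continuous].
have g0 x : I x -> 0 <= g x by move=> Ix; rewrite mulr_ge0 ?sqr_ge0// ltW// p0.
have cVq := continuous_inv cq q0.
set D := integral_density _ _ _.
rewrite /integral_density; under eq_integral do rewrite -EFinM.
rewrite muleC -lee_pdivlMr//.
apply: (ge0_integral_exhaust It).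
- by apply/measurable_EFinP; exact: continuous_on_measurable.
- by move=> x Ix; rewrite lee_fin g0.
move=> a' b' Ia' Ib' /andP[at' tb'].
have [a [b [Ia Ib aa' b'b]]] := ereal_itv_enlarge Ia' Ib' (le_trans at' tb').
have at_ := lt_le_trans aa' at'; have tb := le_lt_trans tb' b'b.
have ab := lt_trans at_ tb.
have [psi [mpsi Hpsi HD]] := ac_derive_majorant Ia Ib ab ac.
rewrite lee_pdivlMr// muleC.
apply: (@le_trans _ _ (c%:E * \int[mu]_(x in `[a, b]) (g x)%:E)%E).
  apply: lee_wpmul2l; first by rewrite lee_fin ltW.
  apply: ge0_subset_integral => //.
  - apply: continuous_on_emeasurableS cg _ _ => //.
    exact: ereal_itv_segment.
  - by move=> x xab; rewrite lee_fin g0//; apply: (ereal_itv_segment Ia Ib).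
  - by apply: subset_itv; rewrite bnd_simp ltW.
apply: (glue (h := fun x => psi x ^+ 2 * (q x)^-1)) => //.
- exact: continuous_on_measurable.
- apply: measurable_funM; first by apply: measurable_funX; exact: measurable_funS mpsi.
  exact: continuous_on_measurableS cVq (measurable_itv _) (ereal_itv_segment Ia Ib).
- move=> x /(ereal_itv_segment Ia Ib) Ix.
  by rewrite mulr_ge0 ?sqr_ge0// invr_ge0 ltW// q0.
- apply: (hardy_neumann_minus cf cp cq f0 p0 q0 dH It c0 Ia Hm
    (phi := fun x => phi x - phi theta)) => //.
    exact: measurable_funS mpsi.
  move=> x ax xt; rewrite distrC.
  by apply: Hpsi => //; exact: ltW.
- apply: (hardy_neumann_plus cf cp cq f0 p0 q0 dH It c0 Ib Hp
    (phi := fun x => phi x - phi theta)) => //.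
    exact: measurable_funS mpsi.
  by move=> x tx xb; apply: Hpsi => //; exact: ltW.
by apply: HD => // x Ix; rewrite invr_gt0 q0.
Qed.

End bounds.
End lower_bounds.

(** * The root theta *)

Section root.
Context {R : realType}.
Notation mu := (@lebesgue_measure R).
Variables (M N : \bar R).
Local Notation I := (ereal_itv (- M)%E N).
Implicit Types (f g p q H : R -> R) (theta x y z c : R).

Lemma integral_continuous_gt0 g x : continuous_on_itv (- M)%E N g ->
  (forall x, I x -> 0 < g x) -> I x -> (0 < \int[mu]_(x in I) (g x)%:E)%E.
Proof.
move=> cg g0 Ix; have [a [b [Ia Ib ax xb]]] := ereal_itv_enlarge Ix Ix (lexx _).
have ab := lt_trans ax xb.
pose G := oriented_integral g x.
have dG y : I y -> is_derive y 1 G (g y).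
  by move=> Iy; exact: (@oriented_integral_derive R (- M)%E N).
apply: (@lt_le_trans _ _ (\int[mu]_(x in `[a, b]) (g x)%:E)%E).
  rewrite (derive_on_integral dG cg Ia Ib (ltW ab)) lte_fin.
  have [c [ac cb ->]] := derive_on_MVT dG Ia Ib ab.
  rewrite mulr_gt0 ?subr_gt0// g0//.
  by apply: (ereal_itv_between Ia Ib); rewrite !ltW.
apply: ge0_subset_integral => //.
- exact: measurable_ereal_itv.
- exact: continuous_on_emeasurableS cg (measurable_ereal_itv _ _) (subset_refl _).
- by move=> y Iy; rewrite lee_fin ltW// g0.
- exact: ereal_itv_segment.
Qed.

Lemma ereal_itv_splitE theta : I theta ->
  I `\` [set theta] = ereal_itv (- M)%E theta%:E `|` ereal_itv theta%:E N.
Proof.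
move=> It; apply/seteqP; split=> [x [Ix /eqP xt]|x [|]].
- have [Mx xN] := Ix; case: (ltgtP x theta) xt => // [xt|tx] _; [left|right];
  by split=> //; rewrite lte_fin.
- move=> xt; split; first exact: (ereal_itv_minus It).
  by move=> /= e; move: xt; rewrite e => -[_]; rewrite ltxx.
- move=> tx; split; first exact: (ereal_itv_plus It).
  by move=> /= e; move: tx; rewrite e => -[]; rewrite ltxx.
Qed.

Lemma ereal_itv_disjoint theta :
  [disjoint ereal_itv (- M)%E theta%:E & ereal_itv theta%:E N].
Proof. by apply/disj_setPS => x /= [[_ h1] [/(lt_trans h1)]]; rewrite ltxx. Qed.

Lemma Rintegral_ereal_itv_split g theta : I theta -> mu.-integrable I (EFin \o g) ->
  \int[mu]_(x in I) g x = \int[mu]_(x in ereal_itv (- M)%E theta%:E) g x +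
    \int[mu]_(x in ereal_itv theta%:E N) g x.
Proof.
move=> It ig; have mI := measurable_ereal_itv (- M)%E N.
rewrite -Rintegral_setU; [|exact: measurable_ereal_itv|exact: measurable_ereal_itv| |
  exact: ereal_itv_disjoint].
  rewrite /Rintegral (@negligible_integral _ _ _ mu _ [set theta])//.
    by rewrite ereal_itv_splitE.
  exact: lebesgue_measure_set1.
apply: integrableS ig => //.
  by apply: measurableU; exact: measurable_ereal_itv.
by rewrite -ereal_itv_splitE//; exact: subDsetl.
Qed.

Lemma ge0_integral_ereal_itv_split g theta : I theta -> measurable_fun I g ->
  (forall x, I x -> 0 <= g x) ->
  (\int[mu]_(x in I) (g x)%:E = \int[mu]_(x in ereal_itv (- M)%E theta%:E) (g x)%:E +
    \int[mu]_(x in ereal_itv theta%:E N) (g x)%:E)%E.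
Proof.
move=> It mg g0; have mI := measurable_ereal_itv (- M)%E N.
have mEg : measurable_fun I (EFin \o g) by exact/measurable_EFinP.
rewrite -ge0_integral_setU; first last.
- exact: ereal_itv_disjoint.
- by move=> x; rewrite -ereal_itv_splitE// => -[Ix _]; rewrite lee_fin g0.
- by apply: measurable_funS mEg => //; rewrite -ereal_itv_splitE//; exact: subDsetl.
- exact: measurable_ereal_itv.
- exact: measurable_ereal_itv.
rewrite (@ge0_negligible_integral _ _ _ mu _ [set theta])//.
  by rewrite ereal_itv_splitE.
exact: lebesgue_measure_set1.
Qed.

Section fixed_weights.
Variables (f p q H : R -> R).
Hypotheses (cf : continuous_on_itv (- M)%E N f) (cp : continuous_on_itv (- M)%E N p)
  (cq : continuous_on_itv (- M)%E N q).
Hypotheses (f0 : forall x, I x -> 0 < f x) (p0 : forall x, I x -> 0 < p x)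
  (q0 : forall x, I x -> 0 < q x).
Hypothesis dH : forall x, I x -> is_derive x 1 H (f x * q x).
Hypothesis ip : mu.-integrable I (EFin \o p).
Variable x0 : R.
Hypothesis Ix0 : I x0.

Let mI : measurable (I : set (measurableTypeR R)) := measurable_ereal_itv (- M)%E N.

Let h_integrable theta : h_finite M N p q f -> I theta ->
  mu.-integrable I (EFin \o (fun x => (H theta - H x) * p x)).
Proof.
move=> hf It; have cw := @continuous_minus_weight R M N f p q H cp dH theta.
have mw := continuous_on_measurable cw.
apply/integrableP; split; first exact/measurable_EFinP.
apply: (@le_lt_trans _ _ (\int[mu]_(x in I) (`|(H theta - H x) * p x|)%:E)%E) => //.
rewrite (ge0_integral_ereal_itv_split It)//; last by apply: measurableT_comp.
have [hm hp] := hf _ _ It It.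
apply: lte_add_pinfty.
  apply: le_lt_trans (hm (lexx _)).
  rewrite (h_minusE p cf cq dH It It)// le_eqVlt; apply/orP; left; apply/eqP.
  apply: eq_integral => x /[!inE] xt; rewrite ger0_norm//.
  have Ix := ereal_itv_minus It xt; rewrite mulr_ge0//; last by rewrite ltW// p0.
  rewrite subr_ge0; apply: (primitive_nondecreasing f0 q0 dH) => //.
  by move: xt => -[_]; rewrite lte_fin => /ltW.
apply: le_lt_trans (hp (lexx _)).
rewrite (h_plusE p cf cq dH It It)// le_eqVlt; apply/orP; left; apply/eqP.
apply: eq_integral => x /[!inE] xt; rewrite -normrN -mulNr opprB ger0_norm//.
have Ix := ereal_itv_plus It xt; rewrite mulr_ge0//; last by rewrite ltW// p0.
rewrite subr_ge0; apply: (primitive_nondecreasing f0 q0 dH) => //.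
by move: xt => -[]; rewrite lte_fin => /ltW.
Qed.

Let P := \int[mu]_(x in I) p x.
Let m := \int[mu]_(x in I) (H x * p x).

Let P0 : 0 < P.
Proof.
rewrite -lte_fin /P /Rintegral fineK; last exact: integrable_fin_num.
exact: integral_continuous_gt0 Ix0.
Qed.

Let Hp_integrable : h_finite M N p q f ->
  mu.-integrable I (EFin \o (fun x => H x * p x)).
Proof.
move=> hf; have := integrableB mI (integrableZl mI (H x0) ip) (h_integrable hf Ix0).
apply: eq_integrable => // x _ /=.
by rewrite -EFinM -EFinB; congr EFin; ring.
Qed.

Let Rintegral_minus theta : h_finite M N p q f -> I theta ->
  \int[mu]_(x in I) ((H theta - H x) * p x) = H theta * P - m.
Proof.
move=> hf It; rewrite -RintegralZl// -RintegralB//.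
- by apply: eq_Rintegral => x _; rewrite mulrBl.
- exact: (integrableZl mI (H theta) ip).
- exact: Hp_integrable.
Qed.

(** The difference h^-(theta) - h^+(theta) is the integral over the whole
    interval of (H(theta) - H) p, that is H(theta) P - m. The roots are thus the
    points at which H takes its mean value with respect to p. *)
Lemma h_rootE theta : h_finite M N p q f -> I theta ->
  h_root M N p q f theta <-> H theta = m / P.
Proof.
move=> hf It; have iw := h_integrable hf It.
have hm : h_minus M p q f theta theta =
    (\int[mu]_(x in ereal_itv (- M)%E theta%:E) ((H theta - H x) * p x))%:E.
  rewrite (h_minusE p cf cq dH It It)// /Rintegral fineK//.
  apply: integrable_fin_num; first exact: measurable_ereal_itv.
  apply: integrableS iw => //; first exact: measurable_ereal_itv.
  exact: ereal_itv_minus.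
have hp : h_plus N p q f theta theta =
    (- \int[mu]_(x in ereal_itv theta%:E N) ((H theta - H x) * p x))%:E.
  have iw2 : mu.-integrable (ereal_itv theta%:E N) (EFin \o (fun x => (H theta - H x) * p x)).
    apply: integrableS iw => //; first exact: measurable_ereal_itv.
    exact: ereal_itv_plus.
  rewrite (h_plusE p cf cq dH It It)// /Rintegral EFinN fineK; last first.
    by apply: integrable_fin_num => //; exact: measurable_ereal_itv.
  rewrite -integralN/=; last first.
    by apply: (integrable_add_def _ iw2); exact: measurable_ereal_itv.
  by apply: eq_integral => x _ /=; rewrite -?EFinN; congr EFin; ring.
have split := Rintegral_ereal_itv_split It iw.
rewrite (Rintegral_minus hf It) in split.
rewrite /h_root hm hp; split=> [[_ [e]]|e].
  rewrite e addNr in split; apply/(canRL (mulfK _)); first by rewrite gt_eqF.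
  by apply/eqP; rewrite -subr_eq0 split.
split=> //; congr EFin; apply/eqP; rewrite -addr_eq0 -split e divfK ?subrr//.
by rewrite gt_eqF.
Qed.

(** A continuous strictly increasing function takes its mean value exactly
    once. *)
Lemma h_root_unique_exists : h_finite M N p q f ->
  exists theta, unique (h_root M N p q f) theta.
Proof.
move=> hf; pose k := m / P.
have kPm : k * P = m by rewrite /k divfK// gt_eqF.
have ik : mu.-integrable I (EFin \o (fun x => (k - H x) * p x)).
  have := integrableB mI (integrableZl mI k ip) (Hp_integrable hf).
  apply: eq_integrable => // x _ /=.
  by rewrite -EFinM -EFinB; congr EFin; ring.
have R0 : \int[mu]_(x in I) ((k - H x) * p x) = 0.
  transitivity (\int[mu]_(x in I) (k * p x) - \int[mu]_(x in I) (H x * p x)).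
    rewrite -RintegralB//; [|exact: (integrableZl mI k ip)|exact: Hp_integrable].
    by apply: eq_Rintegral => x _; rewrite mulrBl.
  by rewrite RintegralZl// kPm subrr.
have cH := derive_on_continuous dH.
have I0 : (\int[mu]_(x in I) ((k - H x) * p x)%:E = 0)%E.
  have := R0; rewrite /Rintegral => e; rewrite -[LHS]fineK ?e//.
  exact: integrable_fin_num.
(* If H stayed on one side of its mean, the integral of (k - H) p would not vanish. *)
have [u [Iu Hu]] : exists u, I u /\ H u <= k.
  apply: contrapT => ne.
  have : (0 < \int[mu]_(x in I) ((H x - k) * p x)%:E)%E.
    apply: (integral_continuous_gt0 _ _ Ix0) => x Ix.
      apply: continuousM; last exact: cp.
      by apply: continuousB; [exact: cH|exact: cst_continuous].
    rewrite mulr_gt0 ?p0// subr_gt0 ltNge; apply/negP => h; apply: ne.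
    by exists x.
  have -> : (\int[mu]_(x in I) ((H x - k) * p x)%:E =
             \int[mu]_(x in I) - ((k - H x) * p x)%:E)%E.
    by apply: eq_integral => x _ /=; rewrite -?EFinN; congr EFin; ring.
  by rewrite integralN ?I0 ?oppe0 ?ltxx//; exact: (integrable_add_def mI ik).
have [v [Iv Hv]] : exists v, I v /\ k <= H v.
  apply: contrapT => ne.
  have : (0 < \int[mu]_(x in I) ((k - H x) * p x)%:E)%E.
    apply: (integral_continuous_gt0 _ _ Ix0) => x Ix.
      apply: continuousM; last exact: cp.
      by apply: continuousB; [exact: cst_continuous|exact: cH].
    rewrite mulr_gt0 ?p0// subr_gt0 ltNge; apply/negP => h; apply: ne.
    by exists x.
  by rewrite I0 ltxx.
have uv : u <= v.
  rewrite leNgt; apply/negP => vu.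
  by have := primitive_increasing f0 q0 dH Iv Iu vu; rewrite ltNge (le_trans Hu).
have [|theta] := IVT uv (continuous_on_segment cH Iu Iv) (v := k).
  by rewrite ge_min Hu le_max Hv orbT.
rewrite in_itv/= => ut Ht.
have It := ereal_itv_between Iu Iv ut.
exists theta; split; first exact/h_rootE.
move=> t rt; have It' : I t by case: rt.
move: rt => /(h_rootE hf It'); rewrite -/k -Ht => Htt.
case: (ltgtP theta t) => // h.
  by have := primitive_increasing f0 q0 dH It It' h; rewrite Htt ltxx.
by have := primitive_increasing f0 q0 dH It' It h; rewrite Htt ltxx.
Qed.

End fixed_weights.
End root.

(** * Linear systems with continuous coefficients *)

Section linear_system.
Context {R : realType}.
Variables (l r : \bar R).
Local Notation I := (ereal_itv l r).
Implicit Types (F G h k : R -> R).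

Lemma is_derive_eq_val (F : R -> R) (x d d' : R) :
  is_derive x 1 F d -> d = d' -> is_derive x 1 F d'.
Proof. by move=> dF <-. Qed.

(** The mean value theorem applied to G + F and to G - F. *)
Lemma derive_on_dominated F G h k a b :
  (forall x, I x -> is_derive x 1 F (h x)) ->
  (forall x, I x -> is_derive x 1 G (k x)) -> I a -> I b -> a <= b ->
  (forall x, a <= x <= b -> `|h x| <= k x) -> `|F b - F a| <= G b - G a.
Proof.
move=> dF dG Ia Ib; rewrite le_eqVlt => /predU1P[->|ab] hk; first by rewrite !subrr normr0.
rewrite ler_norml; apply/andP; split.
  have dS x : I x -> is_derive x 1 (fun x => G x + F x) (k x + h x).
    by move=> Ix; apply: is_deriveD; [exact: dG|exact: dF].
  have [c [ac cb e]] := derive_on_MVT dS Ia Ib ab.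
  have : 0 <= (k c + h c) * (b - a).
    have := hk c; rewrite (ltW ac) (ltW cb) ler_norml => /(_ isT)/andP[h1 h2].
    by apply: mulr_ge0; lra.
  by rewrite -e; lra.
have dS x : I x -> is_derive x 1 (fun x => G x - F x) (k x - h x).
  by move=> Ix; apply: is_deriveB; [exact: dG|exact: dF].
have [c [ac cb e]] := derive_on_MVT dS Ia Ib ab.
have : 0 <= (k c - h c) * (b - a).
  have := hk c; rewrite (ltW ac) (ltW cb) ler_norml => /(_ isT)/andP[h1 h2].
  by apply: mulr_ge0; lra.
by rewrite -e; lra.
Qed.

(** The sequence u + v is nondecreasing and bounded. *)
Lemma cvg_dominated_increments (u v : nat -> R) (L : R) :
  v @ \oo --> L ->
  (forall n m, (n <= m)%N -> `|u m - u n| <= v m - v n) ->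
  u @ \oo --> limn u /\ forall n, `|limn u - u n| <= L - v n.
Proof.
move=> vL uv.
have vnd : {homo v : n m / (n <= m)%N >-> n <= m}.
  by move=> n m /uv; have := normr_ge0 (u m - u n); lra.
have cv : cvgn v by apply/cvg_ex; exists L.
have vle n : v n <= L by rewrite -(cvg_lim _ vL)//; exact: nondecreasing_cvgn_le.
have cuv : cvgn (u \+ v).
  apply: nondecreasing_is_cvgn => [n m /uv|]; first by rewrite ler_norml/= => /andP[]; lra.
  exists (u 0%N + L - v 0%N + L) => _ [n _ <-] /=.
  have := uv _ _ (leq0n n); rewrite ler_norml => /andP[_].
  by have := vle n; lra.
have cu : cvgn u.
  rewrite (_ : u = (u \+ v) \- v); first exact: is_cvgB.
  by apply/funext => n /=; rewrite addrK.
split=> // n.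
have h1 : `|u m - u n| @[m --> \oo] --> `|limn u - u n|.
  by apply: cvg_norm; apply: cvgB => //; exact: cvg_cst.
have h2 : v m - v n @[m --> \oo] --> L - v n by apply: cvgB => //; exact: cvg_cst.
apply: ler_cvg_to h1 h2 _.
by near=> m; apply: uv; near: m; exact: nbhs_infty_ge.
Unshelve. all: by end_near. Qed.

Variables (p q : R -> R) (x0 g0 k0 : R).
Hypotheses (cp : continuous_on_itv l r p) (cq : continuous_on_itv l r q).
Hypothesis (Ix0 : I x0).

Local Notation prim h := (oriented_integral h x0).

(** Picard iterates of g' = p k, k' = q g with values g0, k0 at x0. Starting
    from zero makes the constant pair the first iterate, so that the increments
    obey one formula from the beginning. *)
Fixpoint picard (n : nat) : (R -> R) * (R -> R) :=
  if n is m.+1 then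
    (fun x => g0 + prim (fun u => p u * (picard m).2 u) x,
     fun x => k0 + prim (fun u => q u * (picard m).1 u) x)
  else (fun=> 0, fun=> 0).

Let A n := (picard n).1.
Let B n := (picard n).2.

Let prim_derive h : continuous_on_itv l r h ->
  forall x, I x -> is_derive x 1 (prim h) (h x).
Proof. by move=> ch x Ix; exact: (@oriented_integral_derive R l r). Qed.

Let picard_continuous n : continuous_on_itv l r (A n) /\ continuous_on_itv l r (B n).
Proof.
elim: n => [|n [cA cB]]; first by split=> x _; exact: cst_continuous.
split=> x Ix; (apply: continuousD; first exact: cst_continuous).
  apply: (derive_on_continuous (prim_derive _)) => // y Iy.
  by apply: continuousM; [exact: cp|exact: cB].
apply: (derive_on_continuous (prim_derive _)) => // y Iy.
by apply: continuousM; [exact: cq|exact: cA].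
Qed.

Let dA n x : I x -> is_derive x 1 (A n.+1) (p x * B n x).
Proof.
move=> Ix; apply: is_derive_eq_val; last exact: add0r.
apply: is_deriveD; apply: prim_derive => // y Iy.
by apply: continuousM; [exact: cp|exact: (picard_continuous n).2].
Qed.

Let dB n x : I x -> is_derive x 1 (B n.+1) (q x * A n x).
Proof.
move=> Ix; apply: is_derive_eq_val; last exact: add0r.
apply: is_deriveD; apply: prim_derive => // y Iy.
by apply: continuousM; [exact: cq|exact: (picard_continuous n).1].
Qed.

Let A0 n : A n.+1 x0 = g0.
Proof. by rewrite /A/= oriented_integralxx addr0. Qed.

Let B0 n : B n.+1 x0 = k0.
Proof. by rewrite /B/= oriented_integralxx addr0. Qed.

(** With E the signed integral of w from x0, the n-th increment of the iterates
    is at most m0 |E|^n/n!; this majorant is summable at every point of the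
    interval, however large E is, which gives a global solution at once. *)
Let w x := `|p x| + `|q x|.

Let cw : continuous_on_itv l r w.
Proof.
by move=> x Ix; apply: continuousD; apply: continuous_comp;
  [exact: cp|exact: norm_continuous|exact: cq|exact: norm_continuous].
Qed.

Let E := prim w.
Let dE : forall x, I x -> is_derive x 1 E (w x). Proof. exact: prim_derive. Qed.
Let E0 : E x0 = 0. Proof. exact: oriented_integralxx. Qed.
Let w0 x : 0 <= w x. Proof. by rewrite addr_ge0. Qed.

Let E_mono a b : I a -> I b -> a <= b -> E a <= E b.
Proof.
move=> Ia Ib ab; have dz z : I z -> is_derive z 1 (fun=> 0 : R) (0 : R).
  by move=> _; exact: is_derive_cst.
rewrite -subr_ge0; apply: le_trans (normr_ge0 (0 - 0 : R)) _.
by apply: (derive_on_dominated dz dE) => // z _; rewrite normr0.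
Qed.

Let E_ge0 x : I x -> x0 <= x -> 0 <= E x.
Proof. by move=> Ix x0x; rewrite -[leLHS]E0; exact: E_mono. Qed.

Let E_le0 x : I x -> x <= x0 -> E x <= 0.
Proof. by move=> Ix x0x; rewrite -[leRHS]E0; exact: E_mono. Qed.

Let m0 := `|g0| + `|k0|.
Let m0_ge0 : 0 <= m0. Proof. by rewrite addr_ge0. Qed.

Let dEX n x : I x -> is_derive x 1 (fun x => m0 * (E x ^+ n.+1 / n.+1`!%:R))
  (m0 * (E x ^+ n / n`!%:R * w x)).
Proof.
move=> Ix.
have d1 : is_derive x 1 (E ^+ n.+1) ((n.+1%:R * E x ^+ n) *: w x).
  exact: (is_deriveX n.+1 (dE Ix)).
have := is_deriveZ (m0 / n.+1`!%:R) d1.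
rewrite (_ : _ \*: _ = (fun x => m0 * (E x ^+ n.+1 / n.+1`!%:R))); last first.
  by apply/funext => y /=; rewrite /GRing.scale/= -mulrA (mulrC _^-1) exprfctE.
move=> /is_derive_eq_val; apply.
rewrite /GRing.scale/= factS natrM invfM.
have : (n`!%:R : R) != 0 by rewrite pnatr_eq0 -lt0n fact_gt0.
have : (n.+1%:R : R) != 0 by rewrite pnatr_eq0.
move: (n.+1%:R : R) (n`!%:R : R) => s t s0 t0.
by field; rewrite s0 t0.
Qed.

(** To the left of x0 the function E is negative; the outer sign makes the
    majorant increasing there. *)
Let dEXN n x : I x -> is_derive x 1 (fun x => - (m0 * ((- E x) ^+ n.+1 / n.+1`!%:R)))
  (m0 * ((- E x) ^+ n / n`!%:R * w x)).
Proof.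
move=> Ix; have := is_deriveZ ((-1) ^+ n) (dEX n Ix).
rewrite (_ : _ \*: _ = (fun x => - (m0 * ((- E x) ^+ n.+1 / n.+1`!%:R)))); last first.
  apply/funext => y /=; rewrite /GRing.scale/= [in RHS]exprNn [(-1) ^+ n.+1]exprS.
  by set a := (-1) ^+ n; set b := E y ^+ _; set c := _^-1; ring.
move=> /is_derive_eq_val; apply.
rewrite /GRing.scale/= [in RHS]exprNn.
by set a := (-1) ^+ n; set b := E x ^+ _; set c := _^-1; ring.
Qed.

Let step_bound (u h k : R -> R) n x : I x ->
  (forall y, I y -> is_derive y 1 u (h y * k y)) -> u x0 = 0 ->
  (forall y, I y -> `|h y| <= w y) ->
  (forall y, I y -> `|k y| <= m0 * (`|E y| ^+ n / n`!%:R)) ->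
  `|u x| <= m0 * (`|E x| ^+ n.+1 / n.+1`!%:R).
Proof.
move=> Ix du u0 hw kE.
have [x0x|/ltW xx0] := leP x0 x.
  have -> : `|u x| = `|u x - u x0| by rewrite u0 subr0.
  have e : m0 * (`|E x| ^+ n.+1 / n.+1`!%:R) = m0 * (E x ^+ n.+1 / n.+1`!%:R) -
      m0 * (E x0 ^+ n.+1 / n.+1`!%:R).
    by rewrite E0 expr0n/= mul0r mulr0 subr0 ger0_norm// E_ge0.
  rewrite e; apply: (derive_on_dominated du (@dEX n)) => // y x0yx.
  have Iy : I y by exact: (ereal_itv_between Ix0 Ix).
  have /andP[x0y _] := x0yx.
  rewrite normrM mulrC mulrA; apply: ler_pM => //; last exact: hw.
  by have := kE y Iy; rewrite (ger0_norm (E_ge0 Iy x0y)).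
have -> : `|u x| = `|u x0 - u x| by rewrite u0 sub0r normrN.
have e : m0 * (`|E x| ^+ n.+1 / n.+1`!%:R) = - (m0 * ((- E x0) ^+ n.+1 / n.+1`!%:R)) -
    - (m0 * ((- E x) ^+ n.+1 / n.+1`!%:R)).
  by rewrite E0 oppr0 expr0n/= mul0r mulr0 oppr0 sub0r opprK ler0_norm// E_le0.
rewrite e; apply: (derive_on_dominated du (@dEXN n)) => // y x0yx.
have Iy : I y by exact: (ereal_itv_between Ix Ix0).
have /andP[_ yx0] := x0yx.
rewrite normrM mulrC mulrA; apply: ler_pM => //; last exact: hw.
by have := kE y Iy; rewrite (ler0_norm (E_le0 Iy yx0)).
Qed.

Let increment_bound n : forall x, I x ->
  `|A n.+1 x - A n x| <= m0 * (`|E x| ^+ n / n`!%:R) /\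
  `|B n.+1 x - B n x| <= m0 * (`|E x| ^+ n / n`!%:R).
Proof.
elim: n => [x Ix|n ih x Ix].
  rewrite /A/B/= expr0 fact0 divr1 mulr1 !subr0.
  have z h : prim (fun u => h u * 0) x = 0.
    rewrite (_ : (fun u => h u * 0) = cst 0).
      by rewrite /oriented_integral; case: ifP => _; rewrite Rintegral_cst// mul0r ?oppr0.
    by apply/funext => y; rewrite mulr0.
  by rewrite !z !addr0 /m0 lerDl lerDr.
split.
  apply: (step_bound (h := p) (k := fun y => B n.+1 y - B n y)
    (u := fun y => A n.+2 y - A n.+1 y)) => //.
  - move=> y Iy; apply: is_derive_eq_val.
      by apply: is_deriveB; exact: dA.
    by rewrite mulrBr.
  - by rewrite !A0 subrr.
  - by move=> y Iy; rewrite lerDl.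
  - by move=> y Iy; have [] := ih y Iy.
apply: (step_bound (h := q) (k := fun y => A n.+1 y - A n y)
    (u := fun y => B n.+2 y - B n.+1 y)) => //.
- move=> y Iy; apply: is_derive_eq_val.
    by apply: is_deriveB; exact: dB.
  by rewrite mulrBr.
- by rewrite !B0 subrr.
- by move=> y Iy; rewrite lerDr.
- by move=> y Iy; have [] := ih y Iy.
Qed.

(** Partial sums of the majorant; tail is the remainder of the exponential
    series. *)
Let T K n := m0 * series (exp_coeff K) n.
Let TE K : T K @ \oo --> m0 * expR K.
Proof. by apply: cvgM; [exact: cvg_cst|exact: is_cvg_series_exp_coeff]. Qed.
Let tail K n := m0 * expR K - T K n.
Let tail0 K : tail K @ \oo --> 0.
Proof. by rewrite -(subrr (m0 * expR K)); apply: cvgB; [exact: cvg_cst|exact: TE]. Qed.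

Let g x := limn (A ^~ x).
Let k x := limn (B ^~ x).

Let gk_tail K x n : I x -> `|E x| <= K ->
  `|g x - A n x| <= tail K n /\ `|k x - B n x| <= tail K n.
Proof.
move=> Ix EK.
have inc (u : nat -> R) : (forall i, `|u i.+1 - u i| <= m0 * (`|E x| ^+ i / i`!%:R)) ->
    forall i j, (i <= j)%N -> `|u j - u i| <= T K j - T K i.
  move=> ui i j; elim: j => [|j ih]; first by rewrite leqn0 => /eqP ->; rewrite !subrr normr0.
  rewrite leq_eqVlt => /predU1P[->|/ih {}ih]; first by rewrite !subrr normr0.
  have : T K j.+1 = T K j + m0 * (K ^+ j / j`!%:R).
    by rewrite /T seriesSr mulrDr.
  move=> ->; rewrite addrAC (_ : u j.+1 - u i = (u j - u i) + (u j.+1 - u j)); last by ring.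
  apply: le_trans (ler_normD _ _) _; apply: lerD => //.
  apply: le_trans (ui j) _; apply: ler_wpM2l => //.
  by rewrite ler_wpM2r ?invr_ge0//; apply: lerXn2r; rewrite ?nnegrE// (le_trans _ EK).
split.
  apply: (cvg_dominated_increments (u := A ^~ x) (@TE K) _).2.
  by apply: inc => i; have [] := increment_bound i Ix.
apply: (cvg_dominated_increments (u := B ^~ x) (@TE K) _).2.
by apply: inc => i; have [] := increment_bound i Ix.
Qed.

(** Since E is locally bounded, the remainder is locally uniform. *)
Let limit_continuous (u : R -> R) (U : nat -> R -> R) :
  (forall n, continuous_on_itv l r (U n)) ->
  (forall K x n, I x -> `|E x| <= K -> `|u x - U n x| <= tail K n) ->
  continuous_on_itv l r u.
Proof.
move=> cU uU x Ix; apply/cvgrPdist_lt => e e0.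
have e3 : 0 < e / 3 by rewrite divr_gt0.
pose K := `|E x| + 1.
have /cvgrPdist_lt/(_ _ e3)[n _ Hn] := @tail0 K.
have tn : tail K n < e / 3.
  have := Hn n (leqnn _); rewrite sub0r normrN; apply: le_lt_trans; exact: ler_norm.
have cE : {for x, continuous E} by exact: (derive_on_continuous dE).
have nI : nbhs x I by apply: open_nbhs_nbhs; split=> //; exact: open_ereal_itv.
near=> y.
have Iy : I y by near: y.
have EyK : `|E y| <= K.
  have : `|E x - E y| < 1 by near: y; apply: cvgr_dist_lt => //; exact: cE.
  move=> h; rewrite -[E y](subrK (E x)); apply: le_trans (ler_normD _ _) _.
  by rewrite distrC /K addrC; apply: lerD => //; exact: ltW.
have h1 := uU K x n Ix; have h2 := uU K y n Iy EyK.
have {}h1 : `|u x - U n x| <= tail K n by apply: h1; rewrite /K lerDl.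
have h3 : `|U n x - U n y| < e / 3 by near: y; apply: cvgr_dist_lt => //; exact: (cU n x Ix).
rewrite (_ : u x - u y = (u x - U n x) + (U n x - U n y) - (u y - U n y)); last by ring.
apply: le_lt_trans (ler_normB _ _) _.
have := ler_normD (u x - U n x) (U n x - U n y).
have : e = e / 3 + e / 3 + e / 3 by field.
by lra.
Unshelve. all: by end_near. Qed.

Let cg : continuous_on_itv l r g.
Proof.
apply: limit_continuous => [n|K x n Ix EK]; first exact: (picard_continuous n).1.
by have [] := gk_tail n Ix EK.
Qed.

Let ck : continuous_on_itv l r k.
Proof.
apply: limit_continuous => [n|K x n Ix EK]; first exact: (picard_continuous n).2.
by have [] := gk_tail n Ix EK.
Qed.

Let E_norm_mono x y : I x -> (x0 <= y <= x) || (x <= y <= x0) -> `|E y| <= `|E x|.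
Proof.
move=> Ix /orP[] xy.
  have Iy := ereal_itv_between Ix0 Ix xy; have /andP[h1 h2] := xy.
  rewrite !ger0_norm ?E_ge0//; first exact: E_mono.
  exact: le_trans h2.
have Iy := ereal_itv_between Ix Ix0 xy; have /andP[h1 h2] := xy.
rewrite !ler0_norm ?E_le0//; last exact: le_trans h2.
by rewrite lerN2; exact: E_mono.
Qed.

(** Passing to the limit in the integral equation: the error is controlled by
    the remainders of u and of v. *)
Let limit_equation (h u : R -> R) (c : R) (U V : nat -> R -> R) (v : R -> R) :
  continuous_on_itv l r h ->
  (forall n, continuous_on_itv l r (V n)) -> continuous_on_itv l r v ->
  (forall n x, I x -> is_derive x 1 (U n.+1) (h x * V n x)) ->
  (forall n, U n.+1 x0 = c) ->
  (forall K x n, I x -> `|E x| <= K -> `|u x - U n x| <= tail K n) ->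
  (forall K x n, I x -> `|E x| <= K -> `|v x - V n x| <= tail K n) ->
  forall x, I x -> u x = c + prim (fun y => h y * v y) x.
Proof.
move=> ch cV cv dU U0 uU vV x Ix; pose K := `|E x|.
have chv : continuous_on_itv l r (fun y => h y * v y).
  by move=> y Iy; apply: continuousM; [exact: ch|exact: cv].
have dhv := prim_derive chv.
have cnh : continuous_on_itv l r (fun y => `|h y|).
  by move=> y Iy; apply: continuous_comp; [exact: ch|exact: norm_continuous].
have dnh := prim_derive cnh.
pose W := `|prim (fun y => `|h y|) x|.
have bound n : `|u x - (c + prim (fun y => h y * v y) x)| <= tail K n.+1 + tail K n * W.
  have h1 : `|u x - U n.+1 x| <= tail K n.+1 by exact: uU.
  suff h2 : `|U n.+1 x - (c + prim (fun y => h y * v y) x)| <= tail K n * W.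
    rewrite -[u x](subrK (U n.+1 x)) -addrA; apply: le_trans (ler_normD _ _) _.
    exact: lerD.
  pose F y := U n.+1 y - (c + prim (fun y => h y * v y) y).
  have dF y : I y -> is_derive y 1 F (h y * (V n y - v y)).
    move=> Iy; apply: is_derive_eq_val.
      apply: is_deriveB; first exact: dU.
      by apply: is_deriveD; exact: dhv.
    by rewrite add0r mulrBr.
  have F0 : F x0 = 0 by rewrite /F U0 oriented_integralxx addr0 subrr.
  pose G y := tail K n * prim (fun y => `|h y|) y.
  have dG y : I y -> is_derive y 1 G (tail K n * `|h y|).
    by move=> Iy; exact: (is_deriveZ (tail K n) (dnh y Iy)).
  have Fx : U n.+1 x - (c + prim (fun y => h y * v y) x) = F x by [].
  have pt y : I y -> (x0 <= y <= x) || (x <= y <= x0) ->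
      `|h y * (V n y - v y)| <= tail K n * `|h y|.
    move=> Iy xy; rewrite normrM mulrC ler_wpM2r// distrC.
    by apply: vV => //; exact: E_norm_mono.
  have tl0 : 0 <= tail K n by apply: le_trans (vV K x n Ix (lexx _)).
  rewrite Fx; have [x0x|/ltW xx0] := leP x0 x.
    have : `|F x - F x0| <= G x - G x0.
      apply: (derive_on_dominated dF dG) => // y xy; apply: pt; last by rewrite xy.
      exact: (ereal_itv_between Ix0 Ix).
    rewrite F0 subr0 => /le_trans; apply; rewrite /G oriented_integralxx mulr0 subr0.
    by rewrite ler_wpM2l// ler_norm.
  have : `|F x0 - F x| <= G x0 - G x.
    apply: (derive_on_dominated dF dG) => // y xy; apply: pt; last by rewrite xy orbT.
    exact: (ereal_itv_between Ix Ix0).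
  rewrite F0 sub0r normrN => /le_trans; apply; rewrite /G oriented_integralxx mulr0 sub0r.
  by rewrite -mulrN ler_wpM2l// /W -normrN ler_norm.
apply/eqP; rewrite -subr_eq0 -normr_le0.
have lim0 : tail K n.+1 + tail K n * W @[n --> \oo] --> (0 : R).
  have -> : (0 : R) = 0 + 0 * W by rewrite mul0r addr0.
  apply: cvgD; last by apply: cvgM; [exact: tail0|exact: cvg_cst].
  by rewrite (cvg_shiftS (tail K)); exact: tail0.
rewrite -(cvg_lim _ lim0)//; apply: limr_ge; first by apply/cvg_ex; exists 0.
by near=> n; exact: bound.
Unshelve. all: by end_near. Qed.

Lemma linear_system_solution : exists g k : R -> R,
  [/\ forall x, I x -> is_derive x 1 g (p x * k x),
      forall x, I x -> is_derive x 1 k (q x * g x), g x0 = g0 & k x0 = k0].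
Proof.
have ge x : I x -> g x = g0 + prim (fun y => p y * k y) x.
  apply: (limit_equation (U := A) (V := B)) => //.
  - by move=> n; exact: (picard_continuous n).2.
  - by move=> K y n Iy EK; have [] := gk_tail n Iy EK.
  - by move=> K y n Iy EK; have [] := gk_tail n Iy EK.
have ke x : I x -> k x = k0 + prim (fun y => q y * g y) x.
  apply: (limit_equation (U := B) (V := A)) => //.
  - by move=> n; exact: (picard_continuous n).1.
  - by move=> K y n Iy EK; have [] := gk_tail n Iy EK.
  - by move=> K y n Iy EK; have [] := gk_tail n Iy EK.
exists (fun x => g0 + prim (fun y => p y * k y) x), (fun x => k0 + prim (fun y => q y * g y) x).
split; rewrite ?oriented_integralxx ?addr0// => x Ix.
  rewrite -ke//; apply: is_derive_eq_val; last exact: add0r.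
  apply: is_deriveD; apply: prim_derive => // y Iy.
  by apply: continuousM; [exact: cp|exact: ck].
rewrite -ge//; apply: is_derive_eq_val; last exact: add0r.
apply: is_deriveD; apply: prim_derive => // y Iy.
by apply: continuousM; [exact: cq|exact: cg].
Qed.

End linear_system.

(** * Positive solutions and conjugate points *)

Section dichotomy.
Context {R : realType}.
Variables (l r : \bar R).
Local Notation I := (ereal_itv l r).
Variables (p q : R -> R) (lam : R).

(** The equation (g'/p)' = - lam q g, written as a system with k = g'/p so
    that p need not be differentiable. *)
Definition sturm_solution (g k : R -> R) :=
  (forall x, I x -> is_derive x 1 g (p x * k x)) /\
  (forall x, I x -> is_derive x 1 k (- (lam * q x) * g x)).

(** The condition on k a excludes the zero solution. *)
Definition conjugate_points :=
  exists g k a b, [/\ sturm_solution g k, I a, I b, a < b &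
    [/\ g a = 0, g b = 0 & k a != 0]].

Hypotheses (cp : continuous_on_itv l r p) (cq : continuous_on_itv l r q)
  (p0 : forall x, I x -> 0 < p x).

Lemma wronskian_constant g k h j : sturm_solution g k -> sturm_solution h j ->
  forall a b, I a -> I b -> g a * j a - h a * k a = g b * j b - h b * k b.
Proof.
move=> [dg dk] [dh dj]; pose W x := g x * j x - h x * k x.
have dW x : I x -> is_derive x 1 W 0.
  move=> Ix; apply: is_derive_eq_val.
    apply: is_deriveB; first exact: is_deriveM (dg x Ix) (dj x Ix).
    exact: is_deriveM (dh x Ix) (dk x Ix).
  by rewrite /GRing.scale/=; ring.
have dz (x : R) : I x -> is_derive x 1 (fun=> 0 : R) (0 : R).
  by move=> _; exact: is_derive_cst.
have main a b : I a -> I b -> a <= b -> W a = W b.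
  move=> Ia Ib ab; have : `|W b - W a| <= 0 - 0.
    by apply: (derive_on_dominated dW dz Ia Ib ab) => x _; rewrite normr0.
  by rewrite subr0 normr_le0 subr_eq0 => /eqP.
move=> a b Ia Ib; have [ab|/ltW ba] := leP a b; first exact: main.
by apply/esym; exact: main.
Qed.

Lemma sturm_solution_lin g k h j s : sturm_solution g k -> sturm_solution h j ->
  sturm_solution (fun x => g x + s * h x) (fun x => k x + s * j x).
Proof.
move=> [dg dk] [dh dj]; split=> x Ix.
  have dsh : is_derive x 1 (fun x => s * h x) (s * (p x * j x)).
    exact: (is_deriveZ s (dh x Ix)).
  apply: is_derive_eq_val; first exact: is_deriveD (dg x Ix) dsh.
  by ring.
have dsj : is_derive x 1 (fun x => s * j x) (s * (- (lam * q x) * h x)).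
  exact: (is_deriveZ s (dj x Ix)).
apply: is_derive_eq_val; first exact: is_deriveD (dk x Ix) dsj.
by ring.
Qed.

Lemma continuous_zero g a b : continuous_on_itv l r g -> I a -> I b -> a <= b ->
  (g a <= 0 <= g b) || (g b <= 0 <= g a) -> exists2 c, a <= c <= b & g c = 0.
Proof.
move=> cg Ia Ib ab sgn.
have [|c] := IVT ab (continuous_on_segment cg Ia Ib) (v := 0).
  by move/orP: sgn => [] /andP[h1 h2]; rewrite ge_min le_max h1 h2 ?orbT.
by rewrite in_itv/= => acb gc; exists c.
Qed.

(** Let u and v be the solutions with (g, k) = (1, 0) and (0, 1) at x0, and
    suppose that there are no conjugate points. Then v has no zero but x0. The
    quotient rho = - u/v has derivative p/v^2, since the Wronskian is 1, so it
    increases on each side of x0; the zeros of g_s = u + s v are the points where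
    rho takes the value s. If rho took a larger value at b > x0 than at a < x0,
    then for s strictly between these values g_s would have a zero on each side
    of x0. Hence all values of rho on the right are at most those on the left,
    and for s the supremum of the former g_s has no zero. *)
Lemma positive_solution_or_conjugate x0 : I x0 ->
  conjugate_points \/
  exists g k, sturm_solution g k /\ forall x, I x -> 0 < g x.
Proof.
move=> Ix0; have cNq : continuous_on_itv l r (fun x => - (lam * q x)).
  move=> x Ix; apply: continuousN; apply: continuousM; last exact: cq.
  exact: cst_continuous.
have [u [ku [du dku u0 ku0]]] := linear_system_solution 1 0 cp cNq Ix0.
have [v [kv [dv dkv v0 kv0]]] := linear_system_solution 0 1 cp cNq Ix0.
have su : sturm_solution u ku by [].
have sv : sturm_solution v kv by [].
have [conj|nconj] := pselect conjugate_points; [by left|right].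
pose g s x := u x + s * v x; pose k s x := ku x + s * kv x.
have sg s : sturm_solution (g s) (k s) by exact: sturm_solution_lin.
have gx0 s : g s x0 = 1 by rewrite /g u0 v0 mulr0 addr0.
have cu := derive_on_continuous du; have cv := derive_on_continuous dv.
have ckv := derive_on_continuous dkv.
have cgs s : continuous_on_itv l r (g s) by exact: derive_on_continuous (sg s).1.
have Wuv x : I x -> u x * kv x - v x * ku x = 1.
  by move=> Ix; rewrite (wronskian_constant su sv Ix Ix0) u0 v0 kv0 mul0r mulr1 subr0.
have Wg s x : I x -> g s x = 0 -> k s x != 0.
  move=> Ix gx; apply/eqP => kx.
  have := wronskian_constant (sg s) sv Ix Ix0.
  rewrite gx kx gx0 kv0 v0 mul0r mulr0 mul0r mulr1 !subr0 => /eqP.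
  by rewrite eq_sym oner_eq0.
have v_zero x : I x -> x != x0 -> v x != 0.
  move=> Ix xx0; apply/eqP => vx; apply: nconj.
  have kvx y : I y -> v y = 0 -> kv y != 0.
    move=> Iy vy; apply/eqP => kvy.
    by have := Wuv y Iy; rewrite vy kvy mulr0 mul0r subr0 => /eqP; rewrite eq_sym oner_eq0.
  have [h|h|h] := ltgtP x x0; last by rewrite h eqxx in xx0.
    by exists v, kv, x, x0; split=> //; split=> //; exact: kvx.
  by exists v, kv, x0, x; split=> //; split=> //; exact: kvx.
have [e e0 kv_pos] : exists2 e, 0 < e & forall y, I y -> `|y - x0| < e -> 0 < kv y.
  have : \forall y \near x0, 0 < kv y.
    have ck0 : kv x @[x --> x0] --> kv x0 by exact: (ckv x0 Ix0).
    by apply: (cvgr_gt _ ck0); rewrite kv0.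
  move=> /nbhs_ballP[e /= e0 He]; exists e => // y Iy yx.
  by apply: He; rewrite /ball/= distrC.
have v_pos x : I x -> x0 < x -> 0 < v x.
  move=> Ix x0x; rewrite ltNge; apply/negP => vx.
  (* A point so close to x0 that kv is positive from x0 up to it. *)
  pose y := x0 + Num.min e (x - x0) / 2.
  have m0 : 0 < Num.min e (x - x0) by rewrite lt_min e0 subr_gt0.
  have me : Num.min e (x - x0) <= e by rewrite ge_min lexx.
  have mx : Num.min e (x - x0) <= x - x0 by rewrite ge_min lexx orbT.
  have x0y : x0 < y by rewrite /y; lra.
  have yx : y < x by rewrite /y; lra.
  have ye : y < x0 + e by rewrite /y; lra.
  have Iy : I y by apply: (ereal_itv_between Ix0 Ix); rewrite !ltW.
  have [c [x0c cy E]] := derive_on_MVT dv Ix0 Iy x0y.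
  have Ic : I c by apply: (ereal_itv_between Ix0 Iy); rewrite !ltW.
  have vy : 0 < v y.
    rewrite v0 subr0 in E; rewrite E mulr_gt0 ?subr_gt0// mulr_gt0 ?p0//.
    by apply: kv_pos => //; rewrite gtr0_norm ?subr_gt0//; lra.
  have [|z /andP[yz zx] vz] := continuous_zero cv Iy Ix (ltW yx).
    by rewrite vx (ltW vy) orbT.
  have Iz : I z by apply: (ereal_itv_between Iy Ix); rewrite yz.
  by have := v_zero z Iz; rewrite vz eqxx gt_eqF ?(lt_le_trans x0y)// => /(_ isT).
have v_neg x : I x -> x < x0 -> v x < 0.
  move=> Ix xx0; rewrite ltNge; apply/negP => vx.
  pose y := x0 - Num.min e (x0 - x) / 2.
  have m0 : 0 < Num.min e (x0 - x) by rewrite lt_min e0 subr_gt0.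
  have me : Num.min e (x0 - x) <= e by rewrite ge_min lexx.
  have mx : Num.min e (x0 - x) <= x0 - x by rewrite ge_min lexx orbT.
  have yx0 : y < x0 by rewrite /y; lra.
  have xy : x < y by rewrite /y; lra.
  have ye : x0 - e < y by rewrite /y; lra.
  have Iy : I y by apply: (ereal_itv_between Ix Ix0); rewrite !ltW.
  have [c [yc cx0 E]] := derive_on_MVT dv Iy Ix0 yx0.
  have Ic : I c by apply: (ereal_itv_between Iy Ix0); rewrite !ltW.
  have vy : v y < 0.
    rewrite v0 sub0r in E; rewrite -oppr_gt0 E mulr_gt0 ?subr_gt0// mulr_gt0 ?p0//.
    by apply: kv_pos => //; rewrite distrC gtr0_norm ?subr_gt0//; lra.
  have [|z /andP[xz zy] vz] := continuous_zero cv Ix Iy (ltW xy).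
    by rewrite vx (ltW vy) orbT.
  have Iz : I z by apply: (ereal_itv_between Ix Iy); rewrite xz.
  by have := v_zero z Iz; rewrite vz eqxx lt_eqF ?(le_lt_trans zy)// => /(_ isT).
pose rho x := - (u x / v x).
have gE s x : v x != 0 -> g s x = v x * (s - rho x).
  by move=> vx; rewrite /g /rho; field.
have drho x : I x -> x != x0 -> is_derive x 1 rho (p x / v x ^+ 2).
  move=> Ix xx0; have vx := v_zero x Ix xx0.
  apply: is_derive_eq_val.
    apply: is_deriveN; apply: is_deriveM; first exact: du.
    exact: is_deriveV vx (dv x Ix).
  (* The Wronskian is the numerator of the derivative of the quotient. *)
  rewrite /GRing.scale/= -[p x in RHS]mulr1 -(Wuv x Ix); field.
  by [].
have rho_incr a b : I a -> I b -> a < b -> (x0 < a) || (b < x0) -> rho a < rho b.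
  move=> Ia Ib ab /orP[x0a|bx0].
    have sub : ereal_itv x0%:E r `<=` I.
      by move=> x [h1 h2]; split=> //; exact: lt_trans Ix0.1 h1.
    have dr x : ereal_itv x0%:E r x -> is_derive x 1 rho (p x / v x ^+ 2).
      move=> xr; apply: drho; first exact: sub.
      by case: xr => h _; rewrite lte_fin in h; rewrite gt_eqF.
    have Ia' : ereal_itv x0%:E r a by split; [rewrite lte_fin|exact: Ia.2].
    have Ib' : ereal_itv x0%:E r b.
      by split; [rewrite lte_fin (lt_trans x0a)|exact: Ib.2].
    have [c [ac cb E]] := derive_on_MVT dr Ia' Ib' ab.
    have Ic : I c by apply: (ereal_itv_between Ia Ib); rewrite !ltW.
    rewrite -subr_gt0 E mulr_gt0 ?subr_gt0// divr_gt0 ?p0// exprn_gt0//.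
    by rewrite v_pos// (lt_trans x0a).
  have sub : ereal_itv l x0%:E `<=` I.
    by move=> x [h1 h2]; split=> //; exact: lt_trans h2 Ix0.2.
  have dr x : ereal_itv l x0%:E x -> is_derive x 1 rho (p x / v x ^+ 2).
    move=> xr; apply: drho; first exact: sub.
    by case: xr => _ h; rewrite lte_fin in h; rewrite lt_eqF.
  have Ia' : ereal_itv l x0%:E a.
    by split; [exact: Ia.1|rewrite lte_fin (lt_trans ab)].
  have Ib' : ereal_itv l x0%:E b by split; [exact: Ib.1|rewrite lte_fin].
  have [c [ac cb E]] := derive_on_MVT dr Ia' Ib' ab.
  have Ic : I c by apply: (ereal_itv_between Ia Ib); rewrite !ltW.
  rewrite -subr_gt0 E mulr_gt0 ?subr_gt0// divr_gt0 ?p0//.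
  by rewrite exprn_even_gt0//= v_zero// lt_eqF// (lt_trans cb).
have rho_le a b : I a -> I b -> a < x0 -> x0 < b -> rho b <= rho a.
  move=> Ia Ib ax0 x0b; rewrite leNgt; apply/negP => rab.
  pose s := (rho a + rho b) / 2.
  have va := v_neg a Ia ax0; have vb := v_pos b Ib x0b.
  have ga : g s a <= 0.
    by rewrite gE ?lt_eqF// nmulr_rle0// subr_ge0 /s; lra.
  have gb : g s b <= 0.
    by rewrite gE ?gt_eqF// pmulr_rle0// subr_le0 /s; lra.
  have [|z1 /andP[az1 z1x0] gz1] := continuous_zero (cgs s) Ia Ix0 (ltW ax0).
    by rewrite ga gx0 ler01.
  have [|z2 /andP[x0z2 z2b] gz2] := continuous_zero (cgs s) Ix0 Ib (ltW x0b).
    by rewrite gb gx0 ler01 orbT.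
  have Iz1 : I z1 by apply: (ereal_itv_between Ia Ix0); rewrite az1.
  have Iz2 : I z2 by apply: (ereal_itv_between Ix0 Ib); rewrite x0z2.
  apply: nconj; exists (g s), (k s), z1, z2; split=> //.
    rewrite lt_neqAle (le_trans z1x0)// andbT; apply/eqP => z12.
    have : z1 = x0 by apply/eqP; rewrite eq_le z1x0 z12.
    by move=> h; move: gz1; rewrite h gx0 => /eqP; rewrite oner_eq0.
  by split=> //; exact: Wg.
have [a0 [b0 [Ia0 Ib0 a0x0 x0b0]]] := ereal_itv_enlarge Ix0 Ix0 (lexx _).
pose S := [set rho x | x in [set x | I x /\ x0 < x]].
have S0 : S !=set0 by exists (rho b0), b0.
have Sub a : I a -> a < x0 -> ubound S (rho a).
  by move=> Ia ax0 _ [x [Ix x0x] <-]; exact: rho_le.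
have Sb : has_sup S by split=> //; exists (rho a0); exact: Sub.
exists (g (sup S)), (k (sup S)); split=> // x Ix.
have [xx0|x0x|->] := ltgtP x x0; last by rewrite gx0.
  have [a [_ [Ia _ ax _]]] := ereal_itv_enlarge Ix Ix (lexx _).
  rewrite gE ?lt_eqF ?v_neg// nmulr_rgt0 ?v_neg// subr_lt0.
  apply: le_lt_trans (rho_incr a x Ia Ix ax _); last by rewrite xx0 orbT.
  by apply: ge_sup => //; apply: Sub => //; exact: lt_trans xx0.
have [_ [b [_ Ib _ xb]]] := ereal_itv_enlarge Ix Ix (lexx _).
rewrite gE ?gt_eqF ?v_pos// pmulr_rgt0 ?v_pos// subr_gt0.
apply: lt_le_trans (rho_incr x b Ix Ib xb _) _; first by rewrite x0x.
by apply: ub_le_sup; [exact: Sb.2|exists b => //; split=> //; exact: lt_trans xb].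
Qed.

End dichotomy.

(** * Positive solutions bound the supremum from below *)

Section sup_bound.
Context {R : realType}.
Notation mu := (@lebesgue_measure R).
Variables (M N : \bar R).
Local Notation I := (ereal_itv (- M)%E N).

(** With 1/0 = +oo and 1/oo = 0, the inequality c <= (h/y)^-1 also holds
    for h = 0 and fails for h = +oo, as c h <= y does. *)
Lemma le_inve_div (c y : R) (h : \bar R) : 0 < c -> 0 < y -> (0 <= h)%E ->
  (c%:E <= (h / y%:E)^-1)%E = (c%:E * h <= y%:E)%E.
Proof.
move=> c0 y0 h0; have yV : (0 <= y%:E^-1)%E by rewrite inve_ge0 lee_fin ltW.
rewrite inve_pge ?inE; [|by rewrite lee_fin ltW|exact: mule_ge0].
by rewrite !inver !gt_eqF// lee_pdivrMr// lee_pdivlMl.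
Qed.

Lemma h_minus_ge0 (p q f : R -> R) theta z : (forall x, I x -> 0 < f x) ->
  (forall x, I x -> 0 < p x) -> (forall x, I x -> 0 < q x) ->
  I theta -> I z -> z <= theta -> (0 <= h_minus M p q f theta z)%E.
Proof.
move=> f0 p0 q0 It Iz zt; apply: integral_ge0 => x Jx.
have Ix := ereal_itv_minus Iz Jx; rewrite mule_ge0//; last by rewrite lee_fin ltW ?p0.
apply: integral_ge0 => u /(ereal_itv_segment Ix It) Iu.
by rewrite -EFinM lee_fin mulr_ge0 ?ltW ?f0 ?q0.
Qed.

Lemma h_plus_ge0 (p q f : R -> R) theta z : (forall x, I x -> 0 < f x) ->
  (forall x, I x -> 0 < p x) -> (forall x, I x -> 0 < q x) ->
  I theta -> I z -> theta <= z -> (0 <= h_plus N p q f theta z)%E.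
Proof.
move=> f0 p0 q0 It Iz tz; apply: integral_ge0 => x Jx.
have Ix := ereal_itv_plus Iz Jx; rewrite mule_ge0//; last by rewrite lee_fin ltW ?p0.
apply: integral_ge0 => u /(ereal_itv_segment It Ix) Iu.
by rewrite -EFinM lee_fin mulr_ge0 ?ltW ?f0 ?q0.
Qed.

Section positive_solution.
Variables (p q g k : R -> R) (lam : R).
Hypotheses (cp : continuous_on_itv (- M)%E N p) (cq : continuous_on_itv (- M)%E N q)
  (p0 : forall x, I x -> 0 < p x) (q0 : forall x, I x -> 0 < q x)
  (ip : mu.-integrable I (EFin \o p)) (lam0 : 0 < lam).
Hypothesis sol : sturm_solution (- M)%E N p q lam g k.
Hypothesis g0 : forall x, I x -> 0 < g x.
Variable x0 : R.
Hypothesis Ix0 : I x0.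

Let cg : continuous_on_itv (- M)%E N g.
Proof. exact: derive_on_continuous sol.1. Qed.

Let H x := - (k x / lam).

Let dH x : I x -> is_derive x 1 H (g x * q x).
Proof.
move=> Ix; have d1 : is_derive x 1 H (- lam^-1 * (- (lam * q x) * g x)).
  have := is_deriveZ (- lam^-1) (sol.2 x Ix).
  rewrite (_ : _ \*: _ = H); first exact.
  by apply/funext => y; rewrite /H -[LHS]/(- lam^-1 * k y) mulNr mulrC.
apply: is_derive_eq_val d1 _; field; exact: lt0r_neq0.
Qed.

Let Pr := oriented_integral p x0.

Let dPr x : I x -> is_derive x 1 Pr (p x).
Proof. by move=> Ix; exact: (@oriented_integral_derive R (- M)%E N). Qed.

Let P := fine (\int[mu]_(x in I) (p x)%:E).

Let Pr_le a b : I a -> I b -> a <= b -> 0 <= Pr b - Pr a <= P.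
Proof.
move=> Ia Ib ab; have e := derive_on_integral dPr cp Ia Ib ab.
apply/andP; split; rewrite -lee_fin -e.
  apply: integral_ge0 => x xab; rewrite lee_fin ltW// p0//.
  exact: (ereal_itv_segment Ia Ib).
rewrite /P fineK; last by apply: integrable_fin_num => //; exact: measurable_ereal_itv.
apply: ge0_subset_integral => //.
- exact: measurable_ereal_itv.
- exact: continuous_on_emeasurableS cp (measurable_ereal_itv _ _) (subset_refl _).
- by move=> x Ix; rewrite lee_fin ltW// p0.
- exact: ereal_itv_segment.
Qed.

(** As g' = p k and H = - k/lam, the integrand is
    H(theta) p + g'/lam. *)
Let minus_segment theta a b : I theta -> I a -> I b -> a <= b ->
  (\int[mu]_(x in `[a, b]) ((H theta - H x) * p x)%:E =
   (H theta * (Pr b - Pr a) + (g b - g a) / lam)%:E)%E.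
Proof.
move=> It Ia Ib ab; pose Phi x := H theta * Pr x + lam^-1 * g x.
have dPhi x : I x -> is_derive x 1 Phi ((H theta - H x) * p x).
  move=> Ix; have d1 : is_derive x 1 (fun x => H theta * Pr x) (H theta * p x).
    exact: (is_deriveZ (H theta) (dPr Ix)).
  have d2 : is_derive x 1 (fun x => lam^-1 * g x) (lam^-1 * (p x * k x)).
    exact: (is_deriveZ lam^-1 (sol.1 x Ix)).
  have d3 : is_derive x 1 Phi _ := is_deriveD d1 d2.
  apply: is_derive_eq_val d3 _.
  by rewrite /H; field; exact: lt0r_neq0.
rewrite (derive_on_integral dPhi _ Ia Ib ab).
  by congr EFin; rewrite /Phi; field; exact: lt0r_neq0.
exact: (@continuous_minus_weight R M N g p q H cp dH theta).
Qed.

Let plus_segment theta a b : I theta -> I a -> I b -> a <= b ->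
  (\int[mu]_(x in `[a, b]) ((H x - H theta) * p x)%:E =
   (- (H theta * (Pr b - Pr a) + (g b - g a) / lam))%:E)%E.
Proof.
move=> It Ia Ib ab; pose Phi x := - H theta * Pr x + - lam^-1 * g x.
have dPhi x : I x -> is_derive x 1 Phi ((H x - H theta) * p x).
  move=> Ix; have d1 : is_derive x 1 (fun x => - H theta * Pr x) (- H theta * p x).
    exact: (is_deriveZ (- H theta) (dPr Ix)).
  have d2 : is_derive x 1 (fun x => - lam^-1 * g x) (- lam^-1 * (p x * k x)).
    exact: (is_deriveZ (- lam^-1) (sol.1 x Ix)).
  have d3 : is_derive x 1 Phi _ := is_deriveD d1 d2.
  apply: is_derive_eq_val d3 _.
  by rewrite /H; field; exact: lt0r_neq0.
rewrite (derive_on_integral dPhi _ Ia Ib ab).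
  by congr EFin; rewrite /Phi; field; exact: lt0r_neq0.
exact: (@continuous_plus_weight R M N g p q H cp dH theta).
Qed.

(** On the left of theta the integrand is nonnegative, so h^- is the supremum
    of the integrals over [a, z]. *)
Let minus_bound theta z (B : R) : I theta -> I z -> z <= theta ->
  (forall a, I a -> a < z -> H theta * (Pr z - Pr a) + (g z - g a) / lam <= B) ->
  (h_minus M p q g theta z <= B%:E)%E.
Proof.
move=> It Iz zt HB; rewrite (h_minusE p cg cq dH It Iz zt).
have [c [_ [Ic _ cz _]]] := ereal_itv_enlarge Iz Iz (lexx _).
have Jc : ereal_itv (- M)%E z%:E c by split; [exact: Ic.1|rewrite lte_fin].
have cw := @continuous_minus_weight R M N g p q H cp dH theta.
have w0 x : I x -> x <= z -> 0 <= (H theta - H x) * p x.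
  move=> Ix xz; rewrite mulr_ge0//; last by rewrite ltW// p0.
  rewrite subr_ge0; apply: (primitive_nondecreasing g0 q0 dH) => //.
  exact: le_trans zt.
apply: (ge0_integral_exhaust Jc).
- exact: (continuous_on_emeasurableS cw (measurable_ereal_itv _ _) (ereal_itv_minus Iz)).
- move=> x Jx; rewrite lee_fin; apply: w0; first exact: (ereal_itv_minus Iz).
  by case: Jx => _; rewrite lte_fin => /ltW.
move=> a b Ja Jb /andP[ac cb].
have Ia := ereal_itv_minus Iz Ja.
have az : a < z by case: Ja => _; rewrite lte_fin.
have bz : b < z by case: Jb => _; rewrite lte_fin.
apply: (@le_trans _ _ (\int[mu]_(x in `[a, z]) ((H theta - H x) * p x)%:E)%E).
  apply: ge0_subset_integral => //.
  - exact: (continuous_on_emeasurableS cw (measurable_itv _) (ereal_itv_segment Ia Iz)).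
  - move=> x xaz; rewrite lee_fin; apply: w0; first exact: (ereal_itv_segment Ia Iz).
    by move: xaz; rewrite /= in_itv/= => /andP[].
  - by apply: subset_itvl; rewrite bnd_simp ltW.
by rewrite (minus_segment It Ia Iz (ltW az)) lee_fin; exact: HB.
Qed.

Let plus_bound theta z (B : R) : I theta -> I z -> theta <= z ->
  (forall b, I b -> z < b -> - (H theta * (Pr b - Pr z) + (g b - g z) / lam) <= B) ->
  (h_plus N p q g theta z <= B%:E)%E.
Proof.
move=> It Iz tz HB; rewrite (h_plusE p cg cq dH It Iz tz).
have [_ [c [_ Ic _ zc]]] := ereal_itv_enlarge Iz Iz (lexx _).
have Jc : ereal_itv z%:E N c by split; [rewrite lte_fin|exact: Ic.2].
have cw := @continuous_plus_weight R M N g p q H cp dH theta.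
have w0 x : I x -> z <= x -> 0 <= (H x - H theta) * p x.
  move=> Ix zx; rewrite mulr_ge0//; last by rewrite ltW// p0.
  rewrite subr_ge0; apply: (primitive_nondecreasing g0 q0 dH) => //.
  exact: le_trans zx.
apply: (ge0_integral_exhaust Jc).
- exact: (continuous_on_emeasurableS cw (measurable_ereal_itv _ _) (ereal_itv_plus Iz)).
- move=> x Jx; rewrite lee_fin; apply: w0; first exact: (ereal_itv_plus Iz).
  by case: Jx; rewrite lte_fin => /ltW.
move=> a b Ja Jb /andP[ac cb].
have Ib := ereal_itv_plus Iz Jb.
have zb : z < b by case: Jb; rewrite lte_fin.
have za : z < a by case: Ja; rewrite lte_fin.
apply: (@le_trans _ _ (\int[mu]_(x in `[z, b]) ((H x - H theta) * p x)%:E)%E).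
  apply: ge0_subset_integral => //.
  - exact: (continuous_on_emeasurableS cw (measurable_itv _) (ereal_itv_segment Iz Ib)).
  - move=> x xzb; rewrite lee_fin; apply: w0; first exact: (ereal_itv_segment Iz Ib).
    by move: xzb; rewrite /= in_itv/= => /andP[].
  - by apply: subset_itvr; rewrite bnd_simp ltW.
by rewrite (plus_segment It Iz Ib (ltW zb)) lee_fin; exact: HB.
Qed.

(** As g is positive and p is integrable, the integrals over compact
    intervals are at most |H(theta)| P + g(z)/lam. *)
Let solution_h_finite : h_finite M N p q g.
Proof.
move=> theta z It Iz; split=> zt.
  apply: le_lt_trans (minus_bound (B := `|H theta| * P + g z / lam) It Iz zt _) _.
    move=> a Ia az; have /andP[h1 h2] := Pr_le Ia Iz (ltW az).
    apply: lerD.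
      apply: le_trans (ler_norm _) _; rewrite normrM (ger0_norm h1).
      exact: ler_wpM2l.
    by rewrite ler_pM2r ?invr_gt0// gerBl ltW// g0.
  exact: ltry.
apply: le_lt_trans (plus_bound (B := `|H theta| * P + g z / lam) It Iz zt _) _.
  move=> b Ib zb; have /andP[h1 h2] := Pr_le Iz Ib (ltW zb).
  rewrite opprD; apply: lerD.
    apply: le_trans (ler_norm _) _; rewrite normrN normrM (ger0_norm h1).
    exact: ler_wpM2l.
  by rewrite -mulNr opprB ler_pM2r ?invr_gt0// gerBl ltW// g0.
exact: ltry.
Qed.

(** If H(theta) <= 0, dropping the nonpositive terms H(theta) (Pr z - Pr a)
    and - g(a)/lam gives the left bound. At the root it becomes
    h^+(theta) <= g(theta)/lam, which says that
    - H(theta) (Pr b - Pr theta) <= g(b)/lam for all b > theta; the right bound at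
    z follows because Pr z >= Pr theta. The case H(theta) >= 0 is symmetric. *)
Let root_bounds theta : h_root M N p q g theta ->
  (forall z, I z -> z <= theta -> (h_minus M p q g theta z <= (g z / lam)%:E)%E) /\
  (forall z, I z -> theta <= z -> (h_plus N p q g theta z <= (g z / lam)%:E)%E).
Proof.
move=> [It rt]; have gl x : I x -> 0 <= g x / lam by move=> Ix; rewrite divr_ge0 ?ltW ?g0.
have cwp := @continuous_plus_weight R M N g p q H cp dH theta.
have cwm := @continuous_minus_weight R M N g p q H cp dH theta.
have [Ht|/ltW Ht] := leP (H theta) 0.
  have mb z : I z -> z <= theta -> (h_minus M p q g theta z <= (g z / lam)%:E)%E.
    move=> Iz zt; apply: (minus_bound It Iz zt) => a Ia az.
    have /andP[h1 _] := Pr_le Ia Iz (ltW az).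
    have := mulr_le0_ge0 Ht h1; have := gl a Ia; rewrite mulrBl; lra.
  split; first exact: mb.
  move=> z Iz tz; apply: (plus_bound It Iz tz) => b Ib zb.
  have tb : theta < b by exact: le_lt_trans zb.
  have : (\int[mu]_(x in `[theta, b]) ((H x - H theta) * p x)%:E <= (g theta / lam)%:E)%E.
    apply: le_trans (mb _ It (lexx _)); rewrite rt -integral_itv_obnd_cbnd; last first.
      apply: (continuous_on_emeasurableS cwp (measurable_itv _)) => x xtb.
      by apply: (ereal_itv_segment It Ib); move: x xtb; apply: subset_itvr; rewrite bnd_simp.
    apply: (integral_le_h_plus cg cp cq g0 p0 q0 dH It It (lexx _) (measurable_itv _)) => x /=.
    rewrite in_itv/= => /andP[tx xb]; split; first by rewrite lte_fin.
    by apply: le_lt_trans Ib.2; rewrite lee_fin.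
  rewrite (plus_segment It It Ib (ltW tb)) lee_fin !mulrBl.
  have /andP[h1 _] := Pr_le It Iz tz; have := mulr_le0_ge0 Ht h1.
  by have := gl b Ib; lra.
have pb z : I z -> theta <= z -> (h_plus N p q g theta z <= (g z / lam)%:E)%E.
  move=> Iz tz; apply: (plus_bound It Iz tz) => b Ib zb.
  have /andP[h1 _] := Pr_le Iz Ib (ltW zb).
  have := mulr_ge0 Ht h1; have := gl b Ib; rewrite mulrBl; lra.
split; last exact: pb.
move=> z Iz zt; apply: (minus_bound It Iz zt) => a Ia az.
have at_ : a < theta by exact: lt_le_trans zt.
have : (\int[mu]_(x in `[a, theta]) ((H theta - H x) * p x)%:E <= (g theta / lam)%:E)%E.
  apply: le_trans (pb _ It (lexx _)); rewrite -rt -integral_itv_bndo_bndc; last first.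
    apply: (continuous_on_emeasurableS cwm (measurable_itv _)) => x xtb.
    by apply: (ereal_itv_segment Ia It); move: x xtb; apply: subset_itvl; rewrite bnd_simp.
  apply: (integral_le_h_minus cg cp cq g0 p0 q0 dH It It (lexx _) (measurable_itv _)) => x /=.
  rewrite in_itv/= => /andP[ax xt]; split; last by rewrite lte_fin.
  by apply: lt_le_trans Ia.1 _; rewrite lee_fin.
rewrite (minus_segment It Ia It (ltW at_)) lee_fin !mulrBl.
have /andP[h1 _] := Pr_le Iz It zt; have := mulr_ge0 Ht h1.
by have := gl a Ia; lra.
Qed.

Lemma le_sup_lower_estimate : (lam%:E <= sup_lower_estimate M N p q)%E.
Proof.
have [theta [rt un]] := h_root_unique_exists cg cp cq g0 p0 q0 dH ip Ix0 solution_h_finite.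
have It : I theta by case: rt.
have [mb pb] := root_bounds rt.
apply: (@le_trans _ _ (lower_estimate M N p q g theta)); last first.
  apply: ereal_sup_ubound; exists g.
    by split=> //; apply/continuous_on_itvP; exact: cg.
  by left; split; [exact: solution_h_finite|exists theta].
rewrite /lower_estimate le_min; apply/andP; split; apply/ereal_infP => _ [z Jz <-].
  have Iz := ereal_itv_minus It Jz; have zt : z < theta by case: Jz => _; rewrite lte_fin.
  rewrite /II_minus le_inve_div ?g0//.
    by rewrite muleC -lee_pdivlMr//; apply: mb => //; exact: ltW.
  exact: h_minus_ge0 g0 p0 q0 It Iz (ltW zt).
have Iz := ereal_itv_plus It Jz; have tz : theta < z by case: Jz; rewrite lte_fin.
rewrite /II_plus le_inve_div ?g0//.
  by rewrite muleC -lee_pdivlMr//; apply: pb => //; exact: ltW.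
exact: h_plus_ge0 g0 p0 q0 It Iz (ltW tz).
Qed.

End positive_solution.
End sup_bound.

(** * Test functions from conjugate points *)

Section test_functions.
Context {R : realType}.
Notation mu := (@lebesgue_measure R).
Variables (M N : \bar R).
Local Notation I := (ereal_itv (- M)%E N).

Section clamped.
Variables (u u' : R -> R) (a b : R).
Hypotheses (du : forall x, I x -> is_derive x 1 u (u' x))
  (cu' : continuous_on_itv (- M)%E N u') (Ia : I a) (Ib : I b) (ab : a < b).

Let F := u \o clamp a b.

Lemma clamped_lipschitz : exists2 L, 0 < L &
  forall x y, x <= y -> `|F y - F x| <= L * (y - x).
Proof.
have cn : {within `[a, b], continuous (fun x => `|u' x|)}.
  apply: (@continuous_on_segment _ (- M)%E N) => // x Ix.
  by apply: continuous_comp; [exact: cu'|exact: norm_continuous].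
have [c _ Hc] := EVT_max (ltW ab) cn.
exists (`|u' c| + 1); first by rewrite ltr_wpDl.
move=> x y xy; set L := _ + 1.
have /andP[h1 h2] := clamp_itv x (ltW ab).
have /andP[h3 h4] := clamp_itv y (ltW ab).
have Ix : I (clamp a b x) by apply: (ereal_itv_between Ia Ib); rewrite h1.
have Iy : I (clamp a b y) by apply: (ereal_itv_between Ia Ib); rewrite h3.
have dG (z : R) : I z -> is_derive z 1 (fun z => L * z) (L * 1).
  by move=> _; exact: (is_deriveZ L (is_derive_id z 1)).
apply: (@le_trans _ _ (L * clamp a b y - L * clamp a b x)).
  apply: (derive_on_dominated du dG Ix Iy (clamp_le (ltW ab) xy)) => z /andP[xz zy].
  rewrite mulr1 /L ler_wpDr// Hc// in_itv/= (le_trans h1)//=.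
  exact: le_trans h4.
rewrite -mulrBr ler_wpM2l//; last exact: clamp_dist (ltW ab) xy.
by rewrite addr_ge0.
Qed.

Lemma clamped_absolutely_continuous (A : set R) : absolutely_continuous A F.
Proof.
have [L L0 HL] := clamped_lipschitz => e e0.
exists (e / L); first by rewrite divr_gt0.
move=> n x y Axy _; rewrite ltr_pdivlMr// => h.
apply: le_lt_trans h; rewrite mulrC mulr_sumr; apply: ler_sum => i _.
by apply: HL; have [_ []] := Axy i.
Qed.

(** Outside [a, b] the function is locally constant, so its derivative
    vanishes there. *)
Lemma clamped_D_form v : continuous_on_itv (- M)%E N v -> (forall x, I x -> 0 < v x) ->
  (integral_density v I (fun x => (derive1 F x ^+ 2)%:E) <=
   \int[mu]_(x in `[a, b]) (u' x ^+ 2 * v x)%:E)%E.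
Proof.
move=> cv v0; rewrite /integral_density.
have abI := ereal_itv_segment Ia Ib.
have dcst c (x : R) : derive1 (cst c : R -> R) x = 0.
  by rewrite derive1E derive_cst.
apply: (@ge0_le_integral_ae_l _ _ _ mu _ _ ([set a] `|` [set b])).
- exact: measurable_itv.
- exact: measurableU.
- have cuv : continuous_on_itv (- M)%E N (fun x => u' x ^+ 2 * v x).
    move=> x Ix; apply: continuousM; last exact: cv.
    by apply: continuousM; exact: cu'.
  exact: (continuous_on_emeasurableS cuv (measurable_itv _) abI).
- apply/eqP; rewrite eq_le measure_ge0 andbT.
  apply: le_trans (measureU2 _ _ _) _ => //.
  by rewrite [X in (_ + X)%E]lebesgue_measure_set1 [X in (X + _)%E]lebesgue_measure_set1 adde0.
- by move=> x Ix; rewrite mule_ge0// lee_fin ?sqr_ge0// ltW// v0.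
- by move=> x /abI Ix; rewrite lee_fin mulr_ge0 ?sqr_ge0// ltW// v0.
move=> x Ix nz nab; have xa : x != a by apply/eqP => e; apply: nab; left.
have xb : x != b by apply/eqP => e; apply: nab; right.
have near_derive1 (h : R -> R) : (\forall y \near (x : R), F y = h y) ->
    derive1 F x = derive1 h x.
  by move=> Fh; rewrite !derive1E; exact: near_eq_derive.
(* The derivative is nonzero at x, so F cannot be constant near x. *)
have out c : (\forall y \near (x : R), F y = c) -> False.
  move=> Fc; have : derive1 F x = 0.
    by rewrite (near_derive1 (cst c))// dcst.
  by move=> e; move: nz; rewrite e expr0n mul0e eqxx.
have [xa'|ax] := ltP x a.
  exfalso; apply: (out (u a)); near=> y.
  have ya : y < a by near: y; exact: lt_nbhsl.
  by rewrite /F /= /clamp (ltW ya).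
have [xb'|bx] := ltP b x.
  exfalso; apply: (out (u b)); near=> y.
  have yb : b < y by near: y; exact: lt_nbhsr.
  by rewrite /F /= /clamp !leNgt (lt_trans ab yb) yb.
have axb : a < x < b by rewrite !lt_neqAle ax bx eq_sym xa xb.
split; first by rewrite /= in_itv/= ax bx.
rewrite -EFinM lee_fin (_ : derive1 F x = u' x)//.
have /andP[lax lxb] := axb.
have Fu : \forall y \near (x : R), F y = u y.
  near=> y; have ay : a <= y by near: y; exact: lt_le_nbhsr.
  have yb : y <= b by near: y; exact: lt_le_nbhsl.
  by rewrite /F /= clamp_id// ay.
by rewrite (near_derive1 u)// derive1E; have [_ ->] := du Ix.
Unshelve. all: by end_near. Qed.

End clamped.

Lemma primitive_lt (h K : R -> R) a b : (forall x, I x -> is_derive x 1 K (h x)) ->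
  continuous_on_itv (- M)%E N h -> (forall x, I x -> 0 <= h x) -> I a -> I b -> a < b ->
  0 < h a -> K a < K b.
Proof.
move=> dK ch h0 Ia Ib ab ha.
have mono x y : I x -> I y -> x <= y -> K x <= K y.
  move=> Ix Iy; rewrite le_eqVlt => /predU1P[->//|xy].
  have [c [xc cy E]] := derive_on_MVT dK Ix Iy xy.
  rewrite -subr_ge0 E mulr_ge0 ?subr_ge0 ?(ltW xy)// h0//.
  by apply: (ereal_itv_between Ix Iy); rewrite !ltW.
have cha : h x @[x --> a] --> h a by exact: (ch a Ia).
have /nbhs_ballP[e /= e0 He] : \forall y \near a, 0 < h y by exact: (cvgr_gt _ cha).
pose y := a + Num.min e (b - a) / 2.
have m0 : 0 < Num.min e (b - a) by rewrite lt_min e0 subr_gt0.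
have me : Num.min e (b - a) <= e by rewrite ge_min lexx.
have mb : Num.min e (b - a) <= b - a by rewrite ge_min lexx orbT.
have ay : a < y by rewrite /y; lra.
have yb : y < b by rewrite /y; lra.
have ye : y < a + e by rewrite /y; lra.
have Iy : I y by apply: (ereal_itv_between Ia Ib); rewrite !ltW.
apply: (@lt_le_trans _ _ (K y)); last by apply: mono => //; exact: ltW.
have [c [ac cy E]] := derive_on_MVT dK Ia Iy ay.
rewrite -subr_gt0 E mulr_gt0 ?subr_gt0//; apply: He.
by rewrite /ball/= distrC gtr0_norm ?subr_gt0//; lra.
Qed.

Section conjugate.
Variables (p q g k : R -> R) (lam a b : R).
Hypotheses (cp : continuous_on_itv (- M)%E N p) (cq : continuous_on_itv (- M)%E N q)
  (p0 : forall x, I x -> 0 < p x) (q0 : forall x, I x -> 0 < q x) (lam0 : 0 < lam).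
Hypothesis sol : sturm_solution (- M)%E N p q lam g k.
Hypotheses (Ia : I a) (Ib : I b) (ab : a < b) (ga : g a = 0) (gb : g b = 0)
  (ka : k a != 0).

Let cg : continuous_on_itv (- M)%E N g := derive_on_continuous sol.1.
Let ck : continuous_on_itv (- M)%E N k := derive_on_continuous sol.2.

Let cpk : continuous_on_itv (- M)%E N (fun x => p x * k x ^+ 2).
Proof.
move=> x Ix; apply: continuousM; first exact: cp.
by apply: continuousM; exact: ck.
Qed.

Let cqg : continuous_on_itv (- M)%E N (fun x => q x * g x ^+ 2).
Proof.
move=> x Ix; apply: continuousM; first exact: cq.
by apply: continuousM; exact: cg.
Qed.

Let K := oriented_integral (fun x => p x * k x ^+ 2) a.
Let dK x : I x -> is_derive x 1 K (p x * k x ^+ 2).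
Proof. by move=> Ix; exact: (oriented_integral_derive cpk). Qed.
Let S := oriented_integral (fun x => q x * g x ^+ 2) a.
Let dS x : I x -> is_derive x 1 S (q x * g x ^+ 2).
Proof. by move=> Ix; exact: (oriented_integral_derive cqg). Qed.

Let K_gt0 : 0 < K b - K a.
Proof.
rewrite subr_gt0; apply: (primitive_lt dK cpk) => //.
  by move=> x Ix; rewrite mulr_ge0 ?sqr_ge0// ltW// p0.
by rewrite mulr_gt0 ?p0// exprn_even_gt0.
Qed.

(** Integration by parts: the derivative of g k is p k^2 - lam q g^2, and g k
    vanishes at both ends. *)
Let energy : K b - K a = lam * (S b - S a).
Proof.
pose W x := g x * k x - K x + lam * S x.
have dW x : I x -> is_derive x 1 W 0.
  move=> Ix; have d1 : is_derive x 1 (fun x => lam * S x) (lam * (q x * g x ^+ 2)).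
    exact: (is_deriveZ lam (dS Ix)).
  have d2 := is_deriveB (is_deriveM (sol.1 x Ix) (sol.2 x Ix)) (dK Ix).
  have d3 : is_derive x 1 W _ := is_deriveD d2 d1.
  by apply: is_derive_eq_val d3 _; rewrite /GRing.scale/=; ring.
have [c [_ _ E]] := derive_on_MVT dW Ia Ib ab.
by move: E; rewrite /W ga gb !mul0r; lra.
Qed.

Let S_gt0 : 0 < S b - S a.
Proof. by rewrite -(pmulr_rgt0 _ lam0) -energy. Qed.

(** The function g, extended by 0 and normalised. As g' = p k, its energy is
    the integral of p k^2 over [a, b], which is lam times the integral of
    q g^2. *)
Lemma conjugate_dirichlet_test : exists phi, [/\ absolutely_continuous I phi,
  compact_support_in I phi,
  integral_density q I (fun x => (phi x ^+ 2)%:E) = 1%E &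
  (integral_density (fun x => ((p x)^-1)%R) I (fun x => (derive1 phi x ^+ 2)%:E)
     <= lam%:E)%E].
Proof.
pose c := (Num.sqrt (S b - S a))^-1.
have c2 : c ^+ 2 = (S b - S a)^-1 by rewrite /c exprVn sqr_sqrtr// ltW.
pose u x := c * g x; pose u' x := c * (p x * k x).
have du x : I x -> is_derive x 1 u (u' x).
  by move=> Ix; exact: (is_deriveZ c (sol.1 x Ix)).
have cu' : continuous_on_itv (- M)%E N u'.
  move=> x Ix; apply: continuousM; first exact: cst_continuous.
  by apply: continuousM; [exact: cp|exact: ck].
have abI := ereal_itv_segment Ia Ib.
have out x : ~ (a <= x <= b) -> (u \o clamp a b) x = 0.
  move=> nx; rewrite /u /= /clamp; case: (leP x a) => xa; first by rewrite ga mulr0.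
  case: (leP x b) => xb; last by rewrite gb mulr0.
  by exfalso; apply: nx; rewrite (ltW xa).
exists (u \o clamp a b); split.
- exact: (clamped_absolutely_continuous du cu' Ia Ib ab).
- exists `[a, b]%classic; split=> //; first exact: segment_compact.
  by move=> x Ix nx; apply: out => h; apply: nx; rewrite /= in_itv.
- have qphi x : (a <= x <= b) -> (u \o clamp a b) x ^+ 2 * q x = c ^+ 2 * (q x * g x ^+ 2).
    by move=> xab; rewrite /= clamp_id// /u; ring.
  have -> : (1%E = \int[mu]_(x in `[a, b]) (c ^+ 2 * (q x * g x ^+ 2))%:E)%E.
    have dS' x : I x -> is_derive x 1 (fun x => c ^+ 2 * S x) (c ^+ 2 * (q x * g x ^+ 2)).
      by move=> Ix; exact: (is_deriveZ (c ^+ 2) (dS Ix)).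
    rewrite (derive_on_integral dS' _ Ia Ib (ltW ab)).
      by rewrite -mulrBr c2 mulVf// gt_eqF.
    move=> x Ix; apply: continuousM; first exact: cst_continuous.
    exact: cqg.
  have cqg0 x : I x -> 0 <= c ^+ 2 * (q x * g x ^+ 2).
    by move=> Ix; rewrite mulr_ge0 ?sqr_ge0// mulr_ge0 ?sqr_ge0// ltW// q0.
  apply/eqP; rewrite eq_le; apply/andP; split.
    apply: ge0_le_integral_any => [x Ix|x /abI Ix|x Ix].
    + by rewrite -EFinM lee_fin mulr_ge0 ?sqr_ge0// ltW// q0.
    + by rewrite lee_fin cqg0.
    rewrite -EFinM => nz; have xab : a <= x <= b.
      by apply: contrapT => /out e; move: nz; rewrite e expr0n mul0r eqxx.
    by split; [rewrite /= in_itv|rewrite lee_fin qphi].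
  apply: ge0_le_integral_any => [x /abI Ix|x Ix|x xab _].
  + by rewrite lee_fin cqg0.
  + by rewrite -EFinM lee_fin mulr_ge0 ?sqr_ge0// ltW// q0.
  split; first exact: abI.
  by rewrite -EFinM lee_fin qphi//; move: xab; rewrite /= in_itv.
have cVp : continuous_on_itv (- M)%E N (fun x => (p x)^-1).
  move=> x Ix; apply: continuousV; first by rewrite gt_eqF// p0.
  exact: (cp Ix).
apply: le_trans (clamped_D_form du cu' Ia Ib ab cVp _) _.
  by move=> x Ix; rewrite invr_gt0 p0.
have -> : (\int[mu]_(x in `[a, b]) (u' x ^+ 2 * (p x)^-1)%:E =
    \int[mu]_(x in `[a, b]) (c ^+ 2 * (p x * k x ^+ 2))%:E)%E.
  apply: eq_integral => x /[!inE] /abI Ix; congr EFin; rewrite /u'; field.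
  by rewrite gt_eqF// p0.
have dK' x : I x -> is_derive x 1 (fun x => c ^+ 2 * K x) (c ^+ 2 * (p x * k x ^+ 2)).
  by move=> Ix; exact: (is_deriveZ (c ^+ 2) (dK Ix)).
rewrite (derive_on_integral dK' _ Ia Ib (ltW ab)).
  by rewrite -mulrBr c2 energy mulrCA mulVf ?mulr1// gt_eqF.
move=> x Ix; apply: continuousM; first exact: cst_continuous.
exact: cpk.
Qed.

(** The function k, extended by constants and then centred at its mean m and
    normalised. As k' = - lam q g, its energy is lam^2 times the integral of
    q g^2, which is lam times the integral of p k^2 over [a, b]. The integral of
    p (k - m)^2 over [a, b] is at least that of p k^2, because the cross term is
    the integral of p k = g', which vanishes; so the variance is large enough. *)
Lemma conjugate_neumann_test : mu.-integrable I (EFin \o p) ->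
  exists phi, [/\ absolutely_continuous I phi,
  integral_density p I (fun x => (phi x)%:E) = 0%E,
  integral_density p I (fun x => (phi x ^+ 2)%:E) = 1%E &
  (integral_density (fun x => ((q x)^-1)%R) I (fun x => (derive1 phi x ^+ 2)%:E)
     <= lam%:E)%E].
Proof.
move=> ip; pose w := k \o clamp a b.
have mI : measurable (I : set (measurableTypeR R)) := measurable_ereal_itv (- M)%E N.
have abI := ereal_itv_segment Ia Ib.
have ck' : continuous_on_itv (- M)%E N (fun x => - (lam * q x) * g x).
  move=> x Ix; apply: continuousM; last exact: cg.
  apply: continuousN; apply: continuousM; first exact: cst_continuous.
  exact: cq.
have cw : continuous_on_itv (- M)%E N w.
  apply: absolutely_continuous_continuous.
  exact: (clamped_absolutely_continuous sol.2 ck' Ia Ib ab).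
have [B B0 wB] : exists2 B, 0 <= B & forall x, `|w x| <= B.
  have cn : {within `[a, b], continuous (fun x => `|k x|)}.
    apply: (@continuous_on_segment _ (- M)%E N) => // x Ix.
    by apply: continuous_comp; [exact: ck|exact: norm_continuous].
  have [c _ Hc] := EVT_max (ltW ab) cn.
  by exists `|k c| => // x; apply: Hc; rewrite in_itv/=; exact: clamp_itv (ltW ab).
have cwp : continuous_on_itv (- M)%E N (fun x => w x * p x).
  by move=> x Ix; apply: continuousM; [exact: cw|exact: cp].
have iwp : mu.-integrable I (EFin \o (fun x => w x * p x)).
  apply: (@le_integrable _ _ _ mu I mI _ (fun x => B%:E * (p x)%:E)%E).
  - exact: continuous_on_emeasurableS cwp (measurable_ereal_itv _ _) (subset_refl _).
  - move=> x Ix /=; rewrite lee_fin !normrM (ger0_norm B0).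
    by rewrite ler_wpM2r.
  - exact: integrableZl.
pose P := \int[mu]_(x in I) p x.
have P0 : 0 < P.
  rewrite -lte_fin /P /Rintegral fineK; last exact: integrable_fin_num.
  exact: integral_continuous_gt0 Ia.
pose m := (\int[mu]_(x in I) (w x * p x)) / P.
have mP : m * P = \int[mu]_(x in I) (w x * p x) by rewrite /m divfK// gt_eqF.
pose v x := (w x - m) ^+ 2 * p x.
have cwm : continuous_on_itv (- M)%E N (fun x => w x - m).
  by move=> x Ix; apply: continuousB; [exact: cw|exact: cst_continuous].
have cv : continuous_on_itv (- M)%E N v.
  move=> x Ix; apply: continuousM; last exact: cp.
  by apply: continuousM; exact: cwm.
have v0 x : I x -> 0 <= v x by move=> Ix; rewrite mulr_ge0 ?sqr_ge0// ltW// p0.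
have iv : mu.-integrable I (EFin \o v).
  apply: (@le_integrable _ _ _ mu I mI _ (fun x => ((B + `|m|) ^+ 2)%:E * (p x)%:E)%E).
  - exact: continuous_on_emeasurableS cv (measurable_ereal_itv _ _) (subset_refl _).
  - move=> x Ix /=; rewrite /v lee_fin [leLHS]normrM [leRHS]normrM ler_wpM2r//.
    rewrite !normrX lerXn2r ?nnegrE// [leRHS]ger0_norm ?addr_ge0//.
    by apply: le_trans (ler_normB _ _) _; apply: lerD.
  - exact: integrableZl.
pose V := \int[mu]_(x in I) v x.
have VE : (V%:E = \int[mu]_(x in I) (v x)%:E)%E.
  by rewrite /V /Rintegral fineK//; exact: integrable_fin_num.
have KV : K b - K a <= V.
  pose Pr := oriented_integral p a.
  have dPr x : I x -> is_derive x 1 Pr (p x).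
    by move=> Ix; exact: (oriented_integral_derive cp).
  (* A primitive of p (k - m)^2, in which the middle term vanishes at a and at b. *)
  pose Phi x := K x + - (2 * m) * g x + m ^+ 2 * Pr x.
  have dPhi x : I x -> is_derive x 1 Phi ((k x - m) ^+ 2 * p x).
    move=> Ix.
    have d1 : is_derive x 1 (fun x => m ^+ 2 * Pr x) (m ^+ 2 * p x).
      exact: (is_deriveZ (m ^+ 2) (dPr _ Ix)).
    have d2 : is_derive x 1 (fun x => - (2 * m) * g x) (- (2 * m) * (p x * k x)).
      exact: (is_deriveZ (- (2 * m)) (sol.1 x Ix)).
    have d3 : is_derive x 1 Phi _ := is_deriveD (is_deriveD (dK Ix) d2) d1.
    by apply: is_derive_eq_val d3 _; ring.
  have ckm : continuous_on_itv (- M)%E N (fun x => (k x - m) ^+ 2 * p x).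
    move=> x Ix; apply: continuousM; last exact: cp.
    have h : {for x, continuous (fun x => k x - m)}.
      by apply: continuousB; [exact: (ck Ix)|exact: cst_continuous].
    by apply: continuousM; exact: h.
  have e := derive_on_integral dPhi ckm Ia Ib (ltW ab).
  have Prab : Pr a <= Pr b.
    apply/ltW/(primitive_lt dPr cp) => //; last exact: p0.
    by move=> x Ix; rewrite ltW// p0.
  apply: (@le_trans _ _ (Phi b - Phi a)).
    rewrite /Phi ga gb !mulr0; have : 0 <= m ^+ 2 * (Pr b - Pr a).
      by rewrite mulr_ge0 ?sqr_ge0// subr_ge0.
    by rewrite mulrBr; lra.
  rewrite -lee_fin VE -e.
  apply: (@le_trans _ _ (\int[mu]_(x in `[a, b]) (v x)%:E)%E).
    rewrite le_eqVlt; apply/orP; left; apply/eqP; apply: eq_integral => x /[!inE] xab.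
    by rewrite /v /w /= clamp_id//; move: xab; rewrite /= in_itv.
  apply: ge0_subset_integral => //.
  - exact: continuous_on_emeasurableS cv (measurable_ereal_itv _ _) (subset_refl _).
have V0 : 0 < V := lt_le_trans K_gt0 KV.
pose c := (Num.sqrt V)^-1.
have c2 : c ^+ 2 = V^-1 by rewrite /c exprVn sqr_sqrtr// ltW.
pose u x := c * (k x - m); pose u' x := c * (- (lam * q x) * g x).
have du x : I x -> is_derive x 1 u (u' x).
  move=> Ix; have d1 := is_deriveB (sol.2 x Ix) (is_derive_cst m x 1).
  have d2 : is_derive x 1 u _ := is_deriveZ c d1.
  by apply: is_derive_eq_val d2 _; rewrite subr0.
have cu' : continuous_on_itv (- M)%E N u'.
  by move=> x Ix; apply: continuousM; [exact: cst_continuous|exact: ck'].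
exists (u \o clamp a b); split.
- exact: (clamped_absolutely_continuous du cu' Ia Ib ab).
- have i1 : mu.-integrable I (EFin \o (fun x => c * (w x * p x))).
    exact: (integrableZl mI c iwp).
  have i2 : mu.-integrable I (EFin \o (fun x => c * m * p x)).
    exact: (integrableZl mI (c * m) ip).
  have e0 : \int[mu]_(x in I) (c * (w x * p x) - c * m * p x) = 0.
    rewrite RintegralB// RintegralZl// RintegralZl// -mP -/P; ring.
  rewrite /integral_density.
  transitivity (\int[mu]_(x in I) (c * (w x * p x) - c * m * p x)%:E)%E.
    apply: eq_integral => x _; rewrite -EFinM; congr EFin.
    by rewrite /u /w /=; ring.
  rewrite -[LHS]fineK ?[fine _]e0//; apply: integrable_fin_num => //.
  exact: (integrableB mI i1 i2).
- rewrite /integral_density.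
  transitivity (\int[mu]_(x in I) ((c ^+ 2)%:E * (v x)%:E))%E.
    apply: eq_integral => x _; rewrite -!EFinM; congr EFin.
    by rewrite /u /v /w /=; ring.
  rewrite (integralZl mI iv) -VE -EFinM c2 mulVf// gt_eqF//.
have cVq : continuous_on_itv (- M)%E N (fun x => (q x)^-1).
  move=> x Ix; apply: continuousV; first by rewrite gt_eqF// q0.
  exact: (cq Ix).
apply: le_trans (clamped_D_form du cu' Ia Ib ab cVq _) _.
  by move=> x Ix; rewrite invr_gt0 q0.
have -> : (\int[mu]_(x in `[a, b]) (u' x ^+ 2 * (q x)^-1)%:E =
    \int[mu]_(x in `[a, b]) (c ^+ 2 * lam ^+ 2 * (q x * g x ^+ 2))%:E)%E.
  apply: eq_integral => x /[!inE] /abI Ix; congr EFin; rewrite /u'; field.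
  by rewrite gt_eqF// q0.
have dS' x : I x -> is_derive x 1 (fun x => c ^+ 2 * lam ^+ 2 * S x)
    (c ^+ 2 * lam ^+ 2 * (q x * g x ^+ 2)).
  by move=> Ix; exact: (is_deriveZ (c ^+ 2 * lam ^+ 2) (dS Ix)).
rewrite (derive_on_integral dS' _ Ia Ib (ltW ab)); last first.
  by move=> x Ix; apply: continuousM; [exact: cst_continuous|exact: cqg].
rewrite lee_fin -mulrBr c2.
have -> : V^-1 * lam ^+ 2 * (S b - S a) = lam * (V^-1 * (K b - K a)).
  by rewrite energy; ring.
rewrite -[leRHS]mulr1 ler_wpM2l ?(ltW lam0)//.
by rewrite mulrC ler_pdivrMr// mul1r.
Qed.

End conjugate.
End test_functions.

(** * The two variational identities *)

Section duality.
Context {R : realType}.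
Notation mu := (@lebesgue_measure R).
Variables (M N : \bar R) (p q : R -> R).
Local Notation I := (ereal_itv (- M)%E N).
Hypotheses (cp : continuous_on_itv (- M)%E N p) (cq : continuous_on_itv (- M)%E N q)
  (p0 : forall x, I x -> 0 < p x) (q0 : forall x, I x -> 0 < q x)
  (ip : mu.-integrable I (EFin \o p)).
Variable x0 : R.
Hypothesis Ix0 : I x0.

Let mI : measurable (I : set (measurableTypeR R)) := measurable_ereal_itv (- M)%E N.

Lemma ereal_between (D E : \bar R) : (0 <= D)%E -> (D < E)%E ->
  exists2 c, 0 < c & (D < c%:E)%E /\ (c%:E < E)%E.
Proof.
move: D E => [d| |] [e| |]//; rewrite ?lee_fin ?lte_fin// => d0 de.
  by exists ((d + e) / 2); [lra|rewrite !lte_fin; split; lra].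
by exists (d + 1); [lra|rewrite lte_fin ltry; split=> //; lra].
Qed.

(** To bound a contribution by D it is enough to consider the real c > 0 that
    lie above D and below the estimate. For them the hypotheses of the lower
    bounds hold, whence c <= D, a contradiction. *)
Lemma contribution_le f v (D : \bar R) : Cplus M N f -> contribution M N p q f v ->
  (0 <= D)%E ->
  (forall theta c, I theta -> 0 < c ->
    (forall z, I z -> z < theta -> (c%:E * h_minus M p q f theta z <= (f z)%:E)%E) ->
    (forall z, I z -> theta < z -> (c%:E * h_plus N p q f theta z <= (f z)%:E)%E) ->
    (c%:E <= D)%E) ->
  (v <= D)%E.
Proof.
move=> [_ f0] [[_ [theta [[It _] _] ->]]|[_ ->]]// D0 H.
rewrite leNgt; apply/negP => /(ereal_between D0)[c c0 [Dc cE]].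
suff : (c%:E <= D)%E by rewrite leNgt Dc.
move: cE; rewrite /lower_estimate lt_min => /andP[cm cP].
apply: (H theta) => // z Iz zt.
  rewrite -le_inve_div ?f0//; last exact: h_minus_ge0 f0 p0 q0 It Iz (ltW zt).
  apply: (le_trans (ltW cm)); apply: ereal_inf_lbound; exists z => //.
  by split; [case: Iz|rewrite lte_fin].
rewrite -le_inve_div ?f0//; last exact: h_plus_ge0 f0 p0 q0 It Iz (ltW zt).
apply: (le_trans (ltW cP)); apply: ereal_inf_lbound; exists z => //.
by split; [rewrite lte_fin|case: Iz].
Qed.

(** The contribution of the constant 1 is nonnegative in either case. *)
Lemma sup_lower_estimate_ge0 : (0 <= sup_lower_estimate M N p q)%E.
Proof.
have f0 (x : R) : I x -> 0 < cst (1 : R) x by [].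
have cf : continuous_on_itv (- M)%E N (cst (1 : R)) by move=> x _; exact: cst_continuous.
have C1 : Cplus M N (cst (1 : R)) by split=> //; apply/continuous_on_itvP.
have [hf|hf] := pselect (h_finite M N p q (cst 1)); last first.
  by apply: ereal_sup_ubound; exists (cst 1) => //; right.
pose H := oriented_integral (fun x => cst 1 x * q x) x0.
have dH x : I x -> is_derive x 1 H (cst 1 x * q x).
  move=> Ix; apply: (@oriented_integral_derive R (- M)%E N) => // y Iy.
  by apply: continuousM; [exact: cf|exact: cq].
have [theta [rt un]] := h_root_unique_exists cf cp cq f0 p0 q0 dH ip Ix0 hf.
have It : I theta by case: rt.
apply: (@le_trans _ _ (lower_estimate M N p q (cst 1) theta)); last first.
  by apply: ereal_sup_ubound; exists (cst 1) => //; left; split=> //; exists theta.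
rewrite /lower_estimate le_min; apply/andP; split; apply/ereal_infP => _ [z Jz <-].
  have Iz := ereal_itv_minus It Jz; have zt : z < theta by case: Jz => _; rewrite lte_fin.
  rewrite /II_minus inve_ge0 mule_ge0 ?inve_ge0//.
  exact: h_minus_ge0 f0 p0 q0 It Iz (ltW zt).
have Iz := ereal_itv_plus It Jz; have tz : theta < z by case: Jz; rewrite lte_fin.
rewrite /II_plus inve_ge0 mule_ge0 ?inve_ge0//.
exact: h_plus_ge0 f0 p0 q0 It Iz (ltW tz).
Qed.

(** A real lam strictly between the supremum and D would admit neither a
    positive solution nor conjugate points. *)
Lemma le_sup_lower_estimate_conjugate (D : \bar R) :
  (forall lam, 0 < lam -> conjugate_points (- M)%E N p q lam -> (D <= lam%:E)%E) ->
  (D <= sup_lower_estimate M N p q)%E.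
Proof.
move=> H; rewrite leNgt; apply/negP => /(ereal_between sup_lower_estimate_ge0).
move=> [lam lam0 [slam lamD]].
have [cj|[g [k [sol g0]]]] := positive_solution_or_conjugate lam cp cq p0 Ix0.
  by have := H _ lam0 cj; rewrite leNgt lamD.
have := le_sup_lower_estimate cp cq p0 q0 ip lam0 sol g0 Ix0.
by rewrite leNgt slam.
Qed.

Lemma energy_ge0 (w phi : R -> R) : (forall x, I x -> 0 < w x) ->
  (0 <= integral_density (fun x => ((w x)^-1)%R) I (fun x => (derive1 phi x ^+ 2)%:E))%E.
Proof.
move=> w0; apply: integral_ge0 => x Ix.
by rewrite -EFinM lee_fin mulr_ge0 ?sqr_ge0// invr_ge0 ltW// w0.
Qed.

Lemma dirichlet_duality :
  ereal_inf [set integral_density (fun x => ((p x)^-1)%R) I (fun x => (derive1 phi x ^+ 2)%:E)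
    | phi in [set phi | [/\ absolutely_continuous I phi, compact_support_in I phi &
        integral_density q I (fun x => (phi x ^+ 2)%:E) = 1%E]]] =
  sup_lower_estimate M N p q.
Proof.
apply/eqP; rewrite eq_le; apply/andP; split.
  apply: le_sup_lower_estimate_conjugate => lam lam0.
  move=> [g [k [a [b [sol Ia Ib ab [ga gb ka]]]]]].
  have [phi [ac cs n1 D]] := conjugate_dirichlet_test cp cq p0 q0 lam0 sol Ia Ib ab ga gb ka.
  by apply: le_trans D; apply: ereal_inf_lbound; exists phi.
apply: ge_ereal_sup => v [f Cf cv]; apply/ereal_infP => _ [phi [ac cs n1] <-].
apply: (contribution_le Cf cv); first exact: energy_ge0.
move=> theta c It c0 Hm Hp; have [/continuous_on_itvP cf f0] := Cf.
by have := dirichlet_lower_bound cf cp cq f0 p0 q0 It c0 Hm Hp ac cs; rewrite n1 mule1.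
Qed.

(** Expanding the square, the cross term vanishes and a nonnegative term is
    added. The function F p is integrable because |F| <= 1 + F^2. *)
Lemma le_integral_sqr_centered (F : R -> R) m : continuous_on_itv (- M)%E N F ->
  integral_density p I (fun x => (F x)%:E) = 0%E ->
  integral_density p I (fun x => (F x ^+ 2)%:E) = 1%E ->
  (1 <= integral_density p I (fun x => ((F x - m) ^+ 2)%:E))%E.
Proof.
move=> cF; rewrite /integral_density => F0 F1.
have F2p0 (x : R) : I x -> 0 <= F x ^+ 2 * p x by move=> Ix; rewrite mulr_ge0 ?sqr_ge0// ltW ?p0.
have cFp : continuous_on_itv (- M)%E N (fun x => F x * p x).
  by move=> x Ix; apply: continuousM; [exact: cF|exact: cp].
have cF2p : continuous_on_itv (- M)%E N (fun x => F x ^+ 2 * p x).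
  move=> x Ix; apply: continuousM; last exact: cp.
  by apply: continuousM; exact: cF.
have mF2 := continuous_on_emeasurableS cF2p (measurable_ereal_itv _ _) (@subset_refl _ I).
have iF2 : mu.-integrable I (EFin \o (fun x => F x ^+ 2 * p x)).
  apply/integrableP; split; first exact: mF2.
  under eq_integral => x /[!inE] Ix do rewrite gee0_abs ?lee_fin ?F2p0//=.
  by rewrite (_ : (\int[mu]_(x in I) (F x ^+ 2 * p x)%:E)%E = 1%E) ?ltry.
have iF : mu.-integrable I (EFin \o (fun x => F x * p x)).
  apply: (@le_integrable _ _ _ mu I mI _ (EFin \o (fun x => p x + F x ^+ 2 * p x))).
  - exact: continuous_on_emeasurableS cFp (measurable_ereal_itv _ _) (subset_refl _).
  - move=> x Ix /=; rewrite lee_fin normrM (gtr0_norm (p0 Ix)).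
    rewrite [leRHS]ger0_norm ?addr_ge0 ?F2p0 ?(ltW (p0 Ix))//.
    rewrite (_ : p x + _ = (1 + `|F x| ^+ 2) * p x); last first.
      by rewrite real_normK ?num_real//; ring.
    rewrite ler_wpM2r ?(ltW (p0 Ix))//.
    by have := sqr_ge0 (`|F x| - 1); rewrite sqrrB; have := normr_ge0 (F x); lra.
  - exact: (integrableD mI ip iF2).
have i1 : mu.-integrable I (EFin \o (fun x => (- (2 * m)) * (F x * p x))).
  exact: (integrableZl mI (- (2 * m)) iF).
have i2 : mu.-integrable I (EFin \o (fun x => m ^+ 2 * p x)).
  exact: (integrableZl mI (m ^+ 2) ip).
have e : (\int[mu]_(x in I) (((F x - m) ^+ 2)%:E * (p x)%:E) =
    \int[mu]_(x in I) (F x ^+ 2 * p x)%:E + (\int[mu]_(x in I) (- (2 * m) * (F x * p x))%:E +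
    \int[mu]_(x in I) (m ^+ 2 * p x)%:E))%E.
  rewrite -(integralD mI i1 i2) -(integralD mI iF2 (integrableD mI i1 i2)).
  by apply: eq_integral => x _ /=; rewrite -!EFinM -!EFinD; congr EFin; ring.
rewrite e (_ : (\int[mu]_(x in I) (F x ^+ 2 * p x)%:E)%E = 1%E)//.
rewrite [X in (_ + (X + _))%E](_ : _ = 0%E).
  rewrite add0e leeDl//; apply: integral_ge0 => x Ix.
  by rewrite lee_fin mulr_ge0 ?sqr_ge0// ltW ?p0.
transitivity ((- (2 * m))%:E * \int[mu]_(x in I) (F x * p x)%:E)%E.
  exact: (integralZl mI iF).
by rewrite (_ : (\int[mu]_(x in I) (F x * p x)%:E)%E = 0%E) ?mule0.
Qed.

Lemma neumann_duality :
  ereal_inf [set integral_density (fun x => ((q x)^-1)%R) I (fun x => (derive1 phi x ^+ 2)%:E)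
    | phi in [set phi | [/\ absolutely_continuous I phi,
        integral_density p I (fun x => (phi x)%:E) = 0%E &
        integral_density p I (fun x => (phi x ^+ 2)%:E) = 1%E]]] =
  sup_lower_estimate M N p q.
Proof.
apply/eqP; rewrite eq_le; apply/andP; split.
  apply: le_sup_lower_estimate_conjugate => lam lam0.
  move=> [g [k [a [b [sol Ia Ib ab [ga gb ka]]]]]].
  have [phi [ac m0 n1 D]] := conjugate_neumann_test cp cq p0 q0 lam0 sol Ia Ib ab ga gb ka ip.
  by apply: le_trans D; apply: ereal_inf_lbound; exists phi.
apply: ge_ereal_sup => v [f Cf cv]; apply/ereal_infP => _ [phi [ac m0 n1] <-].
apply: (contribution_le Cf cv); first exact: energy_ge0.
move=> theta c It c0 Hm Hp; have [/continuous_on_itvP cf f0] := Cf.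
apply: le_trans (neumann_lower_bound_centered cf cp cq f0 p0 q0 It c0 Hm Hp ac).
rewrite -[leLHS]mule1 lee_wpmul2l ?lee_fin ?(ltW c0)//.
exact: le_integral_sqr_centered (absolutely_continuous_continuous ac) m0 n1.
Qed.

End duality.

(** * The densities of the diffusion *)

Section diffusion_densities.
Context {R : realType}.
Notation mu := (@lebesgue_measure R).
Variables (M N : \bar R) (x0 : R) (a b : R -> R).
Local Notation I := (ereal_itv (- M)%E N).
Hypotheses (ca : continuous_on_itv (- M)%E N a) (cb : continuous_on_itv (- M)%E N b)
  (a0 : forall x, I x -> 0 < a x) (Ix0 : I x0).

Lemma continuous_C_fun : continuous_on_itv (- M)%E N (C_fun x0 a b).
Proof.
have cba : continuous_on_itv (- M)%E N (fun u => b u / a u).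
  move=> x Ix; apply: continuousM; first exact: cb.
  by apply: continuousV; [rewrite gt_eqF ?a0|exact: (ca Ix)].
have d x : I x -> is_derive x 1 (C_fun x0 a b) (b x / a x).
  by move=> Ix; exact: (oriented_integral_derive cba).
exact: derive_on_continuous d.
Qed.

Lemma continuous_mu_density : continuous_on_itv (- M)%E N (mu_density x0 a b).
Proof.
move=> x Ix; apply: continuousM.
  by apply: continuous_comp; [exact: continuous_C_fun|exact: continuous_expR].
by apply: continuousV; [rewrite gt_eqF ?a0|exact: (ca Ix)].
Qed.

Lemma mu_density_gt0 x : I x -> 0 < mu_density x0 a b x.
Proof. by move=> Ix; rewrite divr_gt0 ?expR_gt0 ?a0. Qed.

Lemma continuous_nu_density : continuous_on_itv (- M)%E N (nu_density x0 a b).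
Proof.
move=> x Ix; apply: continuous_comp; last exact: continuous_expR.
by apply: continuousN; exact: continuous_C_fun.
Qed.

Lemma nu_density_gt0 x : I x -> 0 < nu_density x0 a b x.
Proof. by move=> _; exact: expR_gt0. Qed.

Lemma D_form_nu f : D_form M N x0 a b f =
  integral_density (fun x => ((nu_density x0 a b x)^-1)%R) I (fun x => (derive1 f x ^+ 2)%:E).
Proof. by apply: eq_integral => x _; rewrite /nu_density expRN invrK. Qed.

Lemma L2mu_norm1 f : L2mu_norm M N x0 a b f = 1%E <->
  integral_density (mu_density x0 a b) I (fun x => (f x ^+ 2)%:E) = 1%E.
Proof.
rewrite /L2mu_norm; set J := integral_density _ _ _.
have J0 : (0 <= J)%E.
  by apply: integral_ge0 => x Ix; rewrite -EFinM lee_fin mulr_ge0 ?sqr_ge0// ltW ?mu_density_gt0.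
split=> [e|->]; last by rewrite poweR1r.
have e2 : (J `^ (2^-1 * 2))%E = 1%E by rewrite poweRrM e poweR1r.
by rewrite -[LHS](poweRe1 J0) -e2 mulVf// pnatr_eq0.
Qed.

Lemma integrable_finite_density (w : R -> R) : continuous_on_itv (- M)%E N w ->
  (forall x, I x -> 0 < w x) -> (integral_density w I (fun=> 1) < +oo)%E ->
  mu.-integrable I (EFin \o w).
Proof.
move=> cw w0 h; apply/integrableP; split.
  exact: continuous_on_emeasurableS cw (measurable_ereal_itv _ _) (subset_refl _).
apply: le_lt_trans h; rewrite le_eqVlt; apply/orP; left; apply/eqP.
by apply: eq_integral => x /[!inE] Ix; rewrite mul1e gee0_abs// lee_fin ltW ?w0.
Qed.

End diffusion_densities.

Unset Implicit Arguments.

Theorem theorem4p2 (R : realType) (M N : \bar R) (x0 : R) (a b : R -> R)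
    (hM : (0 < M)%E) (hN : (0 < N)%E) (hx0 : ereal_itv (- M)%E N x0)
    (ha : {within ereal_itv (- M)%E N, continuous a})
    (hb : {within ereal_itv (- M)%E N, continuous b})
    (a_gt0 : forall x, ereal_itv (- M)%E N x -> 0 < a x) :
  let mu := mu_density x0 a b in
  let nu := nu_density x0 a b in
  ((integral_density nu (ereal_itv (- M)%E N) (fun=> 1) < +oo)%E ->
     lambdaDD M N x0 a b = sup_lower_estimate M N nu mu) /\
  ((integral_density mu (ereal_itv (- M)%E N) (fun=> 1) < +oo)%E ->
     lambdaNN M N x0 a b = sup_lower_estimate M N mu nu).
Proof.
move=> mu nu; have ca := (continuous_on_itvP _ _ _).1 ha.
have cb := (continuous_on_itvP _ _ _).1 hb.
have cmu : continuous_on_itv (- M)%E N mu := continuous_mu_density ca cb a_gt0 hx0.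
have cnu : continuous_on_itv (- M)%E N nu := continuous_nu_density ca cb a_gt0 hx0.
have mu0 x : ereal_itv (- M)%E N x -> 0 < mu x by exact: mu_density_gt0.
have nu0 x : ereal_itv (- M)%E N x -> 0 < nu x by exact: nu_density_gt0.
split=> fin.
  rewrite -(dirichlet_duality cnu cmu nu0 mu0 (integrable_finite_density cnu nu0 fin) hx0).
  congr ereal_inf; apply/seteqP; split=> _ [f [ac cs n1] <-]; exists f; rewrite ?D_form_nu//;
    by split=> //; apply/(L2mu_norm1 x0 b a_gt0).
rewrite -(neumann_duality cmu cnu mu0 nu0 (integrable_finite_density cmu mu0 fin) hx0).
congr ereal_inf; apply/seteqP; split=> _ [f [ac m0 n1] <-]; exists f; rewrite ?D_form_nu//;
  by split=> //; apply/(L2mu_norm1 x0 b a_gt0).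
Qed.
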